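(* Let $\mathbb T^n_\theta$ be a strictly irrational noncommutative torus of dimension $n$, $\mathcal A=C^\infty(\mathbb T^n_\theta)$, let $k>0$ be an (invertible, smooth) element of the copy $\mathcal A^o$ of $\mathcal A$ in the commutant of $\mathcal A$, and let $D_k=kDk$ be the conformal rescaling of the flat Dirac operator $D=\sum_j\gamma^j\delta_j$. Then $D_k$ is torsion free, that is, for all one-forms $u,v,w\in\Omega^1_{D_k}(\mathcal A)$, $$\mathcal T(u,v,w)=\mathcal W\bigl(u\,v\,w\,D_k\,|D_k|^{-n}\bigr)=0 .$$
   Context: $C^\infty(\mathbb T^n_\theta)$ is the smooth algebra of the noncommutative $n$-torus generated by unitaries $U_1,\dots,U_n$ with $U_pU_q=e^{2\pi i\theta_{pq}}U_qU_p$ ($\theta$ a real antisymmetric matrix). Its standard commuting derivations are $\delta_j(U_l)=\delta_{jl}U_l$, and $\tau$ is the standard normalized trace, with $\tau\circ\delta_j=0$. ''Strictly irrational'' means that the centre of the algebra is trivial. The Hilbert space $\mathcal H$ is $L^2(\mathbb T^n_\theta,\tau)$ (tensored with the finite-dimensional space on which the gamma matrices act). $\mathcal A$ acts by left multiplication and $\mathcal A^o$ by right multiplication. $\gamma^j$ are the usual Hermitian gamma matrices, with $\gamma^i\gamma^j+\gamma^j\gamma^i=2\delta^{ij}$. $\Omega^1_{D_k}(\mathcal A)$ is the $\mathcal A$-bimodule generated by the commutators $[D_k,a]$, $a\in\mathcal A$; it is a free left module generated by $k^2\gamma^j$. $\hat{\mathcal A}$ is the algebra generated by $\mathcal A$ and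 $\mathcal A^o$. The derivations extend to it by acting on both factors. In the strictly irrational case the trace on $\hat{\mathcal A}$, still denoted $\tau$, factorizes: $\tau(ab^o)=\tau(a)\tau(b)$ for $a\in\mathcal A$, $b^o\in\mathcal A^o$. The pseudodifferential calculus is the Connes–Moscovici calculus on the noncommutative torus with symbols $\rho:\mathbb R^n\to\hat{\mathcal A}$ (tensored with matrices acting on the gamma-matrix space). The operator $\delta_j$ has symbol $\xi_j$, elements of $\hat{\mathcal A}$ have constant symbols, and symbols compose by $\sigma(PQ)\sim\sum_{\alpha}\frac1{\alpha!}\,\partial_\xi^\alpha\sigma(P)\,\delta^\alpha\sigma(Q)$. The noncommutative residue is $\mathcal W(P)=\int_{\|\xi\|=1}\tau\bigl(\mathrm{Tr}\,\sigma_{-n}(P)(\xi)\bigr)\,d\xi$, where $\sigma_{-n}(P)$ is the homogeneous component of degree $-n$ of the symbol and $\mathrm{Tr}$ is the trace over the gamma-matrix space. Inverse powers of $|D_k|$ are taken on the orthogonal complement of the kernel. *)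

(* Defs.v *)
From HB Require Import structures.
From mathcomp Require Import all_boot all_order all_algebra.
From mathcomp Require Export complex.
From mathcomp Require Import all_classical all_reals all_analysis.
Set Implicit Arguments.
Unset Strict Implicit.
Unset Printing Implicit Defensive.
Import Order.TTheory GRing.Theory Num.Theory numFieldNormedType.Exports.
Local Open Scope classical_set_scope.
Local Open Scope ring_scope.
Local Open Scope complex_scope.

(* A smooth element of the noncommutative n-torus is its rapidly decreasing
   family of Fourier coefficients: a stands for sum_m a(m) U^m, where
   U^m = exp(- pi i sum_(p < q) theta_pq m_p m_q) U_1^m_1 ... U_n^m_n is the
   Weyl monomial, so that
   U^l U^m = exp(pi i sum_(p, q) theta_pq l_p m_q) U^(l + m).
   In the same way a vector of L^2 (x) C^N is a family of columns.  Operators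
   are functions on all families; only their values on the smooth
   (rapidly decreasing) ones are meaningful, and every condition below is
   restricted to those. *)

Section NCTorus.
Context {R : realType} {n : nat}.

Definition rsum (f : 'rV[int]_n -> R) : R :=
  fine (\esum_(m in setT) (Num.max (f m) 0)%:E)
  - fine (\esum_(m in setT) (Num.max (- f m) 0)%:E).

(* Absolutely convergent sums over Z^n. *)
Definition csum (f : 'rV[int]_n -> R[i]) : R[i] :=
  rsum (fun m => complex.Re (f m)) +i* rsum (fun m => complex.Im (f m)).

Definition cnorm (z : R[i]) : R :=
  Num.sqrt (complex.Re z ^+ 2 + complex.Im z ^+ 2).

Definition enorm (x : 'rV[R]_n) : R := Num.sqrt (\sum_j x 0 j ^+ 2).

Definition realv (m : 'rV[int]_n) : 'rV[R]_n := map_mx intr m.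

Definition smooth (a : 'rV[int]_n -> R[i]) : Prop :=
  forall K : nat, exists C : R, forall m,
    cnorm (a m) * (1 + enorm (realv m)) ^+ K <= C.

Definition tau (a : 'rV[int]_n -> R[i]) : R[i] := a 0.

Definition scalarA (c : R[i]) : 'rV[int]_n -> R[i] :=
  fun m => if m == 0 then c else 0.

Variable theta : 'M[R]_n.

Definition phase (l m : 'rV[int]_n) : R[i] :=
  let t := pi * \sum_p \sum_q theta p q * (l 0 p)%:~R * (m 0 q)%:~R in
  cos t +i* sin t.

Definition mulA (a b : 'rV[int]_n -> R[i]) : 'rV[int]_n -> R[i] :=
  fun m => csum (fun l => a l * b (m - l) * phase l (m - l)).

Definition strictly_irrational : Prop :=
  forall z, smooth z -> (forall a, smooth a -> mulA z a = mulA a z) ->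
  exists c, z = scalarA c.

(* Positivity of right multiplication by k on L^2; as the order of R[i] is
   partial, 0 <= z says that z is real and nonnegative. *)
Definition positive_invertible (k : 'rV[int]_n -> R[i]) : Prop :=
  (forall a, smooth a -> 0 <= csum (fun m => (a m)^* * mulA a k m)) /\
  exists h, [/\ smooth h, mulA k h = scalarA 1 & mulA h k = scalarA 1].

Section Spinors.
Context {N : nat}.

Definition spinor := 'rV[int]_n -> 'cV[R[i]]_N.
Definition operator := spinor -> spinor.

Definition smooth_spinor (psi : spinor) : Prop :=
  forall i, smooth (fun m => psi m i 0).

Definition op_eq (X Y : operator) : Prop :=
  forall psi, smooth_spinor psi -> X psi = Y psi.

Definition inner (phi psi : spinor) : R[i] :=
  csum (fun m => \sum_i (phi m i 0)^* * psi m i 0).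

Definition spin_basis (q : 'rV[int]_n) (j : 'I_N) : spinor :=
  fun m => if m == q then delta_mx j 0 else 0.

Definition lmul (a : 'rV[int]_n -> R[i]) : operator :=
  fun psi m => \col_i mulA a (fun l => psi l i 0) m.

Definition rmul (b : 'rV[int]_n -> R[i]) : operator :=
  fun psi m => \col_i mulA (fun l => psi l i 0) b m.

Definition mxact (M : 'M[R[i]]_N) : operator := fun psi m => M *m psi m.

Definition deriv_op (j : 'I_n) : operator :=
  fun psi m => (m 0 j)%:~R *: psi m.

Definition comm_op (X Y : operator) : operator :=
  fun psi m => X (Y psi) m - Y (X psi) m.

Definition gamma_matrices (gamma : 'I_n -> 'M[R[i]]_N) : Prop :=
  (forall i, (map_mx (@conjc R) (gamma i))^T = gamma i) /\
  (forall i j, gamma i *m gamma j + gamma j *m gamma i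
               = (2 * (i == j)%:R)%:M).

Definition dirac (gamma : 'I_n -> 'M[R[i]]_N) : operator :=
  fun psi m => \sum_j mxact (gamma j) (deriv_op j psi) m.

Definition conformal_dirac gamma (k : 'rV[int]_n -> R[i]) : operator :=
  fun psi => rmul k (dirac gamma (rmul k psi)).

Definition one_form (D u : operator) : Prop :=
  exists (r : nat) (a b c : 'I_r -> 'rV[int]_n -> R[i]),
    (forall t, [/\ smooth (a t), smooth (b t) & smooth (c t)]) /\
    op_eq u (fun psi m =>
      \sum_t lmul (a t) (comm_op D (lmul (b t)) (lmul (c t) psi)) m).

(* The algebra generated by A and A^o, tensored with matrices.  As A and A^o
   commute it consists of the finite sums of a b^o (x) M. *)
Definition hat_repr (X : operator) (r : nat)
    (a b : 'I_r -> 'rV[int]_n -> R[i]) (M : 'I_r -> 'M[R[i]]_N) : Prop :=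
  (forall t, smooth (a t) /\ smooth (b t)) /\
  op_eq X (fun psi m =>
    \sum_t lmul (a t) (rmul (b t) (mxact (M t) psi)) m).

Definition in_hat (X : operator) : Prop := exists r a b M, @hat_repr X r a b M.

(* The functional tau (x) Tr, determined by tau(a b^o) = tau(a) tau(b); its
   value does not depend on the decomposition when theta is strictly
   irrational. *)
Definition tauTr (X : operator) : R[i] :=
  xget 0 [set x | exists r a b M, @hat_repr X r a b M /\
                    x = \sum_t tau (a t) * tau (b t) * \tr (M t)].

Definition dxi (j : 'I_n) (h : 'rV[R]_n -> operator) : 'rV[R]_n -> operator :=
  fun xi psi p => \col_i
    ('D_(delta_mx 0 j) (fun eta => complex.Re (h eta psi p i 0)) xi
     +i* 'D_(delta_mx 0 j) (fun eta => complex.Im (h eta psi p i 0)) xi).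

Definition dxis (js : seq 'I_n) (h : 'rV[R]_n -> operator) :=
  foldr dxi h js.

Definition smooth_map (dom : set 'rV[R]_n) (h : 'rV[R]_n -> operator) : Prop :=
  forall js xi, dom xi -> in_hat (dxis js h xi) /\
    forall psi, smooth_spinor psi -> forall p i,
      differentiable (fun eta => complex.Re (dxis js h eta psi p i 0)) xi /\
      differentiable (fun eta => complex.Im (dxis js h eta psi p i 0)) xi.

(* The estimates of symbols of order d,
   || delta^alpha d_xi^beta h(xi) || <= C (1 + |xi|)^(d - |beta|),
   on the set r <= |xi|.  The matrix element of delta^alpha X at (p, q) is
   (p - q)^alpha times that of X, so the seminorms || delta^alpha X || amount
   to the decay of the matrix elements away from the diagonal. *)
Definition symbol_bound (d : int) (r : R) (h : 'rV[R]_n -> operator) : Prop :=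
  forall (js : seq 'I_n) (K : nat), exists C : R,
  forall xi, r <= enorm xi -> forall p q i j,
    cnorm (dxis js h xi (spin_basis q j) p i 0)
      * (1 + enorm (realv (p - q))) ^+ K
    <= C * (1 + enorm xi) ^ (d - (size js)%:Z).

Definition homogeneous (d : int) (h : 'rV[R]_n -> operator) : Prop :=
  [/\ smooth_map [set xi | xi != 0] h,
      symbol_bound d 1 h &
      forall t xi psi, 0 < t -> xi != 0 -> smooth_spinor psi ->
        h (t *: xi) psi = fun p => (t ^ d)%:C *: h xi psi p].

(* The Connes-Moscovici quantization
     P_rho(psi) = (2 pi)^-n int int exp(- i s.xi) rho(xi) alpha_s(psi) ds dxi,
   where alpha_s(U^m) = exp(i s.m) U^m, acts by P_rho(U^m) = rho(m) U^m. *)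
Definition quantize (rho : 'rV[R]_n -> operator) : operator :=
  fun psi p => \col_i
    csum (fun q => \sum_j psi q j 0 * rho (realv q) (spin_basis q j) p i 0).

(* P is the quantization of a classical symbol of order d, with homogeneous
   components s d, s (d - 1), and so on; s e is the component of degree e. *)
Definition has_symbol (P : operator) (d : int)
    (s : int -> 'rV[R]_n -> operator) : Prop :=
  exists rho,
  [/\ smooth_map setT rho, symbol_bound d 0 rho, op_eq P (quantize rho),
      (forall e, homogeneous e (s e)) /\
      (forall e xi, d < e -> xi != 0 -> op_eq (s e xi) (fun _ _ => 0)) &
      forall J : nat, symbol_bound (d - J%:Z) 1
        (fun xi psi p => rho xi psi p - \sum_(m < J) s (d - m%:Z) xi psi p)].

Definition psido (d : int) (P : operator) : Prop :=
  exists s, has_symbol P d s.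

End Spinors.
End NCTorus.

(* Iterated Lebesgue integral over R^n. *)
Fixpoint integral_rV {R : realType} (n : nat) : ('rV[R]_n -> R) -> R :=
  match n with
  | 0 => fun f => f 0
  | m.+1 => fun f => Rintegral lebesgue_measure setT
      (fun t : R => integral_rV (fun x : 'rV[R]_m => f (row_mx t%:M x)))
  end.

(* The surface integral over the unit sphere of f is n times the integral of
   f(x / |x|) over the unit ball. *)
Definition sphere_rintegral {R : realType} {n : nat} (f : 'rV[R]_n -> R) : R :=
  n%:R * integral_rV (fun x : 'rV[R]_n =>
    if 0 < enorm x <= 1 then f ((enorm x)^-1 *: x) else 0).

Definition sphere_integral {R : realType} {n : nat}
    (f : 'rV[R]_n -> R[i]) : R[i] :=
  sphere_rintegral (fun x => complex.Re (f x))
  +i* sphere_rintegral (fun x => complex.Im (f x)).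

Section Torsion.
Context {R : realType} {n N : nat}.
Variable theta : 'M[R]_n.
Notation op := (@operator R n N).

(* 0 if P is not a classical pseudodifferential operator.  Otherwise the
   homogeneous components are determined by P, theta being strictly
   irrational. *)
Definition Wres (P : op) : R[i] :=
  xget 0 [set r | exists d s, has_symbol theta P d s /\
    r = sphere_integral (fun xi => tauTr theta (s (- n%:Z) xi))].

Definition linear_smooth (T : op) : Prop :=
  (forall psi, smooth_spinor psi -> smooth_spinor (T psi)) /\
  (forall (c : R[i]) phi psi, smooth_spinor phi -> smooth_spinor psi ->
     T (fun m => c *: phi m + psi m) = fun m => c *: T phi m + T psi m).

(* T = |D| for D elliptic and symmetric: the nonnegative square root of D^2
   on smooth spinors, which contain the eigenvectors of D^2. *)
Definition is_modulus (D T : op) : Prop :=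
  [/\ linear_smooth T,
      forall phi psi, smooth_spinor phi -> smooth_spinor psi ->
        inner (T phi) psi = inner phi (T psi),
      forall psi, smooth_spinor psi -> 0 <= inner psi (T psi) &
      forall psi, smooth_spinor psi -> T (T psi) = D (D psi)].

Definition orth_ker (T : op) (psi : spinor) : Prop :=
  forall phi, smooth_spinor phi -> T phi = (fun=> 0) -> inner phi psi = 0.

(* B = T^(-r): zero on the kernel of T, and the inverse of T^r on the
   orthogonal complement of that kernel. *)
Definition is_inverse_power (T : op) (r : nat) (B : op) : Prop :=
  [/\ linear_smooth B,
      forall psi, smooth_spinor psi -> T psi = (fun=> 0) -> B psi = (fun=> 0) &
      forall psi, smooth_spinor psi -> orth_ker T psi ->
        orth_ker T (B psi) /\ iter r T (B psi) = psi].

Definition spectral_torsion (D absDinv u v w : op) : R[i] :=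
  Wres (u \o v \o w \o D \o absDinv).

End Torsion.

(* Main.v *)
(* Let P = u v w D_k |D_k|^-n, so that P |D_k|^n = u v w D_k.  Choose integers
   N -> oo and lattice points q with q - N xi -> 0 such that the phases of q
   against every fixed lattice point tend to 1.  Conjugation by the translation
   by q turns the symbol expansion of a pseudodifferential operator near N xi
   into an expansion in powers of 1/N whose first two coefficients are
   determined by the operator.  Comparing them in |D_k|^2 = D_k^2 gives the
   leading symbol |xi| k^2 of |D_k|, by uniqueness of positive square roots, and
   an equation for its subleading symbol; since tau(k^a delta_j(k^b)) = 0 for all
   integers a, b, that symbol is killed by the trace against a M k^z, for a in A
   and M a matrix.  Comparing them in P |D_k|^n = u v w D_k shows that P has
   order 1 - n, that its leading symbol is a sum of such words a M k^z, and that
   its symbol of order -n is again killed by the trace. *)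

Require Import Defs.
From HB Require Import structures.
From mathcomp Require Import all_boot all_order all_algebra.
From mathcomp Require Import all_classical all_reals all_analysis.
From mathcomp Require Import ring lra zify.
Set Implicit Arguments.
Unset Strict Implicit.
Unset Printing Implicit Defensive.
Import Order.TTheory GRing.Theory Num.Theory numFieldNormedType.Exports.
Local Open Scope classical_set_scope.
Local Open Scope ring_scope.
Local Open Scope complex_scope.

(** Neither a composition theorem for symbols nor a parametrix is available as a starting point:
    [|D_k|^-n] is not assumed to be pseudodifferential, and [Wres] is 0 by definition when P is not.
    Symbols are therefore extracted from identities between operators by taking limits. The
    translations must be recurrent because conjugation multiplies the Fourier coefficient of a
    multiplier at r by a phase of r against q; only when these phases tend to 1 does the multiplier
    converge to itself. Simultaneous Diophantine approximation provides such q in every direction.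
    The trace argument works because u v w stands to the left of all derivations. When the
    derivations of D_k and |D_k| are moved to the right they meet powers of k only, never an element
    of A. Every resulting term of order zero is thus governed by a factor delta_j(k^z) on the side
    of A^o, where the trace factorizes. Strict irrationality enters through the trace alone: it
    makes the factorized functional independent of the decomposition into words. *)

(** * Sums over the lattice *)

Section ComplexNorm.
Context {R : realType}.
Implicit Types z w : R[i].

Lemma cnormE z : (cnorm z)%:C = `|z|.
Proof. by rewrite normc_def. Qed.

Lemma cnorm_ge0 z : 0 <= cnorm z.
Proof. exact: sqrtr_ge0. Qed.

Lemma cnorm0 : cnorm 0 = 0 :> R.
Proof. by apply: complexI; rewrite cnormE normr0. Qed.

Lemma cnormM z w : cnorm (z * w) = cnorm z * cnorm w.
Proof. by apply: complexI; rewrite rmorphM /= !cnormE normrM. Qed.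

Lemma cnormD z w : cnorm (z + w) <= cnorm z + cnorm w.
Proof. by rewrite -lecR rmorphD /= !cnormE ler_normD. Qed.

Lemma cnormN z : cnorm (- z) = cnorm z.
Proof. by apply: complexI; rewrite !cnormE normrN. Qed.

Lemma cnormB z w : cnorm (z - w) <= cnorm z + cnorm w.
Proof. by rewrite -(cnormN w) cnormD. Qed.

Lemma cnorm_eq0 z : cnorm z = 0 -> z = 0.
Proof. by move=> z0; apply/eqP; rewrite -normr_eq0 -cnormE z0. Qed.

Lemma cnorm_real (x : R) : cnorm x%:C = `|x|.
Proof. by rewrite /cnorm /= expr0n /= addr0 sqrtr_sqr. Qed.

Lemma cnorm1 : cnorm 1 = 1 :> R.
Proof. by rewrite (cnorm_real 1) normr1. Qed.

Lemma cnorm_conj z : cnorm z^* = cnorm z.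
Proof. by case: z => a b; rewrite /cnorm /= sqrrN. Qed.

Lemma cnormX z k : cnorm (z ^+ k) = cnorm z ^+ k.
Proof. by elim: k => [|k IH]; rewrite ?cnorm1 // !exprS cnormM IH. Qed.

Lemma Re_le_cnorm z : `|complex.Re z| <= cnorm z.
Proof. by rewrite /cnorm -sqrtr_sqr ler_wsqrtr // lerDl sqr_ge0. Qed.

Lemma Im_le_cnorm z : `|complex.Im z| <= cnorm z.
Proof. by rewrite /cnorm -sqrtr_sqr ler_wsqrtr // lerDr sqr_ge0. Qed.

Lemma cnorm_le_ReIm z : cnorm z <= `|complex.Re z| + `|complex.Im z|.
Proof.
rewrite -[leRHS]ger0_norm ?addr_ge0// -sqrtr_sqr ler_wsqrtr // sqrrD !real_normK ?num_real//.
by rewrite lerD2r lerDl mulrn_wge0// mulr_ge0.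
Qed.

Lemma cnorm_sum (I : Type) (r : seq I) (P : pred I) (F : I -> R[i]) :
  cnorm (\sum_(i <- r | P i) F i) <= \sum_(i <- r | P i) cnorm (F i).
Proof.
elim/big_rec2: _ => [|i x y _ le_xy]; first by rewrite cnorm0.
by apply: le_trans (cnormD _ _) _; rewrite lerD2l.
Qed.

Lemma cnorm_le_eps0 z : (forall e : R, 0 < e -> cnorm z <= e) -> z = 0.
Proof.
move=> le_z; apply: cnorm_eq0; apply/eqP; rewrite eq_le cnorm_ge0 andbT leNgt.
by apply/negP => z_gt0; have := le_z _ (divr_gt0 z_gt0 (ltr0n _ 2)); rewrite leNgt ltr_pdivrMr// mulr_natr mulr2n ltrDl z_gt0.
Qed.

Lemma ReD z w : complex.Re (z + w) = complex.Re z + complex.Re w.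
Proof. by case: z w => [a b] [c d]. Qed.

Lemma ImD z w : complex.Im (z + w) = complex.Im z + complex.Im w.
Proof. by case: z w => [a b] [c d]. Qed.

Lemma ReN z : complex.Re (- z) = - complex.Re z.
Proof. by case: z => [a b]. Qed.

Lemma ImN z : complex.Im (- z) = - complex.Im z.
Proof. by case: z => [a b]. Qed.

Lemma Re_sum (I : Type) (r : seq I) (P : pred I) (F : I -> R[i]) :
  complex.Re (\sum_(i <- r | P i) F i) = \sum_(i <- r | P i) complex.Re (F i).
Proof. by apply: (big_morph (@complex.Re R) ReD). Qed.

Lemma Im_sum (I : Type) (r : seq I) (P : pred I) (F : I -> R[i]) :
  complex.Im (\sum_(i <- r | P i) F i) = \sum_(i <- r | P i) complex.Im (F i).
Proof. by apply: (big_morph (@complex.Im R) ImD). Qed.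

Lemma ReMr (x : R) z : complex.Re (x%:C * z) = x * complex.Re z.
Proof. by case: z => a b /=; rewrite mul0r subr0. Qed.

Lemma ImMr (x : R) z : complex.Im (x%:C * z) = x * complex.Im z.
Proof. by case: z => a b /=; rewrite mul0r addr0. Qed.

End ComplexNorm.

Lemma sum_subset_le {R : realType} (T : eqType) (g : T -> R) (G H : seq T) :
  (forall x, 0 <= g x) -> uniq G -> {subset G <= H} ->
  \sum_(x <- G) g x <= \sum_(x <- H) g x.
Proof.
move=> g0; elim: G H => [|x G IH] H /=; first by rewrite big_nil sumr_ge0.
case/andP => xG uG GH; have xH : x \in H by rewrite GH// mem_head.
rewrite big_cons (perm_big _ (perm_to_rem xH)) big_cons lerD2l; apply: IH => // y yG.
have := GH y; rewrite inE yG orbT => /(_ isT); rewrite (perm_mem (perm_to_rem xH)) inE.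
by case/orP => // /eqP yx; rewrite -yx yG in xG.
Qed.

Section Weight.
Context {R : realType} {n : nat}.
Implicit Types x y : 'rV[R]_n.
Implicit Types m : 'rV[int]_n.

Lemma enorm_ge0 x : 0 <= enorm x.
Proof. exact: sqrtr_ge0. Qed.

Lemma sqr_enorm x : enorm x ^+ 2 = \sum_j x 0 j ^+ 2.
Proof. by rewrite sqr_sqrtr// sumr_ge0 // => j _; rewrite sqr_ge0. Qed.

Lemma cauchy_schwarz_row x y :
  \sum_j x 0 j * y 0 j <= enorm x * enorm y.
Proof.
set a := enorm x; set b := enorm y; set s := \sum_j _.
have ab : 0 <= a * b by rewrite mulr_ge0 ?enorm_ge0.
suff : s ^+ 2 <= (a * b) ^+ 2.
  by move=> h; apply: le_trans (ler_norm _) _; rewrite -(ger0_norm ab) -ler_sqr ?nnegrE// !real_normK ?num_real.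
have [b0|b_neq0] := eqVneq b 0.
  have y0 j : y 0 j = 0.
    have : \sum_j y 0 j ^+ 2 = 0 by rewrite -sqr_enorm -/b b0 expr0n.
    move/psumr_eq0P => /(_ (fun j _ => sqr_ge0 _)) /(_ j isT) /eqP.
    by rewrite sqrf_eq0 => /eqP.
  by rewrite /s big1 ?expr0n ?sqr_ge0// => j _; rewrite y0 mulr0.
have b2 : 0 < b ^+ 2 by rewrite exprn_gt0// lt0r b_neq0 enorm_ge0.
(* The vector [b^2 x - s y] is [b^2] times the component of [x] orthogonal to [y]. *)
have : 0 <= \sum_j (b ^+ 2 * x 0 j - s * y 0 j) ^+ 2 by apply: sumr_ge0 => j _; rewrite sqr_ge0.
have -> : \sum_j (b ^+ 2 * x 0 j - s * y 0 j) ^+ 2 = b ^+ 2 * (b ^+ 2 * a ^+ 2 - s ^+ 2).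
  rewrite (eq_bigr (fun j => b ^+ 4 * x 0 j ^+ 2 - (2 * b ^+ 2 * s) * (x 0 j * y 0 j) + s ^+ 2 * y 0 j ^+ 2)); last by move=> j _; ring.
  by rewrite big_split /= sumrB -!mulr_sumr -/s -!sqr_enorm -/a -/b; ring.
by rewrite pmulr_rge0// subr_ge0 exprMn mulrC.
Qed.

Lemma enormD x y : enorm (x + y) <= enorm x + enorm y.
Proof.
have xy : 0 <= enorm x + enorm y by rewrite addr_ge0 ?enorm_ge0.
rewrite -ler_sqr ?nnegrE ?enorm_ge0// sqr_enorm sqrrD !sqr_enorm.
rewrite (eq_bigr (fun j => x 0 j ^+ 2 + (x 0 j * y 0 j) *+ 2 + y 0 j ^+ 2)); last by move=> j _; rewrite mxE sqrrD.
by rewrite big_split big_split /= lerD2r lerD2l sumrMnl lerMn2r/= cauchy_schwarz_row.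
Qed.

Lemma enormZ (t : R) x : enorm (t *: x) = `|t| * enorm x.
Proof.
rewrite /enorm -sqrtr_sqr -sqrtrM ?sqr_ge0// mulr_sumr.
by congr Num.sqrt; apply: eq_bigr => j _; rewrite mxE exprMn.
Qed.

Lemma enormN x : enorm (- x) = enorm x.
Proof. by rewrite -scaleN1r enormZ normrN1 mul1r. Qed.

Lemma enorm0 : enorm (0 : 'rV[R]_n) = 0.
Proof. by rewrite -(scale0r (0 : 'rV_n)) enormZ normr0 mul0r. Qed.

Lemma coord_le_enorm x j : `|x 0 j| <= enorm x.
Proof.
rewrite /enorm -sqrtr_sqr ler_wsqrtr// (bigD1 j)//= lerDl.
by apply: sumr_ge0 => k _; rewrite sqr_ge0.
Qed.

Lemma enorm_le_sum x : enorm x <= \sum_j `|x 0 j|.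
Proof.
have s0 : 0 <= \sum_j `|x 0 j| by apply: sumr_ge0.
rewrite -ler_sqr ?nnegrE ?enorm_ge0// sqr_enorm expr2 mulr_suml.
apply: ler_sum => j _; rewrite -real_normK ?num_real// expr2 ler_wpM2l//.
by rewrite (bigD1 j)//= lerDl sumr_ge0.
Qed.

Lemma enorm_gt0 x : (0 < enorm x) = (x != 0).
Proof.
rewrite lt0r enorm_ge0 andbT; apply/idP/idP.
  by apply: contra_neq => ->; exact: enorm0.
apply: contra_neq => x0; apply/rowP => j; rewrite mxE.
by apply/eqP; rewrite -normr_le0 -x0 coord_le_enorm.
Qed.

Definition wt m : R := 1 + enorm (realv m).

Lemma realvD m m' : realv (m + m') = realv m + realv m' :> 'rV[R]_n.
Proof. by apply/rowP => j; rewrite !mxE intrD. Qed.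

Lemma realv0 : realv 0 = 0 :> 'rV[R]_n.
Proof. by apply/rowP => j; rewrite !mxE. Qed.

Lemma wt_ge1 m : 1 <= wt m.
Proof. by rewrite lerDl enorm_ge0. Qed.

Lemma wt_gt0 m : 0 < wt m.
Proof. exact: lt_le_trans (wt_ge1 m). Qed.

Lemma wt_ge0 m : 0 <= wt m.
Proof. exact: ltW (wt_gt0 m). Qed.

Lemma wtD m m' : wt (m + m') <= wt m * wt m'.
Proof.
rewrite /wt realvD mulrDl mul1r mulrDr mulr1 -!addrA lerD2l.
by apply: le_trans (enormD _ _) _; rewrite [leLHS]addrC lerD2l lerDl mulr_ge0 ?enorm_ge0.
Qed.

Lemma wtXD m m' K : wt (m + m') ^+ K <= wt m ^+ K * wt m' ^+ K.
Proof. by rewrite -exprMn lerXn2r ?wtD ?nnegrE ?mulr_ge0 ?wt_ge0. Qed.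

Lemma wtX_gt0 m K : 0 < wt m ^+ K.
Proof. by rewrite exprn_gt0 ?wt_gt0. Qed.

Lemma wtX_ge0 m K : 0 <= wt m ^+ K.
Proof. exact: ltW (wtX_gt0 m K). Qed.

Lemma wtX_le m K L : (K <= L)%N -> wt m ^+ K <= wt m ^+ L.
Proof. by move=> KL; rewrite ler_weXn2l ?wt_ge1. Qed.

(** The standard summable majorant on the lattice: the exponent provides a factor [(1 + m_j^2)^-1]
    for each of the n coordinates, so that the sum is controlled by a product of one-dimensional
    sums. *)
Definition om m : R := (wt m ^+ (2 * n))^-1.

Lemma om_gt0 m : 0 < om m.
Proof. by rewrite invr_gt0 wtX_gt0. Qed.

Lemma om_ge0 m : 0 <= om m.
Proof. exact: ltW (om_gt0 m). Qed.

Lemma om_le_prod m : om m <= \prod_j (1 + (m 0 j)%:~R ^+ 2)^-1.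
Proof.
rewrite /om prodfV lef_pV2 ?posrE ?wtX_gt0 //; last first.
  by apply: prodr_gt0 => j _; rewrite ltr_wpDr ?sqr_ge0.
rewrite exprM -[X in _ ^+ X]card_ord -prodr_const; apply: ler_prod => j _.
rewrite addr_ge0 ?sqr_ge0//= /wt sqrrD expr1n -addrA lerD2l.
have := coord_le_enorm (realv m) j; rewrite mxE => h.
rewrite ler_wpDl ?mulrn_wge0 ?mulr_ge0 ?enorm_ge0// -real_normK ?num_real//.
by rewrite lerXn2r ?nnegrE ?enorm_ge0.
Qed.

Lemma sum_inv_sqr_nat L : \sum_(x < L) (1 + (x%:R : R) ^+ 2)^-1 <= 3.
Proof.
(* The correction [2 / L.+1] makes the induction telescope: each new term is at most
   [2 / a - 2 / (a + 1)]. *)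
suff : \sum_(x < L.+1) (1 + (x%:R : R) ^+ 2)^-1 <= 3 - 2 / (L.+1)%:R.
  move=> h; apply: le_trans (le_trans _ h) _; last by rewrite gerBl divr_ge0.
  by rewrite big_ord_recr /= lerDl invr_ge0 addr_ge0 ?sqr_ge0.
elim: L => [|L IH]; first by rewrite big_ord_recr big_ord0 /= expr0n/= add0r addr0 invr1; lra.
rewrite big_ord_recr /=; apply: le_trans (lerD IH (lexx _)) _.
have -> : (L.+2%:R : R) = L.+1%:R + 1 by rewrite -(natr1 L.+1).
have : 1 <= L.+1%:R :> R by rewrite ler1n.
move: (L.+1%:R) => a a1.
have a0 : 0 < a by exact: lt_le_trans a1.
suff : (1 + a ^+ 2)^-1 <= 2 / a - 2 / (a + 1) by lra.
have -> : 2 / a - 2 / (a + 1) = 2 / (a * (a + 1)) by field; rewrite !lt0r_neq0// addr_gt0.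
rewrite ler_pdivlMr ?mulr_gt0 ?addr_gt0// mulrC ler_pdivrMr ?ltr_wpDr ?sqr_ge0//; nra.
Qed.

Lemma sum_inv_sqr_int (G : seq int) : uniq G ->
  \sum_(z <- G) (1 + (z%:~R : R) ^+ 2)^-1 <= 6.
Proof.
move=> uG; pose L := (\max_(x <- G) `|x|%N).+1.
have GL (x : int) : x \in G -> (`|x| < L)%N.
  by move=> xG; rewrite ltnS; exact: (leq_bigmax_seq (F := fun x : int => `|x|%N) x xG isT).
(* Nonnegative and nonpositive integers are listed separately; 0 occurs twice, which only enlarges
   the sum and gives the bound 3 + 3. *)
pose H := [seq Posz (i : nat) | i <- iota 0 L] ++ [seq - Posz (i : nat) | i <- iota 0 L].
apply: (@le_trans _ _ (\sum_(z <- H) (1 + (z%:~R : R) ^+ 2)^-1)).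
  apply: sum_subset_le => // [z|z zG]; first by rewrite invr_ge0 addr_ge0 ?sqr_ge0.
  rewrite mem_cat; have := GL _ zG.
  case: (intP z) => [|k|k] lx; apply/orP; [left|left|right]; apply/mapP.
  - by exists 0%N; rewrite // mem_iota.
  - by exists k.+1; rewrite // mem_iota.
  - by exists k.+1; rewrite // mem_iota; rewrite abszN in lx.
rewrite /H big_cat !big_map /=.
under [X in _ + X]eq_bigr do rewrite mulrNz sqrrN.
have : \sum_(0 <= x < L) (1 + (x%:R : R) ^+ 2)^-1 <= 3 by rewrite big_mkord sum_inv_sqr_nat.
rewrite /index_iota subn0 => h; have := lerD h h.
have -> : 3 + 3 = 6 :> R by lra.
by [].
Qed.

(** A finite set of lattice points lies in the box [G^n] over the set [G] of all its coordinates,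
    and on a box the product majorant sums to a product of n sums, each at most 6. *)
Lemma sum_om_le (F : seq 'rV[int]_n) : uniq F -> \sum_(m <- F) om m <= 6 ^+ n.
Proof.
move=> uF; pose G := undup (flatten [seq [seq m 0 j | j <- enum 'I_n] | m : 'rV[int]_n <- F]).
pose g (x : int) : R := (1 + x%:~R ^+ 2)^-1.
have g0 z : 0 <= g z by rewrite invr_ge0 addr_ge0 ?sqr_ge0.
pose H := [seq (\row_j val (f j)) : 'rV[int]_n | f : {ffun 'I_n -> seq_sub G} <- enum {ffun 'I_n -> seq_sub G}].
apply: (@le_trans _ _ (\sum_(m <- H) \prod_j g (m 0 j))).
  apply: (@le_trans _ _ (\sum_(m <- F) \prod_j g (m 0 j))).
    by apply: ler_sum => m _; exact: om_le_prod.
  apply: sum_subset_le => // [m|m mF]; first by apply: prodr_ge0 => j _; exact: g0.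
  have mG j : m 0 j \in G.
    rewrite mem_undup; apply/flattenP; exists [seq m 0 j | j <- enum 'I_n].
      by apply/mapP; exists m.
    by apply/mapP; exists j; rewrite // mem_enum.
  apply/mapP; exists [ffun j => SeqSub (mG j)]; first by rewrite mem_enum.
  by apply/rowP => j; rewrite mxE ffunE.
rewrite big_map big_enum /= .
under eq_bigr do under eq_bigr do rewrite mxE.
rewrite -(bigA_distr_bigA (fun (j : 'I_n) (x : seq_sub G) => g (val x))) /=.
rewrite -[X in _ <= _ ^+ X]card_ord -prodr_const; apply: ler_prod => j _.
rewrite sumr_ge0 //= -(big_map val xpredT g) /=.
apply: sum_inv_sqr_int; rewrite map_inj_uniq; last exact: val_inj.
by rewrite /index_enum -enumT enum_uniq.
Qed.

End Weight.

Section Sums.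
Context {R : realType} {n : nat}.
Local Notation Z := 'rV[int]_n.
Implicit Types f g : Z -> R[i].

Lemma fine_esum_bounds (g : Z -> R) (B : R) :
  (forall m, 0 <= g m) -> (forall F, uniq F -> \sum_(m <- F) g m <= B) ->
  (forall F, uniq F -> \sum_(m <- F) g m <= fine (\esum_(m in setT) (g m)%:E)) /\
  fine (\esum_(m in setT) (g m)%:E) <= B.
Proof.
move=> g0 gB.
have le1 : (\esum_(m in setT) (g m)%:E <= B%:E)%E.
  apply: ge_ereal_sup => _ [A [finA _] <-].
  by rewrite fsbig_finite//= sumEFin lee_fin gB// finmap.fset_uniq.
have ge0 : (0%:E <= \esum_(m in setT) (g m)%:E)%E.
  by apply: esum_ge0 => m _; rewrite lee_fin.
have fin : \esum_(m in setT) (g m)%:E \is a fin_num.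
  by rewrite ge0_fin_numE// (le_lt_trans le1)// ltry.
split=> [F uF|]; last by rewrite -lee_fin fineK.
rewrite -lee_fin fineK// -sumEFin fsbig_seq//; apply: ereal_sup_ubound.
by exists [set` F] => //; split=> //; exact: finite_seq.
Qed.

(** The positive and the negative part of [g] lie between 0 and [phi], so the error of each lies
    between 0 and the tail [B - \sum phi]; the difference of two numbers in that interval is bounded
    by its length. *)
Lemma rsum_approx (g phi : Z -> R) (B : R) :
  (forall m, `|g m| <= phi m) -> (forall F, uniq F -> \sum_(m <- F) phi m <= B) ->
  forall F, uniq F -> `|rsum g - \sum_(m <- F) g m| <= B - \sum_(m <- F) phi m.
Proof.
move=> g_le phiB F uF.
have phi0 m : 0 <= phi m by apply: le_trans (g_le m).
have key (p : Z -> R) : (forall m, 0 <= p m <= phi m) ->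
    0 <= fine (\esum_(m in setT) (p m)%:E) - \sum_(m <- F) p m <= B - \sum_(m <- F) phi m.
  move=> p_le; have p0 m : 0 <= p m by case/andP: (p_le m).
  have pphi m : p m <= phi m by case/andP: (p_le m).
  have [G|lo _] := @fine_esum_bounds p B p0.
    by move=> uG; apply: le_trans (phiB _ uG); apply: ler_sum.
  rewrite subr_ge0 lo//= lerBlDr.
  have [|_] := @fine_esum_bounds p (B - \sum_(m <- F) phi m + \sum_(m <- F) p m) p0; last by [].
  move=> G uG; have := phiB _ (undup_uniq (F ++ G)).
  suff : \sum_(m <- G) p m + \sum_(m <- F) (phi m - p m) <= \sum_(m <- undup (F ++ G)) phi m.
    by rewrite sumrB; lra.
  rewrite [leRHS](eq_bigr (fun m => p m + (phi m - p m))) => [|m _]; last by rewrite addrC subrK.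
  rewrite [leRHS]big_split /=; apply: lerD.
    by apply: sum_subset_le => // m mG; rewrite mem_undup mem_cat mG orbT.
  apply: sum_subset_le => // [m|m mF]; first by rewrite subr_ge0.
  by rewrite mem_undup mem_cat mF.
have /key/andP[a1 a2] : forall m, 0 <= Num.max (g m) 0 <= phi m.
  by move=> m; rewrite le_max lexx orbT ge_max phi0 andbT (le_trans (ler_norm _) (g_le m)).
have /key/andP[b1 b2] : forall m, 0 <= Num.max (- g m) 0 <= phi m.
  by move=> m; rewrite le_max lexx orbT ge_max phi0 andbT (le_trans (ler_norm _)) // normrN.
have -> : \sum_(m <- F) g m = \sum_(m <- F) Num.max (g m) 0 - \sum_(m <- F) Num.max (- g m) 0.
  rewrite -sumrB; apply: eq_bigr => m _.
  by case: (lerP 0 (g m)) => h; [rewrite max_r ?oppr_le0// subr0|rewrite max_l ?oppr_ge0 ?ltW// sub0r opprK].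
rewrite /rsum ler_norml; lra.
Qed.

Lemma csum_approx f (phi : Z -> R) (B : R) :
  (forall m, cnorm (f m) <= phi m) -> (forall F, uniq F -> \sum_(m <- F) phi m <= B) ->
  forall F, uniq F -> cnorm (csum f - \sum_(m <- F) f m) <= 2 * (B - \sum_(m <- F) phi m).
Proof.
move=> f_le phiB F uF; apply: le_trans (cnorm_le_ReIm _) _.
rewrite ReD ImD ReN ImN Re_sum Im_sum /= mulr_natl mulr2n.
apply: lerD; apply: rsum_approx => // m; apply: le_trans (f_le m).
- exact: Re_le_cnorm.
- exact: Im_le_cnorm.
Qed.

Definition sdom (C : R) f := forall m, cnorm (f m) <= C * om m.

Lemma sdom_ge0 C f : sdom C f -> 0 <= C.
Proof. by move/(_ 0) => /(le_trans (cnorm_ge0 _)); rewrite pmulr_lge0 ?om_gt0. Qed.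

Lemma sdom_le C C' f : C <= C' -> sdom C f -> sdom C' f.
Proof. by move=> CC' fC m; apply: le_trans (fC m) _; rewrite ler_wpM2r ?om_ge0. Qed.

Lemma sdomD C C' f g : sdom C f -> sdom C' g -> sdom (C + C') (fun m => f m + g m).
Proof. by move=> fC gC m; rewrite mulrDl; apply: le_trans (cnormD _ _) _; rewrite lerD. Qed.

Lemma sdomZ C (a : R[i]) f : sdom C f -> sdom (cnorm a * C) (fun m => a * f m).
Proof. by move=> fC m; rewrite cnormM -mulrA ler_wpM2l ?cnorm_ge0. Qed.

Lemma sum_om_scaled C (F : seq Z) : 0 <= C -> uniq F ->
  \sum_(m <- F) C * om m <= C * 6 ^+ n :> R.
Proof. by move=> C0 uF; rewrite -mulr_sumr ler_wpM2l ?sum_om_le. Qed.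

(** [F0] depends on the constant [C] only and not on [f]. This uniformity is what dominated
    convergence rests on. *)
Lemma csum_tail C e : 0 < e -> exists2 F0 : seq Z, uniq F0 &
  forall f, sdom C f -> forall F, uniq F -> {subset F0 <= F} ->
  cnorm (csum f - \sum_(m <- F) f m) <= e.
Proof.
move=> e0; have [C0|C0] := ltP C 0.
  by exists [::] => // f /sdom_ge0; rewrite leNgt C0.
have [lo hi] := @fine_esum_bounds (@om R n) (6 ^+ n) (@om_ge0 R n) (@sum_om_le R n).
set S := fine _ in lo hi.
have [F0 uF0 hF0] : exists2 F0 : seq Z, uniq F0 & S - e / (2 * (C + 1)) < \sum_(m <- F0) om m.
  apply: contrapT => h.
  have [|_] := @fine_esum_bounds (@om R n) (S - e / (2 * (C + 1))) (@om_ge0 R n).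
    by move=> F uF; rewrite leNgt; apply/negP => hF; apply: h; exists F.
  by rewrite -/S leNgt ltrBlDr ltrDl divr_gt0 // mulr_gt0 // ltr_wpDl.
exists F0 => // f fC F uF F0F.
apply: le_trans (@csum_approx f (fun m => C * om m) (C * S) fC _ F uF) _.
  by move=> G uG; rewrite -mulr_sumr ler_wpM2l// lo.
rewrite -mulr_sumr -mulrBr.
have : S - \sum_(m <- F) om m <= e / (2 * (C + 1)).
  have : \sum_(m <- F0) om m <= \sum_(m <- F) om m :> R.
    by apply: sum_subset_le => // m; exact: om_ge0.
  by move: hF0; lra.
rewrite ler_pdivlMr ?mulr_gt0 ?ltr_wpDl// => h.
have : 0 <= S - \sum_(m <- F) om m by rewrite subr_ge0 lo.
by move: h; nra.
Qed.

(** Characterizes [csum] as a limit over the directed set of finite subsets, which detaches it from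
    its definition by positive and negative parts; linearity and reindexing follow from here. *)
Lemma csum_unique C f s : sdom C f ->
  (forall e : R, 0 < e -> exists F0 : seq Z, forall F, uniq F -> {subset F0 <= F} ->
     cnorm (s - \sum_(m <- F) f m) <= e) ->
  csum f = s.
Proof.
move=> fC fs; apply/eqP; rewrite -subr_eq0; apply/eqP/cnorm_le_eps0 => e e0.
have e2 : 0 < e / 2 by rewrite divr_gt0.
have [F0 uF0 hF0] := @csum_tail C _ e2; have [F1 hF1] := fs _ e2.
have uF := undup_uniq (F0 ++ F1).
have := hF0 _ fC _ uF; have := hF1 _ uF; set F := undup _; set t := \sum_(m <- F) _ => h1 h2.
have -> : csum f - s = (csum f - t) - (s - t) by rewrite opprB addrA subrK.
apply: le_trans (cnormB _ _) _; rewrite [leRHS](splitr e); apply: lerD.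
- by apply: h2 => m mF; rewrite mem_undup mem_cat mF.
- by apply: h1 => m mF; rewrite mem_undup mem_cat mF orbT.
Qed.

Lemma csum_bound C f : sdom C f -> cnorm (csum f) <= 2 * (C * 6 ^+ n).
Proof.
move=> fC; have := @csum_approx f (fun m => C * om m) (C * 6 ^+ n) fC _ [::] isT.
rewrite !big_nil !subr0; apply=> F uF; apply: sum_om_scaled => //; exact: sdom_ge0 fC.
Qed.

Lemma csum_linear C C' (a : R[i]) f g : sdom C f -> sdom C' g ->
  csum (fun m => a * f m + g m) = a * csum f + csum g.
Proof.
move=> fC gC; apply: csum_unique (sdomD (sdomZ a fC) gC) _ => e e0.
have d0 : 0 < e / (cnorm a + 1) by rewrite divr_gt0// ltr_wpDl// cnorm_ge0.
have [F0 uF0 hF0] := @csum_tail (C + C') _ d0.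
exists F0 => F uF F0F; rewrite big_split /= -mulr_sumr.
have fC' : sdom (C + C') f by apply: sdom_le fC; rewrite lerDl (sdom_ge0 gC).
have gC' : sdom (C + C') g by apply: sdom_le gC; rewrite lerDr (sdom_ge0 fC).
have := hF0 _ fC' _ uF F0F; have := hF0 _ gC' _ uF F0F => h1 h2.
rewrite opprD addrACA -mulrBr; apply: le_trans (cnormD _ _) _; rewrite cnormM.
apply: le_trans (lerD (ler_wpM2l (cnorm_ge0 a) h2) h1) _.
by rewrite -[X in _ + X]mul1r -mulrDl mulrC divfK// gt_eqF// ltr_wpDl// cnorm_ge0.
Qed.

Lemma sdom0 : sdom 0 (fun=> 0).
Proof. by move=> m; rewrite cnorm0 mul0r. Qed.

Lemma csum_unique_fin f (F0 : seq Z) : uniq F0 -> (forall m, m \notin F0 -> f m = 0) ->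
  csum f = \sum_(m <- F0) f m.
Proof.
move=> uF0 f0.
have dom : sdom (\sum_(m <- F0) cnorm (f m) / om m) f.
  move=> m; rewrite -ler_pdivrMr ?om_gt0//; have [mF|/f0 ->] := boolP (m \in F0).
    rewrite (big_rem _ mF) /= lerDl sumr_ge0// => k _; by rewrite divr_ge0 ?cnorm_ge0 ?om_ge0.
  rewrite cnorm0 mul0r sumr_ge0// => k _; by rewrite divr_ge0 ?cnorm_ge0 ?om_ge0.
apply: csum_unique dom _ => e e0; exists F0 => F uF F0F.
have -> : \sum_(m <- F) f m = \sum_(m <- F0) f m; last by rewrite subrr cnorm0 ltW.
rewrite (bigID (mem F0)) /= [X in _ + X]big1 ?addr0; last by move=> m /f0.
rewrite -big_filter; apply: perm_big; apply: uniq_perm => //; first exact: filter_uniq.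
by move=> m; rewrite mem_filter /=; case mF: (m \in F0) => //=; rewrite F0F.
Qed.

Lemma csum1 f a : (forall m, m != a -> f m = 0) -> csum f = f a.
Proof.
move=> f0; rewrite (@csum_unique_fin _ [:: a])// ?big_seq1// => m.
by rewrite inE => /f0.
Qed.

Lemma csum0 : csum (fun _ : Z => 0 : R[i]) = 0.
Proof. by rewrite (@csum_unique_fin _ [::]) ?big_nil. Qed.

Lemma csumZ C (a : R[i]) f : sdom C f -> csum (fun m => a * f m) = a * csum f.
Proof.
move=> fC; have := csum_linear a fC sdom0; rewrite csum0 addr0 => <-.
by congr csum; apply/funext => m; rewrite addr0.
Qed.

Lemma csumD C C' f g : sdom C f -> sdom C' g ->
  csum (fun m => f m + g m) = csum f + csum g.
Proof.
move=> fC gC; have := csum_linear 1 fC gC; rewrite mul1r => <-.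
by congr csum; apply/funext => m; rewrite mul1r.
Qed.

Lemma sdom_sum (I : Type) (r : seq I) (C : R) (F : I -> Z -> R[i]) :
  (forall i, sdom C (F i)) -> sdom (C *+ size r) (fun m => \sum_(i <- r) F i m).
Proof.
move=> FC m; apply: le_trans (cnorm_sum _ _ _) _.
elim: r => [|i r IH]; first by rewrite big_nil mulr0n mul0r.
by rewrite big_cons /= mulrS mulrDl; apply: lerD => //; exact: FC.
Qed.

Lemma csum_sum (I : Type) (r : seq I) (C : R) (F : I -> Z -> R[i]) :
  (forall i, sdom C (F i)) ->
  csum (fun m => \sum_(i <- r) F i m) = \sum_(i <- r) csum (F i).
Proof.
move=> FC; elim: r => [|i r IH].
  by rewrite big_nil -[RHS]csum0; congr csum; apply/funext => m; rewrite big_nil.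
rewrite big_cons -IH -(csumD (FC i) (sdom_sum r FC)).
by congr csum; apply/funext => m; rewrite big_cons.
Qed.

Lemma csum_reindex C C' f (s t : Z -> Z) : cancel s t -> cancel t s ->
  sdom C f -> sdom C' (f \o s) -> csum (f \o s) = csum f.
Proof.
move=> st ts fC fsC; apply: csum_unique fsC _ => e e0.
have [F0 uF0 hF0] := @csum_tail C _ e0; exists [seq t m | m <- F0] => F uF F0F.
have := hF0 _ fC [seq s m | m <- F]; rewrite big_map; apply.
  by rewrite map_inj_uniq//; exact: can_inj st.
move=> m mF0; apply/mapP; exists (t m); rewrite ?ts//; apply: F0F; exact: map_f.
Qed.

Lemma csum_conj C f : sdom C f -> csum (fun m => (f m)^*) = (csum f)^*.
Proof.
move=> fC; apply: (@csum_unique C) => [m|e e0]; first by rewrite cnorm_conj.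
have [F0 uF0 hF0] := @csum_tail C _ e0; exists F0 => F uF F0F.
by rewrite -rmorph_sum -rmorphB /= cnorm_conj hF0.
Qed.

Definition ctend (u : nat -> R[i]) (l : R[i]) :=
  forall e : R, 0 < e -> exists k0, forall k, (k0 <= k)%N -> cnorm (u k - l) <= e.

Lemma ctend_cst l : ctend (fun=> l) l.
Proof. by move=> e e0; exists 0%N => k _; rewrite subrr cnorm0 ltW. Qed.

Lemma ctend_unique u l l' : ctend u l -> ctend u l' -> l = l'.
Proof.
move=> ul ul'; apply/eqP; rewrite -subr_eq0; apply/eqP/cnorm_le_eps0 => e e0.
have e2 : 0 < e / 2 by rewrite divr_gt0.
have [k0 h] := ul _ e2; have [k0' h'] := ul' _ e2.
have -> : l - l' = (u (maxn k0 k0') - l') - (u (maxn k0 k0') - l) by ring.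
apply: le_trans (cnormB _ _) _; rewrite [leRHS](splitr e); apply: lerD.
- by apply: h'; rewrite leq_maxr.
- by apply: h; rewrite leq_maxl.
Qed.

Lemma ctendD u v l l' : ctend u l -> ctend v l' -> ctend (fun k => u k + v k) (l + l').
Proof.
move=> ul vl e e0; have e2 : 0 < e / 2 by rewrite divr_gt0.
have [k0 h] := ul _ e2; have [k0' h'] := vl _ e2; exists (maxn k0 k0') => k.
rewrite geq_max => /andP[/h hk /h' hk'].
rewrite opprD addrACA; apply: le_trans (cnormD _ _) _; rewrite [leRHS](splitr e); exact: lerD.
Qed.

Lemma ctend_bounded u l : ctend u l -> exists2 C : R, 0 < C & forall k, cnorm (u k) <= C.
Proof.
move=> ul; have [k0 h] := ul _ ltr01.
exists (1 + cnorm l + \sum_(k < k0) cnorm (u k)) => [|k].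
  by rewrite ltr_pwDl ?sumr_ge0 ?ltr_pwDl ?cnorm_ge0// => k _; exact: cnorm_ge0.
have [kk0|kk0] := leqP k0 k.
  rewrite ler_wpDr ?sumr_ge0// => [i _|]; first exact: cnorm_ge0.
  by have := cnormD (u k - l) l; rewrite subrK => /le_trans; apply; rewrite lerD2r h.
rewrite (bigD1 (Ordinal kk0))//= ler_wpDl ?addr_ge0 ?cnorm_ge0// lerDl sumr_ge0// => i _; exact: cnorm_ge0.
Qed.

Lemma ctendM u v l l' : ctend u l -> ctend v l' -> ctend (fun k => u k * v k) (l * l').
Proof.
move=> ul vl e e0; have [C C0 uC] := ctend_bounded ul.
have a0 : 0 < cnorm l' + 1 by rewrite ltr_wpDl ?cnorm_ge0.
have [k0 h] := ul _ (divr_gt0 (divr_gt0 e0 (ltr0n _ 2)) a0).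
have [k0' h'] := vl _ (divr_gt0 (divr_gt0 e0 (ltr0n _ 2)) C0).
exists (maxn k0 k0') => k; rewrite geq_max => /andP[/h hk /h' hk'].
have -> : u k * v k - l * l' = u k * (v k - l') + (u k - l) * l' by ring.
apply: le_trans (cnormD _ _) _; rewrite !cnormM [leRHS](splitr e); apply: lerD.
  apply: le_trans (ler_pM _ _ (uC k) hk') _; rewrite ?cnorm_ge0//.
  by rewrite mulrC divfK// gt_eqF.
apply: le_trans (ler_pM _ _ hk (_ : _ <= cnorm l' + 1)) _; rewrite ?cnorm_ge0 ?lerDl//.
by rewrite divfK// gt_eqF.
Qed.

Lemma ctend_sum (I : Type) (r : seq I) (u : I -> nat -> R[i]) (l : I -> R[i]) :
  (forall i, ctend (u i) (l i)) ->
  ctend (fun k => \sum_(i <- r) u i k) (\sum_(i <- r) l i).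
Proof.
move=> ul; elim: r => [|i r IH].
  by rewrite big_nil (_ : (fun _ => _) = fun=> 0); [exact: ctend_cst|apply/funext => k; rewrite big_nil].
by rewrite big_cons (_ : (fun _ => _) = fun k => u i k + \sum_(j <- r) u j k); [exact: ctendD|apply/funext => k; rewrite big_cons].
Qed.

(** Dominated convergence: the common majorant gives one finite set outside of which all tails are
    small, and finite sums pass to the limit. *)
Lemma csum_ctend C (f : nat -> Z -> R[i]) g : (forall k, sdom C (f k)) -> sdom C g ->
  (forall m, ctend (fun k => f k m) (g m)) -> ctend (fun k => csum (f k)) (csum g).
Proof.
move=> fC gC fg e e0; have e3 : 0 < e / 3 by rewrite divr_gt0.
have [F0 uF0 hF0] := @csum_tail C _ e3.
have [k0 h] := ctend_sum F0 fg e3; exists k0 => k /h hk.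
have h1 := hF0 _ (fC k) _ uF0 (fun m => id); have h2 := hF0 _ gC _ uF0 (fun m => id).
have -> : csum (f k) - csum g = (csum (f k) - \sum_(m <- F0) f k m) +
   ((\sum_(m <- F0) f k m - \sum_(m <- F0) g m) - (csum g - \sum_(m <- F0) g m)) by ring.
apply: le_trans (cnormD _ _) _; have := cnormB (\sum_(m <- F0) f k m - \sum_(m <- F0) g m) (csum g - \sum_(m <- F0) g m).
move: h1 h2 hk; lra.
Qed.

End Sums.

Section Exhaust.
Variable n : nat.
(** An exhaustion of the lattice by finite sets, read off from its encoding in the natural
    numbers. *)
Definition exhaust (L : nat) : seq 'rV[int]_n := undup (pmap (@choice.pickle_inv _) (iota 0 L)).
Lemma exhaust_uniq L : uniq (exhaust L).
Proof. exact: undup_uniq. Qed.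

Lemma mem_exhaust L (m : 'rV[int]_n) : (choice.pickle m < L)%N -> m \in exhaust L.
Proof.
move=> mL; rewrite mem_undup mem_pmap; apply/mapP; exists (choice.pickle m); first by rewrite mem_iota.
by rewrite choice.pickleK_inv.
Qed.
End Exhaust.

(** * Bounded families and the twisted product *)

Section Families.
Context {R : realType} {n : nat}.
Local Notation Z := 'rV[int]_n.

(** Bounded subsets of the Frechet space of rapidly decreasing families: each seminorm has one
    constant for all indices. *)
Definition sbf {I : Type} (f : I -> Z -> R[i]) :=
  forall K : nat, exists C : R, forall i m, cnorm (f i m) * wt m ^+ K <= C.

Lemma sbf_smooth (I : Type) (f : I -> Z -> R[i]) i : sbf f -> smooth (f i).
Proof. by move=> fb K; have [C hC] := fb K; exists C => m; exact: hC. Qed.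

Lemma smooth_sbf (I : Type) (a : Z -> R[i]) : smooth a -> sbf (fun _ : I => a).
Proof. by move=> sa K; have [C hC] := sa K; exists C => i m; exact: hC. Qed.

Lemma sbf_ge0 (I : Type) (f : I -> Z -> R[i]) K : sbf f ->
  exists2 C : R, 0 <= C & forall i m, cnorm (f i m) * wt m ^+ K <= C.
Proof.
move=> fb; have [C hC] := fb K; exists `|C| => // i m; exact: le_trans (hC i m) (ler_norm _).
Qed.

Lemma sbf_le (I : Type) (f g : I -> Z -> R[i]) (C : R) (L : nat) :
  (forall i m, cnorm (f i m) <= C * wt m ^+ L * cnorm (g i m)) -> sbf g -> sbf f.
Proof.
move=> fg gb K; have [B B0 hB] := sbf_ge0 (K + L) gb; exists (`|C| * B) => i m.
apply: (@le_trans _ _ (`|C| * (cnorm (g i m) * wt m ^+ (K + L)))); last by rewrite ler_wpM2l.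
rewrite exprD; apply: (@le_trans _ _ (C * wt m ^+ L * cnorm (g i m) * wt m ^+ K)).
  by rewrite ler_wpM2r ?wtX_ge0.
have -> : C * wt m ^+ L * cnorm (g i m) * wt m ^+ K = C * (cnorm (g i m) * (wt m ^+ K * wt m ^+ L)) by ring.
by rewrite ler_wpM2r ?mulr_ge0 ?cnorm_ge0 ?wtX_ge0 ?ler_norm.
Qed.

Lemma sbfD (I : Type) (f g : I -> Z -> R[i]) : sbf f -> sbf g -> sbf (fun i m => f i m + g i m).
Proof.
move=> fb gb K; have [C hC] := fb K; have [C' hC'] := gb K; exists (C + C') => i m.
apply: le_trans (lerD (hC i m) (hC' i m)); rewrite -mulrDl ler_wpM2r ?wtX_ge0//; exact: cnormD.
Qed.

Lemma sbf0 (I : Type) : sbf (fun (_ : I) (_ : Z) => 0).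
Proof. by move=> K; exists 0 => i m; rewrite cnorm0 mul0r. Qed.

Lemma sbfM (I : Type) (c : I -> Z -> R[i]) (C : R) f : (forall i m, cnorm (c i m) <= C) -> sbf f ->
  sbf (fun i m => c i m * f i m).
Proof.
move=> cC; apply: (@sbf_le _ _ _ C 0) => i m.
by rewrite expr0 mulr1 cnormM ler_wpM2r ?cnorm_ge0.
Qed.

Lemma sbfZ (I : Type) (c : R[i]) (f : I -> Z -> R[i]) : sbf f -> sbf (fun i m => c * f i m).
Proof. exact: (@sbfM _ (fun _ _ => c) (cnorm c)). Qed.

Lemma sbf_sum (I : Type) (J : Type) (r : seq J) (f : J -> I -> Z -> R[i]) :
  (forall j, sbf (f j)) -> sbf (fun i m => \sum_(j <- r) f j i m).
Proof.
move=> fb; elim: r => [|j r IH].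
  by apply: (@sbf_le _ _ (fun _ _ => 0) 0 0) (@sbf0 I) => i m; rewrite big_nil cnorm0 mulr0.
apply: (@sbf_le _ _ (fun i m => f j i m + \sum_(j <- r) f j i m) 1 0) (sbfD (fb j) IH) => i m.
by rewrite big_cons expr0 !mul1r.
Qed.

Lemma sbf_sdom (I : Type) (f : I -> Z -> R[i]) : sbf f -> exists C : R, forall i, sdom C (f i).
Proof.
move=> fb; have [C hC] := fb (2 * n)%N; exists C => i m.
by rewrite /om ler_pdivlMr ?wtX_gt0.
Qed.

Lemma sbf_wtV (I : Type) (f : I -> Z -> R[i]) K : sbf f ->
  exists2 C : R, 0 <= C & forall i m, cnorm (f i m) <= C / wt m ^+ K.
Proof.
by move=> fb; have [C C0 hC] := sbf_ge0 K fb; exists C => // i m; rewrite ler_pdivlMr ?wtX_gt0.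
Qed.

Lemma sbf_ctend_smooth (f : nat -> Z -> R[i]) g : sbf f -> (forall m, ctend (f^~ m) (g m)) -> smooth g.
Proof.
move=> fb fg K; have [C C0 hC] := sbf_ge0 K fb; exists (C + 1) => m.
have w0 := @wtX_gt0 R n m K; have wV : 0 < (wt m ^+ K)^-1 :> R by rewrite invr_gt0.
have [k0 /(_ k0 (leqnn _)) h] := fg m _ wV.
have := cnormB (f k0 m) (f k0 m - g m); rewrite opprB addrC subrK => h2.
apply: le_trans (ler_wpM2r (ltW w0) h2) _; rewrite mulrDl; apply: lerD => //.
by apply: le_trans (ler_wpM2r (ltW w0) h) _; rewrite mulVf// gt_eqF.
Qed.

End Families.

Section MulA.
Context {R : realType} {n : nat}.
Local Notation Z := 'rV[int]_n.
Variable theta : 'M[R]_n.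
Local Notation phase := (Defs.phase theta).
Local Notation mulA := (Defs.mulA theta).

Definition expi (t : R) : R[i] := cos t +i* sin t.

Lemma expiD s t : expi (s + t) = expi s * expi t.
Proof. by rewrite /expi cosD sinD; apply/eqP; rewrite eq_complex /= eqxx /= addrC mulrC. Qed.

Lemma expi0 : expi 0 = 1.
Proof. by rewrite /expi cos0 sin0. Qed.

Lemma cnorm_expi t : cnorm (expi t) = 1.
Proof. by rewrite /cnorm /= cos2Dsin2 sqrtr1. Qed.

Lemma expiN t : expi (- t) = (expi t)^*.
Proof. by rewrite /expi cosN sinN. Qed.

Definition thb (l m : Z) : R := pi * \sum_p \sum_q theta p q * (l 0 p)%:~R * (m 0 q)%:~R.

Lemma phaseE l m : phase l m = expi (thb l m).
Proof. by []. Qed.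

Lemma thbDl l l' m : thb (l + l') m = thb l m + thb l' m.
Proof.
rewrite /thb -mulrDr -big_split; congr (_ * _); apply: eq_bigr => p _ /=.
by rewrite -big_split; apply: eq_bigr => q _ /=; rewrite mxE intrD mulrDr mulrDl.
Qed.

Lemma thbDr l m m' : thb l (m + m') = thb l m + thb l m'.
Proof.
rewrite /thb -mulrDr -big_split; congr (_ * _); apply: eq_bigr => p _ /=.
by rewrite -big_split; apply: eq_bigr => q _ /=; rewrite mxE intrD mulrDr.
Qed.

Lemma thb0l m : thb 0 m = 0.
Proof. by have := thbDl 0 0 m; rewrite addr0 => /eqP; rewrite -subr_eq subrr eq_sym => /eqP. Qed.

Lemma thb0r l : thb l 0 = 0.
Proof. by have := thbDr l 0 0; rewrite addr0 => /eqP; rewrite -subr_eq subrr eq_sym => /eqP. Qed.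

Lemma thbNr l m : thb l (- m) = - thb l m.
Proof. by apply/eqP; rewrite -addr_eq0 -thbDr addNr thb0r. Qed.

Lemma phaseDl l l' m : phase (l + l') m = phase l m * phase l' m.
Proof. by rewrite !phaseE thbDl expiD. Qed.

Lemma phaseDr l m m' : phase l (m + m') = phase l m * phase l m'.
Proof. by rewrite !phaseE thbDr expiD. Qed.

Lemma phase0l m : phase 0 m = 1.
Proof. by rewrite phaseE thb0l expi0. Qed.

Lemma phase0r m : phase m 0 = 1.
Proof. by rewrite phaseE thb0r expi0. Qed.

Lemma cnorm_phase l m : cnorm (phase l m) = 1.
Proof. by rewrite phaseE cnorm_expi. Qed.

(** Of the decay of [a], the power [2 * n] is spent on summability in [l]; the remaining power [K],
    together with that of [f], becomes decay in [m] by the submultiplicativity of the weight. *)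
Lemma conv_dom (I : Type) (a f : I -> Z -> R[i]) K : sbf a -> sbf f ->
  exists2 C : R, 0 <= C & forall i m,
    sdom (C / wt m ^+ K) (fun l => a i l * f i (m - l) * phase l (m - l)).
Proof.
move=> ab fb; have [Ca Ca0 hCa] := sbf_wtV (K + 2 * n) ab; have [Cf Cf0 hCf] := sbf_wtV K fb.
exists (Ca * Cf); first exact: mulr_ge0.
move=> i m l; rewrite !cnormM cnorm_phase mulr1.
apply: le_trans (ler_pM _ _ (hCa i l) (hCf i (m - l))) _; rewrite ?cnorm_ge0//.
rewrite exprD /om invfM.
have -> : Ca * ((wt l ^+ K)^-1 / wt l ^+ (2 * n)) * (Cf / wt (m - l) ^+ K) =
   (Ca * Cf / wt l ^+ (2 * n)) * (wt l ^+ K * wt (m - l) ^+ K)^-1 by rewrite invfM; ring.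
have -> : Ca * Cf / wt m ^+ K / wt l ^+ (2 * n) = (Ca * Cf / wt l ^+ (2 * n)) * (wt m ^+ K)^-1 by ring.
rewrite ler_wpM2l ?divr_ge0 ?mulr_ge0 ?wtX_ge0// lef_pV2 ?posrE ?mulr_gt0 ?wtX_gt0//.
by have := @wtXD R n l (m - l) K; rewrite subrKC.
Qed.

Lemma conv_sdom (a b : Z -> R[i]) m : smooth a -> smooth b ->
  exists C, sdom C (fun l => a l * b (m - l) * phase l (m - l)).
Proof.
move=> sa sb; have [C _ h] := conv_dom 0 (smooth_sbf unit sa) (smooth_sbf unit sb).
by exists (C / wt m ^+ 0); exact: h tt m.
Qed.

Lemma sbf_mulA (I : Type) (a f : I -> Z -> R[i]) : sbf a -> sbf f ->
  sbf (fun i => mulA (a i) (f i)).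
Proof.
move=> ab fb K; have [C C0 hC] := conv_dom K ab fb; exists (2 * (C * 6 ^+ n)) => i m.
rewrite -ler_pdivlMr ?wtX_gt0//; apply: le_trans (csum_bound (hC i m)) _.
by rewrite le_eqVlt; apply/orP; left; apply/eqP; ring.
Qed.

Lemma ctend_mulA (a f : nat -> Z -> R[i]) a' f' : sbf a -> sbf f ->
  (forall m, ctend (a^~ m) (a' m)) -> (forall m, ctend (f^~ m) (f' m)) ->
  forall m, ctend (fun k => mulA (a k) (f k) m) (mulA a' f' m).
Proof.
move=> ab fb aa' ff' m; have [C C0 hC] := conv_dom 0 ab fb.
have [C' hC'] := conv_sdom m (sbf_ctend_smooth ab aa') (sbf_ctend_smooth fb ff').
apply: (@csum_ctend _ _ (Num.max (C / wt m ^+ 0) C')) => [k||l].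
- by apply: sdom_le (hC k m); rewrite le_max lexx.
- by apply: sdom_le hC'; rewrite le_max lexx orbT.
- by apply: ctendM; [apply: ctendM|exact: ctend_cst].
Qed.

Lemma smooth_mulA a b : smooth a -> smooth b -> smooth (mulA a b).
Proof.
by move=> sa sb; apply: (@sbf_smooth _ _ unit (fun=> mulA a b) tt); apply: sbf_mulA; exact: smooth_sbf.
Qed.

Lemma mulAl_linear c a a' b : smooth a -> smooth a' -> smooth b ->
  mulA (fun m => c * a m + a' m) b = fun m => c * mulA a b m + mulA a' b m.
Proof.
move=> sa sa' sb; apply/funext => m.
have [C hC] := conv_sdom m sa sb; have [C' hC'] := conv_sdom m sa' sb.
rewrite /Defs.mulA -(csum_linear c hC hC'); congr csum; apply/funext => l; ring.
Qed.

Lemma mulAr_linear c a b b' : smooth a -> smooth b -> smooth b' ->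
  mulA a (fun m => c * b m + b' m) = fun m => c * mulA a b m + mulA a b' m.
Proof.
move=> sa sb sb'; apply/funext => m.
have [C hC] := conv_sdom m sa sb; have [C' hC'] := conv_sdom m sa sb'.
rewrite /Defs.mulA -(csum_linear c hC hC'); congr csum; apply/funext => l; ring.
Qed.

Definition delta (q : Z) : Z -> R[i] := fun m => if m == q then 1 else 0.

Lemma smooth_fin (a : Z -> R[i]) q : (forall m, m != q -> a m = 0) -> smooth a.
Proof.
move=> a0 K; exists (cnorm (a q) * wt q ^+ K) => m.
by have [->//|/a0 ->] := eqVneq m q; rewrite cnorm0 mul0r mulr_ge0 ?cnorm_ge0 ?wtX_ge0.
Qed.

Lemma smooth_delta q : smooth (delta q).
Proof. by apply: (@smooth_fin _ q) => m mq; rewrite /delta (negbTE mq). Qed.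

Lemma mulA_deltar a q m : mulA a (delta q) m = a (m - q) * phase (m - q) q.
Proof.
rewrite /Defs.mulA (@csum1 _ _ _ (m - q)) => [|l lmq]; last first.
  have -> : delta q (m - l) = 0; last by rewrite mulr0 mul0r.
  by rewrite /delta subr_eq addrC -subr_eq eq_sym (negbTE lmq).
by rewrite /delta opprB addrCA subrr addr0 eqxx mulr1.
Qed.

Lemma mulA_deltal b q m : mulA (delta q) b m = b (m - q) * phase q (m - q).
Proof.
rewrite /Defs.mulA (@csum1 _ _ _ q) => [|l lq]; last by rewrite /delta (negbTE lq) !mul0r.
by rewrite /delta eqxx mul1r.
Qed.

End MulA.

(** * Smooth spinors as a module, their bounded families and convergence *)

Section Spinors.
Context {R : realType} {n N : nat}.
Local Notation Z := 'rV[int]_n.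

(** Bundling the smoothness turns operators that are meaningful on smooth families only into genuine
    maps of a module, for which [linear] and the generic lemmas on sums apply. *)
Record sspinor := SSpinor { spv :> 'rV[int]_n -> 'cV[R[i]]_N; spP : @smooth_spinor R n N spv }.

Lemma sspinor_eq (phi psi : sspinor) : (forall m, phi m = psi m) -> phi = psi.
Proof.
case: phi psi => [f fP] [g gP] /= /funext fg; case: _ / fg gP => gP.
by congr SSpinor; exact: Prop_irrelevance.
Qed.

HB.instance Definition _ := gen_eqMixin sspinor.
HB.instance Definition _ := gen_choiceMixin sspinor.

Lemma sspD_subproof (phi psi : sspinor) : smooth_spinor (fun m => phi m + psi m).
Proof.
move=> j; have := sbfD (smooth_sbf unit (spP phi j)) (smooth_sbf unit (spP psi j)).
move/(sbf_smooth tt) => h K; have [C hC] := h K; exists C => m; rewrite mxE; exact: hC.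
Qed.

Lemma sspZ_subproof (c : R[i]) (phi : sspinor) : smooth_spinor (fun m => c *: phi m).
Proof.
move=> j; have := sbfZ c (smooth_sbf unit (spP phi j)).
move/(sbf_smooth tt) => h K; have [C hC] := h K; exists C => m; rewrite mxE; exact: hC.
Qed.

Lemma ssp0_subproof : smooth_spinor (fun _ : Z => 0 : 'cV[R[i]]_N).
Proof. by move=> j K; exists 0 => m; rewrite mxE cnorm0 mul0r. Qed.

Definition ssp0 := SSpinor ssp0_subproof.
Definition sspD phi psi := SSpinor (sspD_subproof phi psi).
Definition sspZ c phi := SSpinor (sspZ_subproof c phi).

Fact sspDA : associative sspD.
Proof. by move=> a b c; apply: sspinor_eq => m; exact: addrA. Qed.

Fact sspDC : commutative sspD.
Proof. by move=> a b; apply: sspinor_eq => m; exact: addrC. Qed.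

Fact ssp0D : left_id ssp0 sspD.
Proof. by move=> a; apply: sspinor_eq => m; exact: add0r. Qed.

Fact sspND : left_inverse ssp0 (sspZ (-1)) sspD.
Proof. by move=> a; apply: sspinor_eq => m /=; rewrite scaleN1r addNr. Qed.

HB.instance Definition _ := GRing.isZmodule.Build sspinor sspDA sspDC ssp0D sspND.

Fact sspZA a b v : sspZ a (sspZ b v) = sspZ (a * b) v.
Proof. by apply: sspinor_eq => m; exact: scalerA. Qed.

Fact sspZ1 : left_id 1 sspZ.
Proof. by move=> a; apply: sspinor_eq => m; exact: scale1r. Qed.

Fact sspZDr : right_distributive sspZ +%R.
Proof. by move=> c a b; apply: sspinor_eq => m; exact: scalerDr. Qed.

Fact sspZDl v : {morph sspZ^~ v : a b / a + b}.
Proof. by move=> a b; apply: sspinor_eq => m; exact: scalerDl. Qed.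

HB.instance Definition _ := GRing.Zmodule_isLmodule.Build R[i] sspinor sspZA sspZ1 sspZDr sspZDl.

Lemma sspDE (phi psi : sspinor) m : (phi + psi) m = phi m + psi m.
Proof. by []. Qed.

Lemma sspZE c (phi : sspinor) m : (c *: phi) m = c *: phi m.
Proof. by []. Qed.

Lemma sspNE (phi : sspinor) m : (- phi) m = - phi m.
Proof. by rewrite -scaleN1r sspZE scaleN1r. Qed.

Lemma ssp0E m : (0 : sspinor) m = 0.
Proof. by []. Qed.

Lemma ssp_sumE (I : Type) (r : seq I) (P : pred I) (F : I -> sspinor) m :
  (\sum_(i <- r | P i) F i) m = \sum_(i <- r | P i) F i m.
Proof. by apply: (big_morph (fun psi : sspinor => psi m)). Qed.

Definition bfam {I : Type} (psi : I -> sspinor) := forall j, sbf (fun i m => psi i m j 0).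

Lemma bfam_eq (I : Type) (phi psi : I -> sspinor) : (forall i, phi i = psi i) -> bfam phi -> bfam psi.
Proof. by move/funext => ->. Qed.

Lemma bfam_cst (I : Type) phi : bfam (fun _ : I => phi).
Proof. by move=> j; apply: smooth_sbf (spP phi j). Qed.

Lemma bfamD (I : Type) (phi psi : I -> sspinor) : bfam phi -> bfam psi -> bfam (fun i => phi i + psi i).
Proof.
move=> fb gb j; have := sbfD (fb j) (gb j); apply: (@sbf_le _ _ _ _ _ 1 0) => i m.
by rewrite !mul1r mxE.
Qed.

Lemma bfamZ (I : Type) (c : I -> R[i]) (C : R) (phi : I -> sspinor) :
  (forall i, cnorm (c i) <= C) -> bfam phi -> bfam (fun i => c i *: phi i).
Proof.
move=> cC fb j; have := fb j; apply: (@sbf_le _ _ _ _ _ C 0) => i m.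
by rewrite mxE cnormM expr0 mulr1 ler_wpM2r ?cnorm_ge0.
Qed.

Lemma bfam_sum (I J : Type) (r : seq J) (phi : J -> I -> sspinor) :
  (forall j, bfam (phi j)) -> bfam (fun i => \sum_(j <- r) phi j i).
Proof.
move=> fb; elim: r => [|j r IH].
  by apply: bfam_eq (bfam_cst I 0) => i; rewrite big_nil.
by apply: bfam_eq (bfamD (fb j) IH) => i; rewrite big_cons.
Qed.

(** Boundedness together with coefficientwise convergence: for rapidly decreasing families this
    amounts to convergence in every seminorm, and it is easier to verify. *)
Definition stend (psi : nat -> sspinor) (phi : sspinor) :=
  bfam psi /\ forall m j, ctend (fun k => psi k m j 0) (phi m j 0).

Lemma stend_cst phi : stend (fun=> phi) phi.
Proof. by split=> [|m j]; [exact: bfam_cst|exact: ctend_cst]. Qed.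

Lemma stend_eq (phi psi : nat -> sspinor) l : (forall i, phi i = psi i) -> stend phi l -> stend psi l.
Proof. by move/funext => ->. Qed.

Lemma stend_unique psi phi phi' : stend psi phi -> stend psi phi' -> phi = phi'.
Proof.
move=> [_ h] [_ h']; apply: sspinor_eq => m; apply/colP => j; exact: ctend_unique (h m j) (h' m j).
Qed.

Lemma stendD psi psi' phi phi' : stend psi phi -> stend psi' phi' ->
  stend (fun k => psi k + psi' k) (phi + phi').
Proof.
move=> [b h] [b' h']; split=> [|m j]; first exact: bfamD.
rewrite mxE (_ : (fun _ => _) = fun k => psi k m j 0 + psi' k m j 0); first exact: ctendD.
by apply/funext => k; rewrite mxE.
Qed.

Lemma stendZ c c' psi phi : ctend c c' -> stend psi phi -> stend (fun k => c k *: psi k) (c' *: phi).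
Proof.
move=> cc' [b h]; split=> [|m j]; first by have [C _ hC] := ctend_bounded cc'; exact: bfamZ hC b.
rewrite mxE (_ : (fun _ => _) = fun k => c k * psi k m j 0); first exact: ctendM.
by apply/funext => k; rewrite mxE.
Qed.

Lemma stend_sum (I : Type) (r : seq I) (psi : I -> nat -> sspinor) phi :
  (forall i, stend (psi i) (phi i)) -> stend (fun k => \sum_(i <- r) psi i k) (\sum_(i <- r) phi i).
Proof.
move=> h; elim: r => [|i r IH].
  by rewrite big_nil; apply: stend_eq (stend_cst 0) => k; rewrite big_nil.
by rewrite big_cons; apply: stend_eq (stendD (h i) IH) => k; rewrite big_cons.
Qed.

(* Sequential continuity for the Frechet topology of rapidly decreasing spinors. *)
Definition scont (X : sspinor -> sspinor) :=
  forall psi phi, stend psi phi -> stend (fun k => X (psi k)) (X phi).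

Lemma smooth_basis q j : smooth_spinor (@spin_basis R n N q j).
Proof.
move=> i; apply: (@smooth_fin _ _ _ q) => m mq.
by rewrite /spin_basis (negbTE mq) mxE.
Qed.

Definition basis q j := SSpinor (smooth_basis q j).

Lemma basisE q j m i : basis q j m i 0 = ((m == q) && (i == j))%:R.
Proof. by rewrite /= /spin_basis; case: eqP => _; rewrite mxE // eqxx andbT. Qed.

Definition trunc (L : nat) (psi : sspinor) : sspinor :=
  \sum_(q <- exhaust n L) \sum_j psi q j 0 *: basis q j.

Lemma truncE L psi m :
  trunc L psi m = if m \in exhaust n L then psi m else 0.
Proof.
rewrite /trunc; have uF := exhaust_uniq n L.
rewrite ssp_sumE; apply/colP => i; rewrite summxE.
have E q : (\sum_j psi q j 0 *: basis q j) m i 0 = (m == q)%:R * psi q i 0 :> R[i].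
  rewrite ssp_sumE summxE (bigD1 i)//= mxE basisE eqxx andbT mulrC big1 ?addr0// => j ji.
  by rewrite mxE basisE [i == j]eq_sym (negbTE ji) andbF mulr0.
under eq_bigr do rewrite E.
case: ifP => mF.
  rewrite (bigD1_seq m)//= eqxx mul1r big1 ?addr0// => q qm.
  by rewrite eq_sym (negbTE qm) mul0r.
rewrite mxE big_seq big1 // => q qF; case: eqP => [mq|_]; last by rewrite mul0r.
by rewrite mq qF in mF.
Qed.

Lemma stend_trunc psi : stend (trunc^~ psi) psi.
Proof.
split=> [j|m j].
  apply: (@sbf_le _ _ _ _ (fun _ m => psi m j 0) 1 0); last exact: smooth_sbf (spP psi j).
  move=> L m; rewrite !mul1r truncE; case: ifP => _ //; rewrite mxE cnorm0; exact: cnorm_ge0.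
move=> e e0; exists (choice.pickle m).+1 => L mL; rewrite truncE ifT ?subrr ?cnorm0 ?ltW//.
exact: mem_exhaust.
Qed.

(** Truncations are finite combinations of basis spinors and converge to [psi]. Identities between
    multipliers are thereby reduced to convolutions with a delta, without interchanging infinite
    sums. *)
Lemma scont_ext (X Y : {linear sspinor -> sspinor}) : scont X -> scont Y ->
  (forall q j, X (basis q j) = Y (basis q j)) -> X =1 Y.
Proof.
move=> cX cY XY psi; apply: (stend_unique (cX _ _ (stend_trunc psi))).
apply: stend_eq (cY _ _ (stend_trunc psi)) => L; rewrite /trunc !linear_sum.
apply: eq_bigr => q _; rewrite !linear_sum; apply: eq_bigr => j _.
by rewrite !linearZ XY.
Qed.

Lemma scont_comp X Y : scont X -> scont Y -> scont (X \o Y).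
Proof. by move=> cX cY psi phi h; apply: cX; apply: cY. Qed.

End Spinors.
Arguments sspinor : clear implicits.
Arguments SSpinor {R n N} _ _.

(** * The smooth algebra of the torus and its left and right actions *)

Section NCAlgebra.
Context {R : realType} {n : nat}.
Local Notation Z := 'rV[int]_n.

(** [theta] is a phantom parameter: the elements are the same families for all [theta], but the ring
    structure attached to the type depends on it. *)
Record ncalg (theta : 'M[R]_n) := NCAlg { ncv :> Z -> R[i]; ncP : smooth ncv }.

Variable theta : 'M[R]_n.
Local Notation A := (ncalg theta).
Local Notation phase := (Defs.phase theta).
Local Notation mulA := (Defs.mulA theta).

Lemma ncalg_eq (a b : A) : (forall m, a m = b m) -> a = b.
Proof.
case: a b => [f fP] [g gP] /= /funext fg; case: _ / fg gP => gP.
by congr NCAlg; exact: Prop_irrelevance.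
Qed.

HB.instance Definition _ := gen_eqMixin A.
HB.instance Definition _ := gen_choiceMixin A.

Definition nbf {I : Type} (a : I -> A) := sbf (fun i m => a i m).

Lemma nbf_cst (I : Type) (a : A) : nbf (fun _ : I => a).
Proof. exact: smooth_sbf (ncP a). Qed.

Lemma nc0_subproof : smooth (fun _ : Z => 0 : R[i]).
Proof. by move=> K; exists 0 => m; rewrite cnorm0 mul0r. Qed.

Lemma ncD_subproof (a b : A) : smooth (fun m => a m + b m).
Proof. exact: (sbf_smooth tt (sbfD (smooth_sbf unit (ncP a)) (smooth_sbf unit (ncP b)))). Qed.

Lemma ncZ_subproof (c : R[i]) (a : A) : smooth (fun m => c * a m).
Proof. exact: (sbf_smooth tt (sbfZ c (smooth_sbf unit (ncP a)))). Qed.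

Definition nc0 : A := NCAlg theta nc0_subproof.
Definition ncD (a b : A) : A := NCAlg theta (ncD_subproof a b).
Definition ncZ c (a : A) : A := NCAlg theta (ncZ_subproof c a).
Definition ncM (a b : A) : A := NCAlg theta (smooth_mulA theta (ncP a) (ncP b)).
Definition ncdelta q : A := NCAlg theta (smooth_delta q).
Definition nc1 : A := ncdelta 0.

Fact ncDA : associative ncD.
Proof. by move=> a b c; apply: ncalg_eq => m; exact: addrA. Qed.

Fact ncDC : commutative ncD.
Proof. by move=> a b; apply: ncalg_eq => m; exact: addrC. Qed.

Fact nc0D : left_id nc0 ncD.
Proof. by move=> a; apply: ncalg_eq => m; exact: add0r. Qed.

Fact ncND : left_inverse nc0 (ncZ (-1)) ncD.
Proof. by move=> a; apply: ncalg_eq => m /=; rewrite mulN1r addNr. Qed.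

HB.instance Definition _ := GRing.isZmodule.Build A ncDA ncDC nc0D ncND.

Fact ncZA a b (v : A) : ncZ a (ncZ b v) = ncZ (a * b) v.
Proof. by apply: ncalg_eq => m; exact: mulrA. Qed.

Fact ncZ1 : left_id 1 ncZ.
Proof. by move=> a; apply: ncalg_eq => m; exact: mul1r. Qed.

Fact ncZDr : right_distributive ncZ +%R.
Proof. by move=> c a b; apply: ncalg_eq => m; exact: mulrDr. Qed.

Fact ncZDl v : {morph ncZ^~ v : a b / a + b}.
Proof. by move=> a b; apply: ncalg_eq => m; exact: mulrDl. Qed.

HB.instance Definition _ := GRing.Zmodule_isLmodule.Build R[i] A ncZA ncZ1 ncZDr ncZDl.

Lemma ncDE (a b : A) m : (a + b) m = a m + b m. Proof. by []. Qed.

Lemma ncZE c (a : A) m : (c *: a) m = c * a m. Proof. by []. Qed.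

Lemma ncNE (a : A) m : (- a) m = - a m.
Proof. by rewrite -scaleN1r ncZE mulN1r. Qed.

Section Operators.
Context {N : nat}.
Local Notation S := (sspinor R n N).

Lemma Lop_subproof (a : A) (psi : S) : smooth_spinor (lmul theta a psi).
Proof.
move=> i K; have [C hC] := smooth_mulA theta (ncP a) (spP psi i) K.
by exists C => m; rewrite mxE; exact: hC.
Qed.

Definition Lop (a : A) (psi : S) : S := SSpinor _ (Lop_subproof a psi).

Lemma Rop_subproof (b : A) (psi : S) : smooth_spinor (rmul theta b psi).
Proof.
move=> i K; have [C hC] := smooth_mulA theta (spP psi i) (ncP b) K.
by exists C => m; rewrite mxE; exact: hC.
Qed.

Definition Rop (b : A) (psi : S) : S := SSpinor _ (Rop_subproof b psi).

Lemma LopE a psi m i : Lop a psi m i 0 = mulA a (fun l => psi l i 0) m.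
Proof. by rewrite mxE. Qed.

Lemma RopE b psi m i : Rop b psi m i 0 = mulA (fun l => psi l i 0) b m.
Proof. by rewrite mxE. Qed.

Lemma sspinor_eqP (phi psi : S) : (forall m i, phi m i 0 = psi m i 0) -> phi = psi.
Proof. by move=> h; apply: sspinor_eq => m; apply/colP => i; exact: h. Qed.

Lemma sspLin c (phi psi : S) i :
  (fun l => (c *: phi + psi) l i 0) = fun l => c * phi l i 0 + psi l i 0.
Proof. by apply/funext => l; rewrite !mxE. Qed.

Fact Lop_linear a : linear (Lop a).
Proof.
move=> c phi psi; apply: sspinor_eqP => m i.
by rewrite LopE sspLin (mulAr_linear _ _ (ncP a) (spP phi i) (spP psi i)) !mxE.
Qed.
HB.instance Definition _ a := GRing.isLinear.Build R[i] S S *:%R (Lop a) (Lop_linear a).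

Fact Rop_linear b : linear (Rop b).
Proof.
move=> c phi psi; apply: sspinor_eqP => m i.
by rewrite RopE sspLin (mulAl_linear _ _ (spP phi i) (spP psi i) (ncP b)) !mxE.
Qed.
HB.instance Definition _ b := GRing.isLinear.Build R[i] S S *:%R (Rop b) (Rop_linear b).

Lemma bfam_Lop (I : Type) (a : I -> A) (psi : I -> S) :
  nbf a -> bfam psi -> bfam (fun i => Lop (a i) (psi i)).
Proof.
move=> ab pb j; apply: (sbf_le (C := 1) (L := 0) _ (sbf_mulA theta ab (pb j))).
by move=> i m; rewrite !mul1r LopE.
Qed.

Lemma bfam_Rop (I : Type) (b : I -> A) (psi : I -> S) :
  nbf b -> bfam psi -> bfam (fun i => Rop (b i) (psi i)).
Proof.
move=> ab pb j; apply: (sbf_le (C := 1) (L := 0) _ (sbf_mulA theta (pb j) ab)).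
by move=> i m; rewrite !mul1r RopE.
Qed.

Lemma stend_Lop (a : nat -> A) (a' : A) (psi : nat -> S) phi : nbf a ->
  (forall m, ctend (fun k => a k m) (a' m)) -> stend psi phi ->
  stend (fun k => Lop (a k) (psi k)) (Lop a' phi).
Proof.
move=> ab aa' [pb pp]; split=> [|m j]; first exact: bfam_Lop.
rewrite LopE (_ : (fun _ => _) = fun k => mulA (a k) (fun l => psi k l j 0) m).
  by apply: ctend_mulA => //; exact: pb.
by apply/funext => k; rewrite LopE.
Qed.

Lemma stend_Rop (b : nat -> A) (b' : A) (psi : nat -> S) phi : nbf b ->
  (forall m, ctend (fun k => b k m) (b' m)) -> stend psi phi ->
  stend (fun k => Rop (b k) (psi k)) (Rop b' phi).
Proof.
move=> ab aa' [pb pp]; split=> [|m j]; first exact: bfam_Rop.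
rewrite RopE (_ : (fun _ => _) = fun k => mulA (fun l => psi k l j 0) (b k) m).
  by apply: ctend_mulA => //; exact: pb.
by apply/funext => k; rewrite RopE.
Qed.

Lemma scont_Lop a : scont (Lop a).
Proof. by move=> psi phi h; apply: stend_Lop h => [|m]; [exact: nbf_cst|exact: ctend_cst]. Qed.

Lemma scont_Rop b : scont (Rop b).
Proof. by move=> psi phi h; apply: stend_Rop h => [|m]; [exact: nbf_cst|exact: ctend_cst]. Qed.

Lemma basis_col q j i : (fun l => @basis R n N q j l i 0) = fun l => (i == j)%:R * delta q l.
Proof. by apply/funext => l; rewrite basisE /delta andbC; case: eqP; case: eqP; rewrite ?mulr1 ?mulr0. Qed.

Lemma mulAZl c a b m : smooth a -> smooth b -> mulA (fun l => c * a l) b m = c * mulA a b m.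
Proof.
move=> sa sb; have [C hC] := conv_sdom theta m sa sb.
by rewrite /Defs.mulA -(csumZ c hC); congr csum; apply/funext => l; rewrite !mulrA.
Qed.

Lemma mulAZr c a b m : smooth a -> smooth b -> mulA a (fun l => c * b l) m = c * mulA a b m.
Proof.
move=> sa sb; have [C hC] := conv_sdom theta m sa sb.
by rewrite /Defs.mulA -(csumZ c hC); congr csum; apply/funext => l; ring.
Qed.

Lemma Rop_basis b q j m i : Rop b (basis q j) m i 0 = (i == j)%:R * (b (m - q) * phase q (m - q)).
Proof. by rewrite RopE basis_col (mulAZl _ _ (smooth_delta q) (ncP b)) mulA_deltal. Qed.

Lemma Lop_basis a q j m i : Lop a (basis q j) m i 0 = (i == j)%:R * (a (m - q) * phase (m - q) q).
Proof. by rewrite LopE basis_col (mulAZr _ _ (ncP a) (smooth_delta q)) mulA_deltar. Qed.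

Lemma Rop_Rop_basis b c q j : Rop c (Rop b (basis q j)) = Rop (ncM b c) (basis q j).
Proof.
apply: sspinor_eqP => m i; rewrite Rop_basis RopE.
have -> : (fun l => Rop b (basis q j) l i 0) = fun l => (i == j)%:R * (mulA (ncdelta q) b l).
  by apply/funext => l; rewrite Rop_basis mulA_deltal.
rewrite (mulAZl _ _ (smooth_mulA theta (smooth_delta q) (ncP b)) (ncP c)); congr (_ * _).
have [C hC] := conv_sdom theta m (smooth_mulA theta (smooth_delta q) (ncP b)) (ncP c).
have [C' hC'] := conv_sdom theta (m - q) (ncP b) (ncP c).
have E l : mulA (delta q) b (l + q) * c (m - (l + q)) * phase (l + q) (m - (l + q)) =
     phase q (m - q) * (b l * c (m - q - l) * phase l (m - q - l)).
  have -> : m - (l + q) = m - q - l by rewrite opprD addrA addrAC.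
  rewrite mulA_deltal addrK phaseDl.
  have -> : phase q (m - q) = phase q l * phase q (m - q - l) by rewrite -phaseDr subrKC.
  ring.
rewrite [LHS]/Defs.mulA -(@csum_reindex _ _ C (cnorm (phase q (m - q)) * C') _ (+%R^~ q) (+%R^~ (- q))) //.
- rewrite (_ : _ \o _ = fun l => phase q (m - q) * (b l * c (m - q - l) * phase l (m - q - l))).
    by rewrite (csumZ _ hC') mulrC.
  by apply/funext => l /=; rewrite E.
- exact: addrK.
- exact: subrK.
- by move=> l /=; rewrite E; exact: (sdomZ _ hC').
Qed.

Lemma Lop_Rop_basis a b q j : Lop a (Rop b (basis q j)) = Rop b (Lop a (basis q j)).
Proof.
apply: sspinor_eqP => m i; rewrite LopE RopE.
have -> : (fun l => Rop b (basis q j) l i 0) = fun l => (i == j)%:R * (mulA (ncdelta q) b l).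
  by apply/funext => l; rewrite Rop_basis mulA_deltal.
have -> : (fun l => Lop a (basis q j) l i 0) = fun l => (i == j)%:R * (mulA a (ncdelta q) l).
  by apply/funext => l; rewrite Lop_basis mulA_deltar.
have sqb := smooth_mulA theta (smooth_delta q) (ncP b).
have saq := smooth_mulA theta (ncP a) (smooth_delta q).
rewrite (mulAZr _ _ (ncP a) sqb) (mulAZl _ _ saq (ncP b)); congr (_ * _).
have [C hC] := conv_sdom theta m saq (ncP b).
have [C' hC'] := conv_sdom theta m (ncP a) sqb.
have E l : mulA a (delta q) (l + q) * b (m - (l + q)) * phase (l + q) (m - (l + q)) =
     a l * mulA (delta q) b (m - l) * phase l (m - l).
  rewrite mulA_deltal mulA_deltar addrK phaseDl opprD addrA.
  have -> : phase l (m - l) = phase l (m - l - q) * phase l q by rewrite -phaseDr subrK.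
  ring.
rewrite [RHS]/Defs.mulA -(@csum_reindex _ _ C C' _ (+%R^~ q) (+%R^~ (- q))) //.
- by congr csum; apply/funext => l /=; rewrite E.
- exact: addrK.
- exact: subrK.
- by move=> l /=; rewrite E; exact: hC'.
Qed.

Lemma Rop_ncM b c (psi : S) : Rop c (Rop b psi) = Rop (ncM b c) psi.
Proof.
pose X : {linear S -> S} := Rop c \o Rop b.
apply: (@scont_ext _ _ _ X (Rop (ncM b c)) _ (scont_Rop _)).
- by apply: scont_comp; exact: scont_Rop.
- by move=> q j; exact: Rop_Rop_basis.
Qed.

Lemma Lop_Rop a b (psi : S) : Lop a (Rop b psi) = Rop b (Lop a psi).
Proof.
pose X : {linear S -> S} := Lop a \o Rop b; pose Y : {linear S -> S} := Rop b \o Lop a.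
apply: (@scont_ext _ _ _ X Y).
- by apply: scont_comp; [exact: scont_Lop|exact: scont_Rop].
- by apply: scont_comp; [exact: scont_Rop|exact: scont_Lop].
- by move=> q j; exact: Lop_Rop_basis.
Qed.

End Operators.

Definition col1_subproof (a : A) : smooth_spinor (fun m => const_mx (a m) : 'cV[R[i]]_1).
Proof. by move=> i K; have [C hC] := ncP a K; exists C => m; rewrite mxE. Qed.

(** The regular representation on one-component spinors; as it is faithful, associativity of the
    product is inherited from the composition of right multiplications. *)
Definition col1 (a : A) : sspinor R n 1 := SSpinor _ (col1_subproof a).

Lemma col1E a m i : col1 a m i 0 = a m.
Proof. exact: mxE. Qed.

Lemma Rop_col1 a b : Rop b (col1 a) = col1 (ncM a b).
Proof.
apply: sspinor_eqP => m i; rewrite RopE col1E.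
have -> : (fun l => col1 a l i 0) = a by apply/funext => l; exact: col1E.
by [].
Qed.

Lemma col1_inj : injective col1.
Proof.
move=> a b ab; apply: ncalg_eq => m.
by rewrite -(col1E a m 0) ab col1E.
Qed.

Fact ncMA : associative ncM.
Proof. by move=> a b c; apply: col1_inj; rewrite -!Rop_col1 Rop_ncM. Qed.

Fact nc1M : left_id nc1 ncM.
Proof. by move=> a; apply: ncalg_eq => m; rewrite /= mulA_deltal subr0 phase0l mulr1. Qed.

Fact ncM1 : right_id nc1 ncM.
Proof. by move=> a; apply: ncalg_eq => m; rewrite /= mulA_deltar subr0 phase0r mulr1. Qed.

Fact ncMDl : left_distributive ncM +%R.
Proof.
move=> a b c; apply: ncalg_eq => m.
have := congr1 (@^~ m) (mulAl_linear theta 1 (ncP a) (ncP b) (ncP c)).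
move=> /=; rewrite mul1r => <-.
by congr (csum _); apply/funext => l; rewrite mul1r.
Qed.

Fact ncMDr : right_distributive ncM +%R.
Proof.
move=> a b c; apply: ncalg_eq => m.
have := congr1 (@^~ m) (mulAr_linear theta 1 (ncP a) (ncP b) (ncP c)).
move=> /=; rewrite mul1r => <-.
by congr (csum _); apply/funext => l; rewrite mul1r.
Qed.

HB.instance Definition _ := GRing.Zmodule_isPzRing.Build A ncMA nc1M ncM1 ncMDl ncMDr.

Lemma ncME (a b : A) m : (a * b) m = mulA a b m. Proof. by []. Qed.

Lemma ncZAl c (a b : A) : c *: (a * b) = c *: a * b.
Proof. by apply: ncalg_eq => m; rewrite ncZE !ncME (mulAZl _ _ (ncP a) (ncP b)). Qed.

Lemma ncZAr c (a b : A) : c *: (a * b) = a * (c *: b).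
Proof. by apply: ncalg_eq => m; rewrite ncZE !ncME (mulAZr _ _ (ncP a) (ncP b)). Qed.

End NCAlgebra.

(** * Multipliers, matrices, derivations and translations acting on spinors *)

Section Operators.
Context {R : realType} {n N : nat}.
Variable theta : 'M[R]_n.
Local Notation Z := 'rV[int]_n.
Local Notation A := (ncalg theta).
Local Notation S := (sspinor R n N).
Local Notation phase := (Defs.phase theta).
Local Notation mulA := (Defs.mulA theta).

Lemma LopM (a b : A) (psi : S) : Lop (a * b) psi = Lop a (Lop b psi).
Proof.
apply: sspinor_eqP => m i; rewrite !LopE.
have -> : (fun l => Lop b psi l i 0) = ncM b (NCAlg theta (spP psi i)).
  by apply/funext => l; rewrite LopE.
exact: (congr1 (fun f : A => f m) (esym (ncMA a b (NCAlg theta (spP psi i))))).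
Qed.

Lemma RopM (b c : A) (psi : S) : Rop (b * c) psi = Rop c (Rop b psi).
Proof. by rewrite Rop_ncM. Qed.

Lemma Lop1 (psi : S) : Lop (1 : A) psi = psi.
Proof.
apply: sspinor_eqP => m i; rewrite LopE.
exact: (congr1 (fun f : A => f m) (nc1M (NCAlg theta (spP psi i)))).
Qed.

Lemma Rop1 (psi : S) : Rop (1 : A) psi = psi.
Proof.
apply: sspinor_eqP => m i; rewrite RopE.
exact: (congr1 (fun f : A => f m) (ncM1 (NCAlg theta (spP psi i)))).
Qed.

Lemma Lop_lin c (a b : A) (psi : S) : Lop (c *: a + b) psi = c *: Lop a psi + Lop b psi.
Proof.
apply: sspinor_eqP => m i; rewrite LopE !mxE.
by rewrite -[RHS](congr1 (@^~ m) (mulAl_linear theta c (ncP a) (ncP b) (spP psi i))).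
Qed.

Lemma Rop_lin c (a b : A) (psi : S) : Rop (c *: a + b) psi = c *: Rop a psi + Rop b psi.
Proof.
apply: sspinor_eqP => m i; rewrite RopE !mxE.
by rewrite -[RHS](congr1 (@^~ m) (mulAr_linear theta c (spP psi i) (ncP a) (ncP b))).
Qed.

Lemma LopD (a b : A) (psi : S) : Lop (a + b) psi = Lop a psi + Lop b psi.
Proof. by rewrite -[a]scale1r Lop_lin !scale1r. Qed.

Lemma RopD (a b : A) (psi : S) : Rop (a + b) psi = Rop a psi + Rop b psi.
Proof. by rewrite -[a]scale1r Rop_lin !scale1r. Qed.

Lemma Lop0 (psi : S) : Lop (0 : A) psi = 0.
Proof. by have := LopD 0 0 psi; rewrite addr0 -{1}[Lop 0 psi]addr0 => /addrI <-. Qed.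

Lemma Rop0 (psi : S) : Rop (0 : A) psi = 0.
Proof. by have := RopD 0 0 psi; rewrite addr0 -{1}[Rop 0 psi]addr0 => /addrI <-. Qed.

Lemma LopZ c (a : A) (psi : S) : Lop (c *: a) psi = c *: Lop a psi.
Proof. by rewrite -[c *: a]addr0 Lop_lin Lop0 addr0. Qed.

Lemma RopZ c (a : A) (psi : S) : Rop (c *: a) psi = c *: Rop a psi.
Proof. by rewrite -[c *: a]addr0 Rop_lin Rop0 addr0. Qed.

Lemma Mop_subproof (M : 'M[R[i]]_N) (psi : S) : smooth_spinor (mxact M psi).
Proof.
move=> i; have := @sbf_sum R n unit _ (enum 'I_N) (fun j _ m => M i j * psi m j 0).
move=> /(_ (fun j => sbfZ _ (smooth_sbf unit (spP psi j)))) /(sbf_smooth tt) h K.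
by have [C hC] := h K; exists C => m; rewrite mxE -[X in cnorm X]big_enum; exact: hC.
Qed.

Definition Mop M (psi : S) : S := SSpinor _ (Mop_subproof M psi).
Lemma MopE M (psi : S) m : Mop M psi m = M *m psi m.
Proof. by []. Qed.

Fact Mop_linear M : linear (Mop M).
Proof. by move=> c phi psi; apply: sspinor_eq => m; rewrite !MopE !(sspDE, sspZE) mulmxDr -scalemxAr. Qed.
HB.instance Definition _ M := GRing.isLinear.Build R[i] S S *:%R (Mop M) (Mop_linear M).
Lemma MopM M M' psi : Mop (M *m M') psi = Mop M (Mop M' psi).
Proof. by apply: sspinor_eq => m; rewrite !MopE mulmxA. Qed.

Lemma MopZ c M psi : Mop (c *: M) psi = c *: Mop M psi.
Proof. by apply: sspinor_eq => m; rewrite !(sspDE, sspZE) !MopE -scalemxAl. Qed.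

Lemma Mop_scalar c psi : Mop c%:M psi = c *: psi.
Proof. by apply: sspinor_eq => m; rewrite MopE sspZE mul_scalar_mx. Qed.

Lemma Mop_sum (I : Type) (r : seq I) (M : I -> 'M[R[i]]_N) psi :
  Mop (\sum_(i <- r) M i) psi = \sum_(i <- r) Mop (M i) psi.
Proof.
apply: sspinor_eq => m; rewrite ssp_sumE MopE mulmx_suml.
by apply: eq_bigr => i _.
Qed.

Lemma Mop_comp M psi m i : Mop M psi m i 0 = \sum_j M i j * psi m j 0.
Proof. by rewrite mxE. Qed.

Lemma Mop_Rop M (b : A) psi : Mop M (Rop b psi) = Rop b (Mop M psi).
Proof.
apply: sspinor_eqP => m i; rewrite Mop_comp RopE.
have [C hC] : exists C : R, forall j, sdom C (fun l => (M i j * psi l j 0) * b (m - l) * phase l (m - l)).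
  pose F := fun (_ : unit) (j : 'I_N) l => M i j * psi l j 0.
  have Fj j : smooth (fun l => M i j * psi l j 0).
    exact: (sbf_smooth tt (sbfZ _ (smooth_sbf unit (spP psi j)))).
  have /choice[C hC] j := conv_sdom theta m (Fj j) (ncP b).
  exists (\sum_j `|C j|) => j; apply: sdom_le (hC j).
  by apply: le_trans (ler_norm _) _; rewrite (bigD1 j)//= lerDl sumr_ge0.
rewrite /Defs.mulA.
have -> : (fun l => Mop M psi l i 0 * b (m - l) * phase l (m - l)) =
    fun l => \sum_(j <- enum 'I_N) (M i j * psi l j 0) * b (m - l) * phase l (m - l).
  by apply/funext => l; rewrite Mop_comp !mulr_suml big_enum.
rewrite (csum_sum (enum 'I_N) hC) big_enum; apply: eq_bigr => j _.
rewrite RopE -(mulAZl theta (M i j) m (spP psi j) (ncP b)).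
by [].
Qed.

Lemma Mop_Lop M (a : A) psi : Mop M (Lop a psi) = Lop a (Mop M psi).
Proof.
apply: sspinor_eqP => m i; rewrite Mop_comp LopE.
have Fj j : smooth (fun l => M i j * psi l j 0).
  exact: (sbf_smooth tt (sbfZ _ (smooth_sbf unit (spP psi j)))).
have [C hC] : exists C : R, forall j, sdom C (fun l => a l * (M i j * psi (m - l) j 0) * phase l (m - l)).
  have /choice[C hC] j := conv_sdom theta m (ncP a) (Fj j).
  exists (\sum_j `|C j|) => j; apply: sdom_le (hC j).
  by apply: le_trans (ler_norm _) _; rewrite (bigD1 j)//= lerDl sumr_ge0.
rewrite /Defs.mulA.
have -> : (fun l => a l * Mop M psi (m - l) i 0 * phase l (m - l)) =
    fun l => \sum_(j <- enum 'I_N) a l * (M i j * psi (m - l) j 0) * phase l (m - l).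
  by apply/funext => l; rewrite Mop_comp mulr_sumr mulr_suml big_enum.
rewrite (csum_sum (enum 'I_N) hC) big_enum; apply: eq_bigr => j _.
rewrite LopE -(mulAZr theta (M i j) m (ncP a) (spP psi j)).
by [].
Qed.

Lemma bfam_Mop (I : Type) M (psi : I -> S) : bfam psi -> bfam (fun i => Mop M (psi i)).
Proof.
move=> pb j; have := @sbf_sum R n I _ (enum 'I_N) (fun k i m => M j k * psi i m k 0) (fun k => sbfZ _ (pb k)).
by apply: (@sbf_le _ _ _ _ _ 1 0) => i m; rewrite !mul1r Mop_comp big_enum.
Qed.

Lemma scont_Mop M : scont (Mop M).
Proof.
move=> psi phi [pb pp]; split=> [|m j]; first exact: bfam_Mop.
rewrite Mop_comp (_ : (fun _ => _) = fun k => \sum_(i <- enum 'I_N) M j i * psi k m i 0).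
  by rewrite -big_enum; apply: ctend_sum => i; apply: ctendM => //; exact: ctend_cst.
by apply/funext => k; rewrite Mop_comp big_enum.
Qed.

Lemma cnorm_int (x : int) : cnorm (x%:~R : R[i]) = `|x%:~R : R|.
Proof. by rewrite -cnorm_real rmorph_int. Qed.

Lemma cnorm_coord_le (m : Z) j : cnorm ((m 0 j)%:~R : R[i]) <= wt m.
Proof.
rewrite cnorm_int /wt; have := coord_le_enorm (realv m : 'rV[R]_n) j.
by rewrite mxE => h; apply: le_trans h _; rewrite lerDr.
Qed.

Lemma sbf_der (I : Type) (f : I -> Z -> R[i]) j : sbf f -> sbf (fun i m => (m 0 j)%:~R * f i m).
Proof.
apply: (@sbf_le _ _ _ _ _ 1 1) => i m.
by rewrite cnormM mul1r expr1 ler_wpM2r ?cnorm_ge0 ?cnorm_coord_le.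
Qed.

Lemma nder_subproof j (a : A) : smooth (fun m : Z => (m 0 j)%:~R * a m).
Proof. exact: (sbf_smooth tt (sbf_der j (smooth_sbf unit (ncP a)))). Qed.

Definition nder j (a : A) : A := NCAlg theta (nder_subproof j a).

Lemma Dop_subproof j (psi : S) : smooth_spinor (deriv_op j psi).
Proof.
move=> i K; have [C hC] := sbf_smooth tt (sbf_der j (smooth_sbf unit (spP psi i))) K.
by exists C => m; rewrite mxE; exact: hC.
Qed.

Definition Dop j (psi : S) : S := SSpinor _ (Dop_subproof j psi).
Lemma DopE j (psi : S) m : Dop j psi m = (m 0 j)%:~R *: psi m.
Proof. by []. Qed.

Lemma DopEi j (psi : S) m i : Dop j psi m i 0 = (m 0 j)%:~R * psi m i 0.
Proof. by rewrite mxE. Qed.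

Fact Dop_linear j : linear (Dop j).
Proof.
move=> c phi psi; apply: sspinor_eq => m; rewrite !(sspDE, sspZE, DopE) scalerDr !scalerA.
by rewrite [in LHS]mulrC.
Qed.
HB.instance Definition _ j := GRing.isLinear.Build R[i] S S *:%R (Dop j) (Dop_linear j).

Lemma mulA_der j a b (m : Z) : smooth a -> smooth b ->
  (m 0 j)%:~R * mulA a b m =
  mulA (fun l => (l 0 j)%:~R * a l) b m + mulA a (fun l => (l 0 j)%:~R * b l) m.
Proof.
move=> sa sb; have [C hC] := conv_sdom theta m sa sb.
have [C1 hC1] := conv_sdom theta m (nder_subproof j (NCAlg theta sa)) sb.
have [C2 hC2] := conv_sdom theta m sa (nder_subproof j (NCAlg theta sb)).
rewrite /Defs.mulA -(csumZ _ hC) -(csumD hC1 hC2); congr csum; apply/funext => l /=.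
have -> : (m 0 j)%:~R = (l 0 j)%:~R + ((m - l) 0 j)%:~R :> R[i].
  by rewrite -intrD !mxE addrCA subrr addr0.
ring.
Qed.

Lemma nderM j (a b : A) : nder j (a * b) = nder j a * b + a * nder j b.
Proof. by apply: ncalg_eq => m; exact: (mulA_der j m (ncP a) (ncP b)). Qed.

Lemma nder_linear j : linear (nder j).
Proof. by move=> c a b; apply: ncalg_eq => m; rewrite /= mulrDr; congr (_ + _); rewrite mulrCA. Qed.
HB.instance Definition _ j := GRing.isLinear.Build R[i] A A *:%R (nder j) (nder_linear j).
Lemma nder1 j : nder j 1 = 0.
Proof. by have := nderM j 1 1; rewrite !mulr1 mul1r -{1}[nder j 1]addr0 => /addrI <-. Qed.

Lemma Dop_Rop j (b : A) psi : Dop j (Rop b psi) = Rop b (Dop j psi) + Rop (nder j b) psi.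
Proof.
apply: sspinor_eqP => m i; rewrite DopEi RopE (mulA_der j m (spP psi i) (ncP b)) mxE !RopE.
have -> : (fun l => Dop j psi l i 0) = fun l => (l 0 j)%:~R * psi l i 0.
  by apply/funext => l; rewrite DopEi.
by [].
Qed.

Lemma Dop_Lop j (a : A) psi : Dop j (Lop a psi) = Lop a (Dop j psi) + Lop (nder j a) psi.
Proof.
apply: sspinor_eqP => m i; rewrite DopEi LopE (mulA_der j m (ncP a) (spP psi i)) mxE !LopE [RHS]addrC.
have -> : (fun l => Dop j psi l i 0) = fun l => (l 0 j)%:~R * psi l i 0.
  by apply/funext => l; rewrite DopEi.
by [].
Qed.

Lemma Dop_Mop j M psi : Dop j (Mop M psi) = Mop M (Dop j psi).
Proof. by apply: sspinor_eq => m; rewrite DopE !MopE DopE scalemxAr. Qed.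

Lemma bfam_Dop (I : Type) j (psi : I -> S) : bfam psi -> bfam (fun i => Dop j (psi i)).
Proof.
move=> pb k; have := sbf_der j (pb k); apply: (@sbf_le _ _ _ _ _ 1 0) => i m.
by rewrite !mul1r DopEi.
Qed.

Lemma scont_Dop j : scont (Dop j).
Proof.
move=> psi phi [pb pp]; split=> [|m k]; first exact: bfam_Dop.
rewrite DopEi (_ : (fun _ => _) = fun i => (m 0 j)%:~R * psi i m k 0).
  by apply: ctendM => //; exact: ctend_cst.
by apply/funext => i; rewrite DopEi.
Qed.

Lemma sbf_transl (f : Z -> R[i]) q : smooth f -> smooth (fun m => f (m - q)).
Proof.
move=> sf K; have [C C0 hC] := sbf_ge0 K (smooth_sbf unit sf); exists (C * wt q ^+ K) => m.
have := @wtXD R n (m - q) q K; rewrite subrK => h.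
apply: (le_trans (ler_wpM2l (cnorm_ge0 _) h)).
by rewrite mulrA ler_wpM2r ?wtX_ge0 // (hC tt).
Qed.

Lemma transl_subproof q (psi : S) : smooth_spinor (fun m => psi (m - q)).
Proof. by move=> i; exact: (sbf_transl q (spP psi i)). Qed.

(** A shift of the Fourier coefficients without phase. It treats the left and the right action
    alike, whereas multiplication by a monomial [U^q] would commute with one of them. *)
Definition transl q (psi : S) : S := SSpinor _ (transl_subproof q psi).
Lemma translE q (psi : S) m : transl q psi m = psi (m - q).
Proof. by []. Qed.

Fact transl_linear q : linear (transl q).
Proof. by move=> c phi psi; apply: sspinor_eq. Qed.
HB.instance Definition _ q := GRing.isLinear.Build R[i] S S *:%R (transl q) (transl_linear q).
Lemma translK q psi : transl (- q) (transl q psi) = psi.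
Proof. by apply: sspinor_eq => m; rewrite !translE opprK addrK. Qed.

Lemma translVK q psi : transl q (transl (- q) psi) = psi.
Proof. by apply: sspinor_eq => m; rewrite !translE opprK subrK. Qed.

Lemma twl_subproof q (a : A) : smooth (fun m => phase m q * a m).
Proof.
have h (i : unit) m : cnorm (phase m q) <= 1 by rewrite cnorm_phase.
exact: (sbf_smooth tt (sbfM h (smooth_sbf unit (ncP a)))).
Qed.

Lemma twr_subproof q (b : A) : smooth (fun m => phase q m * b m).
Proof.
have h (i : unit) m : cnorm (phase q m) <= 1 by rewrite cnorm_phase.
exact: (sbf_smooth tt (sbfM h (smooth_sbf unit (ncP b)))).
Qed.

Definition twl q a : A := NCAlg theta (twl_subproof q a).
Definition twr q b : A := NCAlg theta (twr_subproof q b).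

Lemma Lop_transl q a psi : Lop a (transl q psi) = transl q (Lop (twl q a) psi).
Proof.
apply: sspinor_eqP => m i; rewrite translE !LopE; congr csum; apply/funext => l /=.
rewrite addrAC; have -> : phase l (m - l) = phase l (m - q - l) * phase l q.
  by rewrite -phaseDr addrAC subrK.
ring.
Qed.

Lemma Rop_transl q b psi : Rop b (transl q psi) = transl q (Rop (twr q b) psi).
Proof.
apply: sspinor_eqP => m i; rewrite translE !RopE.
have [C hC] := conv_sdom theta m (spP (transl q psi) i) (ncP b).
have [C' hC'] := conv_sdom theta (m - q) (spP psi i) (ncP (twr q b)).
have E l : transl q psi (l + q) i 0 * b (m - (l + q)) * phase (l + q) (m - (l + q)) =
     psi l i 0 * twr q b (m - q - l) * phase l (m - q - l).
  have -> : m - (l + q) = m - q - l by rewrite opprD addrA addrAC.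
  by rewrite translE addrK phaseDl /=; ring.
rewrite /Defs.mulA -(@csum_reindex _ _ C C' _ (+%R^~ q) (+%R^~ (- q))) //.
- by congr csum; apply/funext => l /=; rewrite -E.
- exact: addrK.
- exact: subrK.
- by move=> l /=; have := hC' l; rewrite -E.
Qed.

Lemma Mop_transl q M psi : Mop M (transl q psi) = transl q (Mop M psi).
Proof. by apply: sspinor_eq. Qed.

Lemma Dop_transl q j psi : Dop j (transl q psi) = transl q (Dop j psi + (q 0 j)%:~R *: psi).
Proof.
apply: sspinor_eq => m; rewrite DopE !translE sspDE sspZE DopE -scalerDl -intrD.
by rewrite !mxE subrK.
Qed.

End Operators.

(** * The inner product of smooth spinors *)

Section Inner.
Context {R : realType} {n N : nat}.
Local Notation Z := 'rV[int]_n.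
Local Notation S := (sspinor R n N).

Lemma inner_dom (I : Type) (phi psi : I -> S) : bfam phi -> bfam psi ->
  exists C : R, forall i, sdom C (fun m => \sum_j (phi i m j 0)^* * psi i m j 0).
Proof.
move=> pb qb.
have : sbf (fun i m => \sum_(j <- enum 'I_N) (phi i m j 0)^* * psi i m j 0).
  apply: sbf_sum => j; have [C C0 hC] := sbf_ge0 0 (pb j).
  by apply: (@sbfM _ _ _ _ C) (qb j) => i m; have := hC i m; rewrite cnorm_conj expr0 mulr1.
move/sbf_sdom => [C hC]; exists C => i m; have := hC i m; by rewrite big_enum.
Qed.

Lemma inner_dom1 (phi psi : S) : exists C : R, sdom C (fun m => \sum_j (phi m j 0)^* * psi m j 0).
Proof. by have [C h] := inner_dom (bfam_cst unit phi) (bfam_cst unit psi); exists C; exact: (h tt). Qed.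

Lemma inner_linear (phi : S) c (psi psi' : S) :
  inner phi (c *: psi + psi') = c * inner phi psi + inner phi psi'.
Proof.
have [C hC] := inner_dom1 phi psi; have [C' hC'] := inner_dom1 phi psi'.
rewrite /inner -(csum_linear c hC hC'); congr csum; apply/funext => m.
rewrite mulr_sumr -big_split; apply: eq_bigr => j _ /=; rewrite !mxE; ring.
Qed.

Lemma inner_conj (phi psi : S) : inner psi phi = (inner phi psi)^*.
Proof.
have [C hC] := inner_dom1 phi psi; rewrite /inner -(csum_conj hC).
congr csum; apply/funext => m; rewrite rmorph_sum; apply: eq_bigr => j _ /=.
by rewrite rmorphM /= conjcK mulrC.
Qed.

(** The real part suffices for symmetry, positivity and norms, and it keeps inequalities in the real
    field, whose order is total. *)
Definition rip (phi psi : S) : R := complex.Re (inner phi psi).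

Lemma ripC phi psi : rip phi psi = rip psi phi.
Proof. by rewrite /rip [in RHS]inner_conj; case: inner. Qed.

Lemma ripDr phi psi psi' : rip phi (psi + psi') = rip phi psi + rip phi psi'.
Proof. by rewrite /rip -[psi]scale1r inner_linear mul1r ReD scale1r. Qed.

Lemma ripZr phi (c : R) psi : rip phi (c%:C *: psi) = c * rip phi psi.
Proof.
have h : inner phi (0 : S) = 0.
  have := inner_linear phi 1 0 0; rewrite scaler0 addr0 mul1r => /eqP.
  by rewrite -subr_eq subrr eq_sym => /eqP.
by rewrite /rip -[_ *: psi]addr0 inner_linear h addr0 ReMr.
Qed.

Lemma ripNr phi psi : rip phi (- psi) = - rip phi psi.
Proof. by have := ripZr phi (-1) psi; rewrite rmorphN /= scaleN1r mulN1r. Qed.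

Lemma ripDl phi psi psi' : rip (psi + psi') phi = rip psi phi + rip psi' phi.
Proof. by rewrite ripC ripDr !(ripC phi). Qed.

Lemma ripZl phi (c : R) psi : rip (c%:C *: psi) phi = c * rip psi phi.
Proof. by rewrite ripC ripZr ripC. Qed.

Lemma ripNl phi psi : rip (- psi) phi = - rip psi phi.
Proof. by rewrite ripC ripNr ripC. Qed.

Lemma rip_term_ge0 (psi : S) m : 0 <= complex.Re (\sum_j (psi m j 0)^* * psi m j 0).
Proof.
rewrite Re_sum; apply: sumr_ge0 => j _; case: (psi m j 0) => a b /=.
by rewrite mulNr opprK addr_ge0 // -expr2 sqr_ge0.
Qed.

Lemma rip_ge_part (psi : S) m i : cnorm (psi m i 0) ^+ 2 <= rip psi psi.
Proof.
have [C hC] := inner_dom1 psi psi; rewrite /rip /inner /csum /=.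
set g := fun m => _.
have g0 l : 0 <= g l by exact: rip_term_ge0.
have gC l : `|g l| <= C * om l by apply: le_trans (Re_le_cnorm _) (hC l).
have gm : cnorm (psi m i 0) ^+ 2 <= g m.
  rewrite /g Re_sum (bigD1 i)//= -[leLHS]addr0 lerD//.
    rewrite /cnorm sqr_sqrtr ?addr_ge0 ?sqr_ge0//; case: (psi m i 0) => a b /=.
    by rewrite mulNr opprK !expr2.
  apply: sumr_ge0 => j _; case: (psi m j 0) => a b /=.
  by rewrite mulNr opprK addr_ge0 // -expr2 sqr_ge0.
apply: le_trans gm _; have C0 := sdom_ge0 hC.
apply/ler_addgt0Pr => e e0.
have h F : uniq F -> \sum_(l <- F) g l <= rsum g.
  move=> uF; rewrite /rsum.
  have gmax : (fun l => (Num.max (g l) 0)%:E) = fun l => (g l)%:E.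
    by apply/funext => l; rewrite max_l.
  have gmin : (fun l => (Num.max (- g l) 0)%:E) = fun=> 0%E.
    by apply/funext => l; rewrite max_r // oppr_le0.
  rewrite gmax gmin (esum1 (fun _ _ => erefl)) subr0.
  have [|lo _] := @fine_esum_bounds R n g (C * 6 ^+ n) g0; last exact: lo.
  move=> G uG; apply: le_trans (sum_om_scaled C0 uG); apply: ler_sum => l _.
  by apply: le_trans (ler_norm _) (gC l).
by have := h [:: m] isT; rewrite big_seq1 => /le_trans; apply; rewrite lerDl ltW.
Qed.

Lemma rip_ge0 (psi : S) : 0 <= rip psi psi.
Proof.
pose g m := complex.Re (\sum_j (psi m j 0)^* * psi m j 0).
have g0 l : 0 <= g l by exact: rip_term_ge0.
have -> : rip psi psi = rsum g by [].
have gmin : (fun l => (Num.max (- g l) 0)%:E) = fun=> 0%E.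
  by apply/funext => l; rewrite max_r // oppr_le0.
rewrite /rsum gmin (esum1 (fun _ _ => erefl)) subr0 fine_ge0// esum_ge0// => l _.
by rewrite lee_fin le_max lexx orbT.
Qed.

Lemma rip_eq0 (psi : S) : rip psi psi <= 0 -> psi = 0.
Proof.
move=> p0; apply: sspinor_eqP => m i; rewrite ssp0E mxE; apply: cnorm_eq0; apply/eqP.
by rewrite -sqrf_eq0 eq_le sqr_ge0 andbT (le_trans (rip_ge_part psi m i)).
Qed.

Lemma rip_cont (phi psi : nat -> S) phi' psi' : stend phi phi' -> stend psi psi' ->
  ctend (fun k => inner (phi k) (psi k)) (inner phi' psi').
Proof.
move=> [pb pp] [qb qq]; have [C hC] := inner_dom pb qb; have [C' hC'] := inner_dom1 phi' psi'.
apply: (@csum_ctend _ _ (Num.max C C')) => [k||m].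
- by apply: sdom_le (hC k); rewrite le_max lexx.
- by apply: sdom_le hC'; rewrite le_max lexx orbT.
- rewrite -big_enum (_ : (fun _ => _) = fun k => \sum_(j <- enum 'I_N) (phi k m j 0)^* * psi k m j 0).
    apply: ctend_sum => j; apply: ctendM; last exact: qq.
    move=> e e0; have [k0 h] := pp m j e e0; exists k0 => k /h.
    by rewrite -rmorphB /= cnorm_conj.
  by apply/funext => k; rewrite big_enum.
Qed.

Lemma inner_transl (q : Z) (phi psi : S) : inner (transl q phi) (transl q psi) = inner phi psi.
Proof.
have [C hC] := inner_dom1 (transl q phi) (transl q psi); have [C' hC'] := inner_dom1 phi psi.
rewrite /inner.
exact: (@csum_reindex _ _ C' C _ (+%R^~ (- q)) (+%R^~ q) (@subrK _ q) (@addrK _ q) hC' hC).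
Qed.

Lemma inner_Dop j (phi psi : S) : inner (Dop j phi) psi = inner phi (Dop j psi).
Proof.
congr csum; apply/funext => m; apply: eq_bigr => i _.
rewrite !DopEi (rmorphM (@conjc R)) /= (rmorph_int (@conjc R)).
by rewrite mulrCA mulrA.
Qed.

Lemma inner_Mop (M : 'M[R[i]]_N) (phi psi : S) : (map_mx (@conjc R) M)^T = M ->
  inner (Mop M phi) psi = inner phi (Mop M psi).
Proof.
move=> hM; congr csum; apply/funext => m.
transitivity (\sum_i \sum_j (phi m j 0)^* * (M j i * psi m i 0)).
  apply: eq_bigr => i _; rewrite Mop_comp (rmorph_sum (@conjc R)) mulr_suml; apply: eq_bigr => j _.
  rewrite (rmorphM (@conjc R)) /=; have -> : M j i = (M i j)^* by rewrite -{1}hM !mxE.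
  by rewrite mulrCA mulrA.
rewrite exchange_big; apply: eq_bigr => j _; rewrite Mop_comp mulr_sumr.
by [].
Qed.

End Inner.

Lemma ctend_conj {R : realType} (u : nat -> R[i]) l : ctend u l -> ctend (fun k => (u k)^*) l^*.
Proof.
move=> ul e e0; have [k0 h] := ul e e0; exists k0 => k /h.
by rewrite -(rmorphB (@conjc R)) /= cnorm_conj.
Qed.

(** * Recurrent sequences of lattice points *)

Section Recurrence.
Context {R : realType}.

(** Pigeonhole: the fractional parts of [N0 * j * y], for [M^m + 1] values of [j], fall into [M^m]
    boxes of side [1 / M]. Working with multiples of [N0] makes the difference of two of them at
    least [N0]. *)
Lemma dirichlet (m : nat) (y : 'I_m -> R) (M N0 : nat) : (0 < M)%N -> (0 < N0)%N ->
  exists2 N : nat, (N0 <= N)%N &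
  exists z : 'I_m -> int, forall i, `|N%:R * y i - (z i)%:~R| <= M%:R^-1.
Proof.
case: M => // M _ N0_gt0.
pose x (j : nat) i : R := (N0 * j)%:R * y i.
pose fl j i : int := Num.floor (M.+1%:R * x j i).
(* The floor of [M x] modulo [M] is the index of the box containing the fractional part of [x]. *)
pose f (j : 'I_((M.+1 ^ m).+1)) : {ffun 'I_m -> 'I_M.+1} := [ffun i => inord `|(fl j i %% M.+1)%Z|%N].
have : ~~ injectiveb f.
  apply/injectiveP => /leq_card; rewrite card_ffun !card_ord ltnn.
  by [].
case/injectivePn => j1 [j2 j12 fj].
have key (k1 k2 : 'I_((M.+1 ^ m).+1)) : (k2 < k1)%N -> f k1 = f k2 ->
  exists2 N : nat, (N0 <= N)%N & exists z : 'I_m -> int, forall i, `|N%:R * y i - (z i)%:~R| <= M.+1%:R^-1.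
  move=> k21 fk; exists (N0 * (k1 - k2))%N; first by rewrite leq_pmulr// subn_gt0.
  exists (fun i => ((fl k1 i - fl k2 i) %/ M.+1)%Z) => i.
  have /eqP dv : ((fl k1 i - fl k2 i) %/ M.+1)%Z * M.+1 = fl k1 i - fl k2 i.
    apply/divzK; rewrite -eqz_mod_dvd.
    have := congr1 (fun g : {ffun _ -> _} => nat_of_ord (g i)) fk; rewrite !ffunE !inordK.
    - move=> h; apply/eqP.
      by rewrite -[LHS]gez0_abs ?modz_ge0// -[RHS]gez0_abs ?modz_ge0// h.
    - by rewrite -ltz_nat gez0_abs ?modz_ge0// ltz_pmod.
    - by rewrite -ltz_nat gez0_abs ?modz_ge0// ltz_pmod.
  have M0 : 0 < M.+1%:R :> R by rewrite ltr0n.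
  rewrite -(ler_pM2l M0) mulfV ?gt_eqF// -[X in X * `|_|](gtr0_norm M0) -normrM mulrBr.
  have -> : M.+1%:R * (((fl k1 i - fl k2 i) %/ M.+1)%Z)%:~R = (fl k1 i)%:~R - (fl k2 i)%:~R :> R.
    by rewrite -intrB -[in RHS](eqP dv) intrM mulrC.
  have -> : (N0 * (k1 - k2))%:R * y i = x k1 i - x k2 i.
    by rewrite /x -mulrBl -natrB ?leq_mul2l ?(ltnW k21) ?orbT// mulnBr.
  have h1 : (fl k1 i)%:~R <= M.+1%:R * x k1 i < (fl k1 i)%:~R + 1.
    by have := floor_itv (M.+1%:R * x k1 i); rewrite intrD.
  have h2 : (fl k2 i)%:~R <= M.+1%:R * x k2 i < (fl k2 i)%:~R + 1.
    by have := floor_itv (M.+1%:R * x k2 i); rewrite intrD.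
  by rewrite ler_norml mulrBr; move: h1 h2; lra.
have [h|h|h] := ltngtP j1 j2.
- exact: key h (esym fj).
- exact: key h fj.
- by rewrite (ord_inj h) eqxx in j12.
Qed.

Lemma expi_2pi (k : int) : expi (2 * pi * k%:~R : R) = 1.
Proof.
have e2 : expi (2 * pi : R) = 1.
  by rewrite mulr_natl mulr2n /expi cosDpi cospi opprK sinDpi sinpi oppr0.
have en (j : nat) : expi (2 * pi * j%:R : R) = 1.
  elim: j => [|j IH]; first by rewrite mulr0 expi0.
  by rewrite -(natr1 j) mulrDr mulr1 expiD IH e2 mulr1.
case: (intP k) => [|j|j]; first by rewrite mulr0 expi0.
  exact: en.
by rewrite mulrNz mulrN expiN en conjc1.
Qed.

Lemma expi_near1 (e : R) : 0 < e -> exists2 d : R, 0 < d & forall t, `|t| <= d -> cnorm (expi t - 1) <= e.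
Proof.
move=> e0; have e2 : 0 < e / 2 by rewrite divr_gt0.
have /cvgrPdist_le/(_ _ e2)/nbhs_normP[d1 /= d10 h1] := @continuous_cos R 0.
have /cvgrPdist_le/(_ _ e2)/nbhs_normP[d2 /= d20 h2] := @continuous_sin R 0.
exists (Num.min d1 d2 / 2) => [|t]; first by rewrite divr_gt0// lt_min d10.
move=> td; have td' : `|t| < Num.min d1 d2.
  by apply: le_lt_trans td _; rewrite ltr_pdivrMr// mulr_natr mulr2n ltrDl lt_min d10.
move: td'; rewrite lt_min => /andP[t1 t2].
apply: le_trans (cnorm_le_ReIm _) _; rewrite [leRHS](splitr e) /=.
have := h1 t; have := h2 t; rewrite /= sub0r normrN cos0 sin0 => /(_ t2) a /(_ t1) b.
by apply: lerD; [rewrite distrC|rewrite oppr0 addr0 -normrN -sub0r].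
Qed.

End Recurrence.

Section Recurrence2.
Context {R : realType} {n : nat}.
Variable theta : 'M[R]_n.
Local Notation Z := 'rV[int]_n.
Local Notation phase := (Defs.phase theta).

(** Simultaneous approximation of the [2n] numbers [xi_j] and [(theta xi)_p / 2]. The phase of [r]
    against [q] is the exponential of [i pi] times [r . theta q], and [q] is close to [N xi]; the
    exponent is close to a multiple of [2 pi] once every [N (theta xi)_p / 2] is close to an
    integer. *)
Lemma recurrence (xi : 'rV[R]_n) : exists (Nn : nat -> nat) (q : nat -> Z),
  [/\ forall k, (k < Nn k)%N,
      forall k j, `|(q k 0 j)%:~R - (Nn k)%:R * xi 0 j| <= (k.+1)%:R^-1 &
      forall r, ctend (fun k => phase r (q k)) 1].
Proof.
pose eta p : R := \sum_q theta p q * xi 0 q.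
pose y (i : 'I_(n + n)) : R := match fintype.split i with inl j => xi 0 j | inr p => eta p / 2 end.
have /choice[f hf] : forall k, exists w : nat * (Z * Z),
    [/\ (k < w.1)%N, forall j, `|(w.2.1 0 j)%:~R - (w.1)%:R * xi 0 j| <= (k.+1)%:R^-1 &
     forall p, `|(w.2.2 0 p)%:~R - (w.1)%:R * (eta p / 2)| <= (k.+1)%:R^-1].
  move=> k.
  have [N kN [z hz]] := @dirichlet _ _ y k.+1 k.+1 isT isT.
  exists (N, (\row_j z (lshift n j), \row_p z (rshift n p))); split=> //= j.
    by have := hz (lshift n j); rewrite /y mxE distrC -[lshift n j]/(unsplit (inl j)) unsplitK.
  by have := hz (rshift n j); rewrite /y mxE distrC -[rshift n j]/(unsplit (inr j)) unsplitK.
exists (fun k => (f k).1), (fun k => (f k).2.1); split=> [k|k j|r]; first by case: (hf k).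
  by case: (hf k).
move=> e e0; have [d d0 hd] := expi_near1 e0.
pose T : R := \sum_p \sum_q `|theta p q|.
have T0 : 0 <= T by apply: sumr_ge0 => p _; apply: sumr_ge0.
pose C : R := pi * ((T + 2) * \sum_p `|(r 0 p)%:~R|).
have C0 : 0 <= C by rewrite mulr_ge0 ?pi_ge0// mulr_ge0 ?addr_ge0// sumr_ge0.
exists (Num.truncn (C / d)) => k hk; case: (hf k); set N := (f k).1; set q := (f k).2.1; set z := (f k).2.2.
move=> _ hq hz.
rewrite phaseE.
(* What remains of the exponent modulo [2 pi]: the error of replacing [N xi] by [q], controlled by
   [T], and that of rounding [N eta / 2], which accounts for the 2 in [C]. *)
pose s : R := pi * \sum_p (r 0 p)%:~R * (\sum_j theta p j * ((q 0 j)%:~R - N%:R * xi 0 j) - 2 * ((z 0 p)%:~R - N%:R * (eta p / 2))).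
have -> : thb theta r q = 2 * pi * (\sum_p r 0 p * z 0 p)%:~R + s.
  rewrite /thb /s [2 * pi]mulrC -mulrA -mulrDr; congr (_ * _).
  rewrite rmorph_sum /= mulr_sumr -big_split /=; apply: eq_bigr => p _ /=; rewrite intrM.
  have -> : \sum_j theta p j * ((q 0 j)%:~R - N%:R * xi 0 j) = \sum_j theta p j * (q 0 j)%:~R - N%:R * eta p.
    by rewrite /eta mulr_sumr -sumrB; apply: eq_bigr => j _; ring.
  have -> : \sum_j theta p j * (r 0 p)%:~R * (q 0 j)%:~R = (r 0 p)%:~R * \sum_j theta p j * (q 0 j)%:~R.
    by rewrite mulr_sumr; apply: eq_bigr => j _; ring.
  by field.
rewrite expiD expi_2pi mul1r; apply: hd.
apply: (@le_trans _ _ (C / k.+1%:R)); last first.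
  rewrite ler_pdivrMr ?ltr0n// mulrC -ler_pdivrMr//.
  have : C / d < (Num.truncn (C / d)).+1%:R by apply: truncnS_gt.
  by move=> /ltW /le_trans; apply; rewrite ler_nat ltnS.
rewrite /s /C normrM (ger0_norm (pi_ge0 _)) -!mulrA ler_wpM2l ?pi_ge0//.
apply: le_trans (ler_norm_sum _ _ _) _.
rewrite mulrCA mulr_suml; apply: ler_sum => p _; rewrite normrM ler_wpM2l//.
apply: le_trans (ler_normB _ _) _; rewrite [leRHS]mulrDl; apply: lerD.
  apply: le_trans (ler_norm_sum _ _ _) _.
  apply: (@le_trans _ _ ((\sum_j `|theta p j|) / k.+1%:R)).
    by rewrite mulr_suml; apply: ler_sum => j _; rewrite normrM ler_wpM2l.
  rewrite ler_wpM2r ?invr_ge0// /T [leRHS](bigD1 p)//= lerDl.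
  by apply: sumr_ge0 => p' _; apply: sumr_ge0.
by rewrite normrM (ger0_norm (ler0n _ 2)) ler_wpM2l.
Qed.

End Recurrence2.

(** * The algebra generated by both actions, tensored with matrices *)

Section HatOperators.
Context {R : realType} {n N : nat}.
Variable theta : 'M[R]_n.
Hypothesis thetaT : theta^T = - theta.
Local Notation Z := 'rV[int]_n.
Local Notation A := (ncalg theta).
Local Notation S := (sspinor R n N).
Local Notation phase := (Defs.phase theta).

Lemma thbC l m : thb theta l m = - thb theta m l.
Proof.
rewrite /thb -mulrN; congr (_ * _); rewrite exchange_big -sumrN; apply: eq_bigr => p _ /=.
rewrite -sumrN; apply: eq_bigr => q _.
have -> : theta q p = - theta p q by have := congr1 (fun M : 'M[R]_n => M p q) thetaT; rewrite !mxE.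
ring.
Qed.

Lemma phaseC l m : phase l m = (phase m l)^*.
Proof. by rewrite !phaseE thbC expiN. Qed.

Lemma phase_diag l : phase l l = 1.
Proof.
have h : thb theta l l = 0 by have := thbC l l; lra.
by rewrite phaseE h expi0.
Qed.

Lemma phaseMC l m : phase l m * phase m l = 1.
Proof. by rewrite !phaseE -expiD [thb _ l m]thbC addNr expi0. Qed.

Lemma phaseNr l m : phase l (- m) = phase m l.
Proof. by rewrite !phaseE thbNr -thbC. Qed.

Definition word : Type := (A * A * 'M[R[i]]_N)%type.
Definition wop (w : word) (psi : S) : S := Lop w.1.1 (Rop w.1.2 (Mop w.2 psi)).
Fact wop_linear w : linear (wop w).
Proof. by move=> c u v; rewrite /wop !linearP. Qed.
HB.instance Definition _ w := GRing.isLinear.Build R[i] S S *:%R (wop w) (wop_linear w).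

Definition hop (ws : seq word) (psi : S) : S := \sum_(w <- ws) wop w psi.
Fact hop_linear ws : linear (hop ws).
Proof. by move=> c u v; rewrite /hop scaler_sumr -big_split; apply: eq_bigr => w _; rewrite linearP. Qed.
HB.instance Definition _ ws := GRing.isLinear.Build R[i] S S *:%R (hop ws) (hop_linear ws).

(** The factors from the opposite algebra multiply in reverse order, as right multiplications
    compose. *)
Definition wmul (w w' : word) : word := (w.1.1 * w'.1.1, w'.1.2 * w.1.2, w.2 *m w'.2).
Lemma wop_mul w w' psi : wop (wmul w w') psi = wop w (wop w' psi).
Proof.
case: w w' => [[a b] M] [[a' b'] M']; rewrite /wop /wmul [LHS]/= [RHS]/=.
by rewrite LopM RopM MopM (Mop_Lop M) (Mop_Rop M) -(Lop_Rop a' b).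
Qed.

Lemma hop_cat ws ws' psi : hop (ws ++ ws') psi = hop ws psi + hop ws' psi.
Proof. exact: big_cat. Qed.

Lemma hop_mul ws ws' psi : hop [seq wmul w w' | w <- ws, w' <- ws'] psi = hop ws (hop ws' psi).
Proof.
rewrite /hop big_allpairs_dep /=; apply: eq_bigr => w _.
by rewrite linear_sum; apply: eq_bigr => w' _; exact: wop_mul.
Qed.

Definition wscale c (w : word) : word := (c *: w.1.1, w.1.2, w.2).
Lemma hop_scale c ws psi : hop [seq wscale c w | w <- ws] psi = c *: hop ws psi.
Proof. by rewrite /hop big_map scaler_sumr; apply: eq_bigr => w _; rewrite /wop LopZ. Qed.

Definition hat (X : S -> S) := exists ws, X =1 hop ws.

Lemma hatD X Y : hat X -> hat Y -> hat (fun psi => X psi + Y psi).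
Proof. by move=> [w hw] [w' hw']; exists (w ++ w') => psi; rewrite hop_cat hw hw'. Qed.

Lemma hatZ c X : hat X -> hat (fun psi => c *: X psi).
Proof. by move=> [w hw]; exists [seq wscale c x | x <- w] => psi; rewrite hop_scale hw. Qed.

Lemma hat_comp X Y : hat X -> hat Y -> hat (X \o Y).
Proof. by move=> [w hw] [w' hw']; exists [seq wmul x y | x <- w, y <- w'] => psi; rewrite hop_mul /= hw hw'. Qed.

Lemma hat_eq X Y : X =1 Y -> hat X -> hat Y.
Proof. by move=> XY [w hw]; exists w => psi; rewrite -XY. Qed.

Lemma hat_wop w : hat (wop w).
Proof. by exists [:: w] => psi; rewrite /hop big_seq1. Qed.

Lemma hat_Lop (a : A) : hat (Lop a).
Proof. by apply: hat_eq (hat_wop (a, 1, 1%:M)) => psi; rewrite /wop /= Mop_scalar scale1r Rop1. Qed.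

Lemma hat_Rop (b : A) : hat (Rop b).
Proof. by apply: hat_eq (hat_wop (1, b, 1%:M)) => psi; rewrite /wop /= Mop_scalar scale1r Lop1. Qed.

Lemma hat_Mop M : hat (Mop M).
Proof. by apply: hat_eq (hat_wop (1, 1, M)) => psi; rewrite /wop /= Rop1 Lop1. Qed.

Lemma hat_id : hat id.
Proof. by apply: hat_eq (hat_Lop 1) => psi; rewrite Lop1. Qed.

Lemma hat0 : hat (fun=> 0).
Proof. by exists [::] => psi; rewrite /hop big_nil. Qed.

(* On Lop a and Rop b this multiplies the coefficient at r by a phase of r
   against q. *)
Definition shc (q : Z) (X : S -> S) (psi : S) : S := transl (- q) (X (transl q psi)).

Definition wtw q (w : word) : word := (twl q w.1.1, twr q w.1.2, w.2).
Lemma shc_wop q w psi : shc q (wop w) psi = wop (wtw q w) psi.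
Proof. by rewrite /shc /wop Mop_transl Rop_transl Lop_transl translK. Qed.

Lemma shc_hop q ws psi : shc q (hop ws) psi = hop [seq wtw q w | w <- ws] psi.
Proof.
rewrite /shc /hop linear_sum big_map; apply: eq_bigr => w _.
by rewrite -shc_wop.
Qed.

Lemma nbf_twl (I : Type) (q : I -> Z) (a : A) : nbf (fun i => twl (q i) a).
Proof.
have h (i : I) m : cnorm (phase m (q i)) <= 1 by rewrite cnorm_phase.
exact: (sbfM h (smooth_sbf I (ncP a))).
Qed.

Lemma nbf_twr (I : Type) (q : I -> Z) (a : A) : nbf (fun i => twr (q i) a).
Proof.
have h (i : I) m : cnorm (phase (q i) m) <= 1 by rewrite cnorm_phase.
exact: (sbfM h (smooth_sbf I (ncP a))).
Qed.

Lemma bfam_hop (I : Type) (q : I -> Z) ws (psi : I -> S) : bfam psi ->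
  bfam (fun i => shc (q i) (hop ws) (psi i)).
Proof.
move=> pb; apply: bfam_eq (_ : bfam (fun i => \sum_(w <- ws) wop (wtw (q i) w) (psi i))) => [i|].
  by rewrite shc_hop /hop big_map.
apply: bfam_sum => w; apply: bfam_Lop; first exact: nbf_twl.
by apply: bfam_Rop; [exact: nbf_twr|exact: bfam_Mop].
Qed.

Lemma bfam_hat (I : Type) (q : I -> Z) X (psi : I -> S) : hat X -> bfam psi ->
  bfam (fun i => shc (q i) X (psi i)).
Proof. by move=> [ws hX] pb; apply: bfam_eq (bfam_hop q ws pb) => i; rewrite /shc hX. Qed.

Lemma stend_hop (q : nat -> Z) ws (psi : nat -> S) phi : (forall r, ctend (fun k => phase r (q k)) 1) ->
  stend psi phi -> stend (fun k => shc (q k) (hop ws) (psi k)) (hop ws phi).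
Proof.
move=> q1 pt; apply: stend_eq (_ : stend (fun i => \sum_(w <- ws) wop (wtw (q i) w) (psi i)) _) => [i|].
  by rewrite shc_hop /hop big_map.
apply: stend_sum => w; apply: stend_Lop; [exact: nbf_twl| |apply: stend_Rop; [exact: nbf_twr| |exact: scont_Mop]].
  move=> m; rewrite -[X in ctend _ X]mul1r; apply: ctendM; [exact: q1|exact: ctend_cst].
move=> m; rewrite -[X in ctend _ X]mul1r; apply: ctendM; last exact: ctend_cst.
(* Recurrence concerns [phase m (q k)], while right multipliers carry [phase (q k) m]; by
   antisymmetry of [theta] one is the conjugate of the other. *)
rewrite -[X in ctend _ X](conjc1 R) (_ : (fun _ => _) = fun k => (phase m (q k))^*).
  exact: ctend_conj.
by apply/funext => k; exact: phaseC.
Qed.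

Lemma stend_hat (q : nat -> Z) X (psi : nat -> S) phi : (forall r, ctend (fun k => phase r (q k)) 1) ->
  hat X -> stend psi phi -> stend (fun k => shc (q k) X (psi k)) (X phi).
Proof.
by move=> q1 [ws hX] pt; rewrite hX; apply: stend_eq (stend_hop ws q1 pt) => k; rewrite /shc hX.
Qed.

Lemma scont_hat X : hat X -> scont X.
Proof.
(* Continuity is the case of the constant sequence [q = 0], whose phases equal 1. *)
move=> hX psi phi pt; have h : forall r, ctend (fun k : nat => phase r 0) 1.
  by move=> r; rewrite phase0r; exact: ctend_cst.
apply: stend_eq (stend_hat h hX pt) => k; rewrite /shc.
have s0 (u : S) : transl 0 u = u by apply: sspinor_eq => m; rewrite translE subr0.
by rewrite oppr0 !s0.
Qed.

End HatOperators.

(** * The trace *)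

Section Trace.
Context {R : realType} {n : nat}.
Variable theta : 'M[R]_n.
Hypothesis thetaT : theta^T = - theta.
Hypothesis theta_irr : strictly_irrational theta.
Local Notation Z := 'rV[int]_n.
Local Notation A := (ncalg theta).
Local Notation phase := (Defs.phase theta).
Local Notation mulA := (Defs.mulA theta).

(** The monomials [U^l U^q] and [U^q U^l] differ by the factor [phase l q ^+ 2]. If all these
    factors were 1, [U^l] would be central and hence scalar. *)
Lemma phase_nontriv l : l != 0 -> exists q, phase l q ^+ 2 != 1.
Proof.
move=> l0; apply: contrapT => h.
have h1 q : phase l q = phase q l.
  have : phase l q ^+ 2 = 1 by apply/eqP; apply: contrapT => /negP hq; apply: h; exists q.
  move=> e; rewrite -[phase q l]mul1r -e expr2 -mulrA phaseMC// mulr1.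
  by [].
have [|c hc] := theta_irr (smooth_delta l).
  move=> a sa; apply/funext => m; rewrite mulA_deltal mulA_deltar h1.
  by [].
have := congr1 (@^~ l) hc; rewrite /scalarA /delta eqxx (negbTE l0) => /eqP.
by rewrite oner_eq0.
Qed.

Lemma half_lt1 (z : R[i]) : cnorm z = 1 -> z != 1 -> cnorm ((1 + z) / 2) < 1.
Proof.
move=> z1 zn1.
have h2 : cnorm ((1 + z) / 2) = cnorm (1 + z) / 2.
  rewrite cnormM; congr (_ * _).
  have -> : (2^-1 : R[i]) = (2^-1 : R)%:C by rewrite rmorphV /= ?rmorph_nat// unitfE.
  by rewrite cnorm_real ger0_norm.
rewrite h2 ltr_pdivrMr// mul1r.
have : cnorm z ^+ 2 = 1 by rewrite z1 expr1n.
rewrite /cnorm sqr_sqrtr ?addr_ge0 ?sqr_ge0//.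
case: z zn1 {z1 h2} => a b zn1 /= ab.
rewrite -(ltr_sqr (sqrtr_ge0 _))// ?nnegrE// sqr_sqrtr ?addr_ge0 ?sqr_ge0//.
have a1 : a < 1.
  rewrite ltNge; apply/negP => a1; move: zn1; rewrite eq_complex /=.
  have b0 : b = 0 by apply/eqP; rewrite -sqrf_eq0 eq_le sqr_ge0 andbT; nra.
  have -> : a = 1 by rewrite b0 in ab; nra.
  by rewrite b0 !eqxx.
nra.
Qed.

Lemma half_le1 (z : R[i]) : cnorm z = 1 -> cnorm ((1 + z) / 2) <= 1.
Proof.
move=> z1; have [->|zn1] := eqVneq z 1; last exact: ltW (half_lt1 z1 zn1).
by rewrite (_ : (1 + 1) / 2 = 1) ?cnorm1// -mulr2n divff.
Qed.

Lemma expr_small (r C e : R) : 0 <= r < 1 -> 0 < e -> exists k, C * r ^+ k <= e.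
Proof.
move=> /andP[r0 r1] e0.
have d0 : 0 < e / (`|C| + 1) by rewrite divr_gt0// ltr_wpDl.
have : (GRing.exp r : nat -> R) @ \oo --> 0 by apply: cvg_expr; rewrite ger0_norm.
move/cvgrPdist_le => /(_ _ d0) [k _ /(_ k (leqnn _))].
rewrite /= sub0r normrN ger0_norm ?exprn_ge0// => h; exists k.
apply: le_trans (ler_norm _) _; rewrite normrM (ger0_norm (exprn_ge0 _ r0)).
apply: le_trans (ler_wpM2l (normr_ge0 _) h) _.
rewrite mulrCA ler_piMr ?(ltW e0)// ler_pdivrMr ?mul1r ?lerDl// ltr_wpDl//.
Qed.

Lemma phase2_norm l q : cnorm (phase l q ^+ 2) = 1.
Proof. by rewrite cnormX cnorm_phase expr1n. Qed.

(** The absolutely convergent Fourier series with coefficients [g] vanishes at all the characters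
    [phase _ q ^+ 2] of the lattice; irrationality says that no [l] other than 0 is trivial under
    all of them. *)
Definition fourier_null (g : Z -> R[i]) :=
  forall q, csum (fun l => g l * phase l q ^+ 2) = 0.

Lemma fourier_dom C g q : sdom C g -> sdom C (fun l => g l * phase l q ^+ 2).
Proof. by move=> gC l; rewrite cnormM phase2_norm mulr1. Qed.

(** The new series at [q'] is the mean of the old one at [q'] and at [q + q']. *)
Lemma fourier_null_half C g q : sdom C g -> fourier_null g ->
  fourier_null (fun l => g l * ((1 + phase l q ^+ 2) / 2)).
Proof.
move=> gC g0 q'; have := csum_linear 1 (fourier_dom q' gC) (fourier_dom (q + q') gC).
rewrite !g0 mulr0 addr0 => h.
have h2 := csumZ 2^-1 (sdomD (sdomZ 1 (fourier_dom q' gC)) (fourier_dom (q + q') gC)).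
rewrite h mulr0 in h2; rewrite -[RHS]h2; congr csum; apply/funext => l.
by rewrite phaseDr; field.
Qed.

Lemma sdom_half C g q : sdom C g -> sdom C (fun l => g l * ((1 + phase l q ^+ 2) / 2)).
Proof.
move=> gC l; rewrite cnormM; apply: le_trans (gC l).
by rewrite ler_piMr ?cnorm_ge0// half_le1 ?phase2_norm.
Qed.

(** Repeated averaging in a direction [q] that moves [l0] damps the coefficient at [l0]
    geometrically, increases no coefficient in modulus and preserves the one at 0. Treating the
    points of [F] in turn therefore never spoils earlier ones. *)
Lemma fourier_null_small C g (F : seq Z) (e : R) : 0 < e -> sdom C g -> fourier_null g ->
  exists g', [/\ sdom C g', fourier_null g', g' 0 = g 0 &
    forall l, l \in F -> l != 0 -> cnorm (g' l) <= e].
Proof.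
move=> e0 gC g0; elim: F => [|l0 F [g' [g'C g'0 g'g g'e]]]; first by exists g.
have [->|l00] := eqVneq l0 0.
  exists g'; split=> // l; rewrite inE => /orP[/eqP ->|]; first by rewrite eqxx.
  exact: g'e.
have [q hq] := phase_nontriv l00.
pose T k l := g' l * ((1 + phase l q ^+ 2) / 2) ^+ k.
have TS k : T k.+1 = fun l => T k l * ((1 + phase l q ^+ 2) / 2).
  by apply/funext => l; rewrite /T exprSr mulrA.
have hT k : sdom C (T k) /\ fourier_null (T k).
  elim: k => [|k [h1 h2]]; first by rewrite (_ : T 0 = g') //; apply/funext => l; rewrite /T mulr1.
  by rewrite TS; split; [exact: sdom_half|exact: fourier_null_half h1 h2].
have Tle k l : cnorm (T k l) <= cnorm (g' l).
  rewrite /T cnormM ler_piMr ?cnorm_ge0// cnormX exprn_ile1 ?cnorm_ge0//.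
  by rewrite half_le1 ?phase2_norm.
have [|k hk] := @expr_small (cnorm ((1 + phase l0 q ^+ 2) / 2)) (cnorm (g' l0)) e _ e0.
  by rewrite cnorm_ge0 half_lt1 ?phase2_norm.
exists (T k); split.
- by case: (hT k).
- by case: (hT k).
- rewrite /T phase0l expr1n (_ : (1 + 1) / 2 = 1) ?expr1n ?mulr1//.
  by rewrite -mulr2n divff.
- move=> l; rewrite inE => /orP[/eqP -> _|lF l0n]; first by rewrite /T cnormM cnormX.
  exact: le_trans (Tle k l) (g'e _ lF l0n).
Qed.

(** Once all coefficients but [g 0] are negligible on a large finite set, the vanishing of the
    series at [q = 0] forces [g 0] to be as small as the tail. Averaging takes the place of the
    density of the characters in the torus. *)
Lemma fourier_null0 C g : sdom C g -> fourier_null g -> g 0 = 0.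
Proof.
move=> gC g0; apply: cnorm_le_eps0 => e e0; have e2 : 0 < e / 2 by rewrite divr_gt0.
have [F0 uF0 hF0] := @csum_tail R n C _ e2.
pose F := undup (0 :: F0).
have d0 : 0 < e / 2 / (size F).+1%:R by rewrite divr_gt0.
have [g' [g'C g'0 g'g g'e]] := fourier_null_small F d0 gC g0.
have := hF0 _ (fourier_dom 0 g'C) F (undup_uniq _).
rewrite g'0 sub0r cnormN => /(_ _)/le_trans; rewrite -g'g => h.
have F0F : {subset F0 <= F} by move=> m mF; rewrite mem_undup inE mF orbT.
have : cnorm (\sum_(m <- F) g' m * phase m 0 ^+ 2) <= e / 2 by exact: (h _ F0F (lexx _)).
have zF : 0 \in F by rewrite mem_undup inE eqxx.
rewrite (bigD1_seq 0) ?undup_uniq //= phase0l expr1n mulr1 => h1.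
set t := \sum_(_ <- _ | _) _ in h1.
have h2 : cnorm t <= e / 2.
  rewrite /t big_seq_cond; apply: le_trans (cnorm_sum _ _ _) _.
  apply: (@le_trans _ _ (\sum_(m <- F) e / 2 / (size F).+1%:R)).
    rewrite [leLHS]big_mkcond /= big_seq [leRHS]big_seq; apply: ler_sum => m mF.
    case: ifP => [/andP[_ m0]|_]; last exact: ltW.
    by rewrite cnormM phase2_norm mulr1 g'e.
  rewrite big_const_seq count_predT iter_addr_0 -[leLHS]mulr_natr -mulrA.
  apply: ler_piMr; first exact: ltW.
  by rewrite mulrC ltW// ltr_pdivrMr ?mul1r ?ltr_nat.
have -> : g' 0 = g' 0 + t - t by rewrite addrK.
by apply: le_trans (cnormB _ _) _; rewrite [leRHS](splitr e) lerD.
Qed.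

Lemma tauC (a b : A) : (a * b) 0 = (b * a) 0.
Proof.
rewrite !ncME; have [C hC] := conv_sdom theta 0 (ncP a) (ncP b).
have [C' hC'] := conv_sdom theta 0 (ncP b) (ncP a).
have E (c d : A) l : c l * d (0 - l) * phase l (0 - l) = c l * d (- l).
  by rewrite sub0r phaseNr// phase_diag// mulr1.
rewrite /Defs.mulA -(@csum_reindex _ _ C C' _ -%R -%R (@opprK _) (@opprK _) hC).
  by congr csum; apply/funext => l /=; rewrite !E opprK mulrC.
by move=> l /=; rewrite E opprK mulrC -(E b a); exact: hC'.
Qed.

Section Spin.
Context {N : nat}.
Local Notation S := (sspinor R n N).
Local Notation word := (@word R n N theta).

(** The diagonal entries of the word at [q], summed over the spin index, form the Fourier series
    with these coefficients, evaluated at the character of [q]; its coefficient at 0 is the value of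
    the trace. *)
Definition wcoef (w : word) (l : Z) : R[i] := w.1.1 l * w.1.2 (- l) * \tr w.2.
Definition trw (ws : seq word) : R[i] := \sum_(w <- ws) w.1.1 0 * w.1.2 0 * \tr w.2.

Lemma wcoef_dom w : exists C, sdom C (wcoef w).
Proof.
have [C hC] := sbf_sdom (smooth_sbf unit (ncP w.1.1)).
have [B B0 hB] := sbf_ge0 0 (smooth_sbf unit (ncP w.1.2)).
exists (C * (B * cnorm (\tr w.2))) => l; rewrite /wcoef !cnormM -mulrA.
have := hB tt (- l); rewrite expr0 mulr1 => h.
have -> : C * (B * cnorm (\tr w.2)) * om l = (C * om l) * (B * cnorm (\tr w.2)) by ring.
apply: ler_pM => //; rewrite ?mulr_ge0 ?cnorm_ge0//; first exact: (hC tt l).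
by rewrite ler_wpM2r ?cnorm_ge0.
Qed.

Lemma wop_diag (w : word) q i :
  wop w (basis q i) q i 0 = csum (fun l => w.1.1 l * w.1.2 (- l) * w.2 i i * phase l q ^+ 2).
Proof.
case: w => [[a b] M]; rewrite /wop LopE /=.
have E1 : (fun l => Mop M (@basis R n N q i) l i 0) = fun l => M i i * delta q l.
  apply/funext => l; rewrite Mop_comp (bigD1 i)//= basisE eqxx andbT big1 ?addr0.
    by rewrite /delta; case: eqP.
  by move=> j ji; rewrite basisE (negbTE ji) andbF mulr0.
have -> : (fun l => Rop b (Mop M (basis q i)) l i 0) = fun l => M i i * mulA (delta q) b l.
  by apply/funext => l; rewrite RopE E1 (mulAZl theta _ _ (smooth_delta q) (ncP b)).
congr csum; apply/funext => l; rewrite mulA_deltal addrAC subrr add0r phaseNr//.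
have -> : phase l (q - l) = phase l q by rewrite phaseDr phaseNr// phase_diag// mulr1.
by rewrite expr2; ring.
Qed.

(** The factorized trace is well defined for this reason: the diagonal of the zero operator
    vanishes, so the Fourier series of the words vanishes at all characters, and with it its
    coefficient at 0. *)
Lemma trw_null (ws : seq word) : (forall psi : S, hop ws psi = 0) -> trw ws = 0.
Proof.
move=> h0; pose g l := \sum_(w <- ws) wcoef w l.
have /choice[C hC] w := wcoef_dom w.
have gC : sdom (\sum_(w <- ws) C w) g.
  move=> l; apply: le_trans (cnorm_sum _ _ _) _; rewrite mulr_suml.
  by apply: ler_sum => w _; exact: hC.
have -> : trw ws = g 0 by apply: eq_bigr => w _; rewrite /wcoef oppr0.
apply: (fourier_null0 gC) => q.
have : \sum_i hop ws (basis q i) q i 0 = 0 by rewrite big1// => i _; rewrite h0 ssp0E mxE.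
have E (w : word) i l : w.1.1 l * w.1.2 (- l) * w.2 i i * phase l q ^+ 2 =
  w.2 i i * (w.1.1 l * w.1.2 (- l) * phase l q ^+ 2) by ring.
have /choice[D hD] : forall w : word, exists D : R, sdom D (fun l => w.1.1 l * w.1.2 (- l) * phase l q ^+ 2).
  move=> w; have [D hD] := wcoef_dom (w.1.1, w.1.2, 1%:M).
  have [D' hD'] := sbf_sdom (smooth_sbf unit (ncP w.1.1)).
  have [B B0 hB] := sbf_ge0 0 (smooth_sbf unit (ncP w.1.2)).
  exists (B * D') => l; rewrite cnormM phase2_norm mulr1 cnormM mulrC -mulrA.
  apply: ler_pM; rewrite ?cnorm_ge0//; last exact: (hD' tt l).
  by have := hB tt (- l); rewrite expr0 mulr1.
have <- : csum (fun l => g l * phase l q ^+ 2) = \sum_i hop ws (basis q i) q i 0; last by [].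
transitivity (\sum_(w <- ws) \tr w.2 * csum (fun l => w.1.1 l * w.1.2 (- l) * phase l q ^+ 2)).
  rewrite -(eq_bigr _ (fun w _ => csumZ (\tr w.2) (hD w))).
  rewrite /g; elim: ws {g gC h0} => [|w ws IH].
    rewrite big_nil -[RHS](@csum0 R n); congr csum; apply/funext => l.
    by rewrite big_nil mul0r.
  rewrite big_cons -IH.
  have d1 : sdom (\sum_(w <- ws) C w) (fun l => (\sum_(w <- ws) wcoef w l) * phase l q ^+ 2).
    apply: fourier_dom => l; apply: le_trans (cnorm_sum _ _ _) _; rewrite mulr_suml.
    by apply: ler_sum => v _; exact: hC.
  rewrite -(csumD (sdomZ (\tr w.2) (hD w)) d1); congr csum; apply/funext => l.
  by rewrite big_cons mulrDl; congr (_ + _); rewrite /wcoef; ring.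
rewrite /hop.
transitivity (\sum_i \sum_(w <- ws) wop w (basis q i) q i 0); last first.
  by apply: eq_bigr => i _; rewrite ssp_sumE summxE.
rewrite exchange_big; apply: eq_bigr => w _ /=; rewrite /mxtrace mulr_suml.
apply: eq_bigr => i _; rewrite wop_diag -(csumZ _ (hD w)).
by congr csum; apply/funext => l; rewrite E.
Qed.

Lemma trw_cat ws ws' : trw (ws ++ ws') = trw ws + trw ws'.
Proof. exact: big_cat. Qed.

Lemma trw_scale c ws : trw [seq wscale c w | w <- ws] = c * trw ws.
Proof. by rewrite /trw big_map mulr_sumr; apply: eq_bigr => w _; rewrite /= !mulrA. Qed.

(* [trv X c]: the operator X belongs to the algebra generated by A and A^o,
   tensored with matrices, and c is the value of tau (x) Tr on it. *)
Definition trv (X : S -> S) (c : R[i]) := exists2 ws, X =1 hop ws & c = trw ws.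

Lemma trv_unique X c c' : trv X c -> trv X c' -> c = c'.
Proof.
move=> [w hw ->] [w' hw' ->]; apply/eqP; rewrite -subr_eq0 -mulN1r -trw_scale -trw_cat.
by apply/eqP/trw_null => psi; rewrite hop_cat hop_scale -hw -hw' scaleN1r subrr.
Qed.

Lemma hat_trv X : hat theta X -> exists c, trv X c.
Proof. by move=> [w hw]; exists (trw w); exists w. Qed.

Lemma trv_eq X Y c : X =1 Y -> trv X c -> trv Y c.
Proof. by move=> XY [w hw ->]; exists w => // psi; rewrite -XY. Qed.

Lemma trvD X Y c c' : trv X c -> trv Y c' -> trv (fun psi => X psi + Y psi) (c + c').
Proof. by move=> [w hw ->] [w' hw' ->]; exists (w ++ w'); rewrite ?trw_cat// => psi; rewrite hop_cat hw hw'. Qed.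

Lemma trvZ a X c : trv X c -> trv (fun psi => a *: X psi) (a * c).
Proof. by move=> [w hw ->]; exists [seq wscale a x | x <- w]; rewrite ?trw_scale// => psi; rewrite hop_scale hw. Qed.

Lemma trv_wop (w : word) : trv (wop w) (w.1.1 0 * w.1.2 0 * \tr w.2).
Proof. by exists [:: w]; [move=> psi; rewrite /hop big_seq1|rewrite /trw big_seq1]. Qed.

(** Cyclicity for factors of [A^o]: on each word it is the trace property of [tau] applied to the
    second component alone. *)
Lemma trv_cyc a M b X c : hat theta X -> trv (fun psi => Lop a (Mop M (Rop b (X psi)))) c ->
  trv (fun psi => Lop (a : A) (Mop M (X (Rop (b : A) psi)))) c.
Proof.
move=> [ws hX] t1.
have t2 : trv (fun psi => Lop a (Mop M (Rop b (X psi)))) (trw [seq wmul (a, b, M) w | w <- ws]).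
  exists [seq wmul (a, b, M) w | w <- ws] => // psi; rewrite hX /hop big_map !linear_sum.
  by apply: eq_bigr => w _; rewrite wop_mul /wop /= Mop_Rop.
rewrite (trv_unique t1 t2).
exists [seq wmul (wmul (a, 1, M) w) (1, b, 1%:M) | w <- ws].
  move=> psi; rewrite hX /hop big_map !linear_sum; apply: eq_bigr => w _.
  rewrite !wop_mul /wop /= Mop_scalar scale1r Lop1 Rop1; by [].
rewrite /trw !big_map; apply: eq_bigr => w _.
have -> : wmul (wmul (a, 1, M) w) (1, b, 1%:M) = (a * w.1.1, b * w.1.2, M *m w.2).
  congr (_, _, _); [exact: mulr1|exact: (congr1 (fun x => b * x) (mulr1 w.1.2))|exact: mulmx1].
by rewrite [LHS]/= -[mulA w.1.2 b 0]/((w.1.2 * b) 0) (tauC w.1.2 b).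
Qed.

Lemma hat_repr_words (X : operator) r a b M : @hat_repr R n theta N X r a b M ->
  exists2 ws : seq word, (forall psi : S, X psi = hop ws psi) &
    \sum_t tau (a t) * tau (b t) * \tr (M t) = trw ws.
Proof.
move=> [sab hX].
exists [seq (NCAlg theta (sab t).1, NCAlg theta (sab t).2, M t) | t <- enum 'I_r].
  move=> psi; rewrite hX; last exact: spP.
  by apply/funext => m; rewrite /hop ssp_sumE big_map big_enum.
by rewrite /trw big_map big_enum.
Qed.

Lemma in_hat_words (X : operator) : @in_hat R n theta N X ->
  exists ws : seq word, forall psi : S, X psi = hop ws psi.
Proof. by move=> [r [a [b [M /hat_repr_words[ws hws _]]]]]; exists ws. Qed.

Lemma tauTr_trv (X : operator) (Y : S -> S) c : (forall psi : S, X psi = Y psi :> spinor) ->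
  trv Y c -> tauTr theta X = c.
Proof.
move=> XY [ws hY ->].
have uniq x : [set x | exists r a b M, @hat_repr R n theta N X r a b M /\
    x = \sum_t tau (a t) * tau (b t) * \tr (M t)] x -> x = trw ws.
  move=> [r [a [b [M [/hat_repr_words[w' hw' e] ->]]]]]; rewrite e.
  apply: (@trv_unique Y); [exists w'|exists ws] => // psi.
  by apply: sspinor_eq => m; rewrite -XY hw'.
rewrite /tauTr; case: xgetP => [x _ /uniq //|].
move=> /(_ (trw ws)); case; exists (size ws), (fun t => (tnth (in_tuple ws) t).1.1),
  (fun t => (tnth (in_tuple ws) t).1.2), (fun t => (tnth (in_tuple ws) t).2).
split; last by rewrite /trw (big_tnth _ _ ws).
split=> [t|psi sp]; first by split; exact: ncP.
have := XY (SSpinor _ sp); rewrite /= => ->; rewrite hY; apply/funext => m.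
by rewrite /hop ssp_sumE (big_tnth _ _ ws).
Qed.

End Spin.
End Trace.

(** * Positive square roots and logarithmic derivatives *)

Section Positivity.
Context {R : realType} {n : nat}.
Variable theta : 'M[R]_n.
Hypothesis thetaT : theta^T = - theta.
Local Notation Z := 'rV[int]_n.
Local Notation A := (ncalg theta).
Local Notation phase := (Defs.phase theta).
Local Notation mulA := (Defs.mulA theta).

Section Norm.
Context {N : nat}.
Local Notation S := (sspinor R n N).

Lemma inner_lin_l (c : R[i]) (phi phi' psi : S) :
  inner (c *: phi + phi') psi = c^* * inner phi psi + inner phi' psi.
Proof.
rewrite inner_conj inner_linear (rmorphD (@conjc R)) (rmorphM (@conjc R)).
by congr (_ * _ + _); rewrite [RHS]inner_conj.
Qed.

Lemma inner0r (phi : S) : inner phi (0 : S) = 0.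
Proof.
have := inner_linear phi 1 0 0; rewrite scaler0 addr0 mul1r -{1}[inner phi _]addr0.
by move/addrI <-.
Qed.

Lemma inner0l (phi : S) : inner (0 : S) phi = 0.
Proof. by rewrite inner_conj inner0r conjc0. Qed.

Lemma innerDr (phi psi psi' : S) : inner phi (psi + psi') = inner phi psi + inner phi psi'.
Proof. by rewrite -[psi]scale1r inner_linear mul1r scale1r. Qed.

Lemma innerDl (phi psi psi' : S) : inner (psi + psi') phi = inner psi phi + inner psi' phi.
Proof. by rewrite -{1}[psi]scale1r inner_lin_l (rmorph1 (@conjc R)) mul1r. Qed.

Lemma innerZr c (phi psi : S) : inner phi (c *: psi) = c * inner phi psi.
Proof. by rewrite -[_ *: _]addr0 inner_linear inner0r addr0. Qed.

Lemma innerZl c (phi psi : S) : inner (c *: phi) psi = c^* * inner phi psi.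
Proof. by rewrite -[_ *: _]addr0 inner_lin_l inner0l addr0. Qed.

(** Polarization at [phi + psi] and [phi + i psi], which compare the imaginary and the real parts of
    the two off-diagonal terms. *)
Lemma herm_of_real (X : {linear S -> S}) :
  (forall psi : S, complex.Im (inner psi (X psi)) = 0) ->
  forall phi psi : S, inner (X phi) psi = inner phi (X psi).
Proof.
move=> h phi psi; rewrite inner_conj.
have e1 : inner (phi + psi) (X (phi + psi)) =
    inner phi (X phi) + inner phi (X psi) + (inner psi (X phi) + inner psi (X psi)).
  by rewrite linearD innerDl !innerDr.
have e2 : inner (phi + 'i%C *: psi) (X (phi + 'i%C *: psi)) =
    inner phi (X phi) + 'i%C * inner phi (X psi) +
    (('i%C)^* * inner psi (X phi) + ('i%C)^* * ('i%C * inner psi (X psi))).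
  by rewrite linearD linearZ innerDl !innerDr !innerZl !innerZr.
move: (h (phi + psi)) (h (phi + 'i%C *: psi)) (h phi) (h psi); rewrite e1 e2.
move: (inner phi (X phi)) (inner phi (X psi)) (inner psi (X phi)) (inner psi (X psi)).
move=> [a a'] [b b'] [c c'] [e e'] /= h1 h2 h3 h4.
by apply/eqP; rewrite eq_complex /=; apply/andP; split; apply/eqP; lra.
Qed.

Definition nrm (psi : S) : R := Num.sqrt (rip psi psi).
Lemma nrm_ge0 psi : 0 <= nrm psi. Proof. exact: sqrtr_ge0. Qed.

Lemma sqr_nrm psi : nrm psi ^+ 2 = rip psi psi.
Proof. by rewrite sqr_sqrtr ?rip_ge0. Qed.

Lemma rip_quad (phi psi : S) (t : R) :
  rip (phi + t%:C *: psi) (phi + t%:C *: psi) = rip phi phi + 2 * t * rip phi psi + t ^+ 2 * rip psi psi.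
Proof. by rewrite !(ripDl, ripDr, ripZl, ripZr) (ripC psi phi); ring. Qed.

Lemma rip_cs (phi psi : S) : rip phi psi <= nrm phi * nrm psi.
Proof.
have ab : 0 <= nrm phi * nrm psi by rewrite mulr_ge0 ?nrm_ge0.
suff : rip phi psi ^+ 2 <= (nrm phi * nrm psi) ^+ 2.
  by move=> h; apply: le_trans (ler_norm _) _; rewrite -(ger0_norm ab) -ler_sqr ?nnegrE// !real_normK ?num_real.
rewrite exprMn !sqr_nrm.
have [p0|p0] := eqVneq (rip psi psi) 0.
  have -> : psi = 0 by apply: rip_eq0; rewrite p0.
  by rewrite /rip !inner0r /= mulr0 expr0n.
have pp : 0 < rip psi psi by rewrite lt0r p0 rip_ge0.
have := rip_ge0 (phi + (- (rip phi psi / rip psi psi))%:C *: psi); rewrite rip_quad.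
have -> : rip phi phi + 2 * - (rip phi psi / rip psi psi) * rip phi psi + (- (rip phi psi / rip psi psi)) ^+ 2 * rip psi psi = rip phi phi - rip phi psi ^+ 2 / rip psi psi by field.
by rewrite subr_ge0 ler_pdivrMr.
Qed.

Lemma nrmD (phi psi : S) : nrm (phi + psi) <= nrm phi + nrm psi.
Proof.
have xy : 0 <= nrm phi + nrm psi by rewrite addr_ge0 ?nrm_ge0.
rewrite -ler_sqr ?nnegrE ?nrm_ge0// sqr_nrm sqrrD !sqr_nrm.
have := rip_quad phi psi 1; rewrite rmorph1 scale1r => ->.
by have := rip_cs phi psi; lra.
Qed.

Lemma nrmZ c (psi : S) : nrm (c *: psi) = cnorm c * nrm psi.
Proof.
rewrite /nrm /rip innerZl innerZr mulrA.
have -> : c^* * c = (cnorm c ^+ 2)%:C.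
  by rewrite rmorphXn /= cnormE normCK mulrC.
by rewrite ReMr sqrtrM ?sqr_ge0// sqrtr_sqr ger0_norm ?cnorm_ge0.
Qed.

Lemma nrm0 : nrm 0 = 0.
Proof. by rewrite /nrm /rip inner0r sqrtr0. Qed.

Lemma nrm_sum (I : Type) (r : seq I) (F : I -> S) : nrm (\sum_(i <- r) F i) <= \sum_(i <- r) nrm (F i).
Proof.
elim/big_rec2: _ => [|i x y _ le_xy]; first by rewrite nrm0.
by apply: le_trans (nrmD _ _) _; rewrite lerD2l.
Qed.

Lemma nrm_Rop_delta r (psi : S) : nrm (Rop (ncdelta theta r) psi) = nrm psi.
Proof.
rewrite /nrm /rip -[in RHS](inner_transl r); congr (Num.sqrt (complex.Re (csum _))).
apply/funext => m; apply: eq_bigr => i _; rewrite RopE mulA_deltar translE.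
rewrite (rmorphM (@conjc R)); set p := Defs.phase _ _ _.
have h : conjc p * p = 1 by rewrite mulrC -normCK -cnormE cnorm_phase expr1n.
by rewrite mulrACA h mulr1.
Qed.

Definition truncA (L : nat) (b : A) : A :=
  \sum_(q <- exhaust n L) b q *: ncdelta theta q.

Lemma nc_sumE (I : Type) (r : seq I) (F : I -> A) m :
  (\sum_(i <- r) F i) m = \sum_(i <- r) F i m.
Proof. by apply: (big_morph (fun b : A => b m)). Qed.

Lemma truncAE L b m :
  truncA L b m = if m \in exhaust n L then b m else 0.
Proof.
rewrite /truncA; have uF := exhaust_uniq n L.
rewrite nc_sumE; case: ifP => mF.
  rewrite (bigD1_seq m)//= /delta eqxx mulr1 big1 ?addr0// => q qm.
  by rewrite /delta eq_sym (negbTE qm) mulr0.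
rewrite big_seq big1// => q qF; rewrite ncZE /= /delta; case: eqP => [mq|_]; last by rewrite mulr0.
by rewrite mq qF in mF.
Qed.

(** Right multiplication by a monomial is isometric, so the norm is at most the sum of the moduli of
    the coefficients; truncations of [b] avoid an infinite triangle inequality. *)
Lemma Rop_bounded (b : A) : exists2 M : R, 0 < M & forall psi : S, nrm (Rop b psi) <= M * nrm psi.
Proof.
have [C hC] := sbf_sdom (smooth_sbf unit (ncP b)); have C0 := sdom_ge0 (hC tt).
exists (C * 6 ^+ n + 1) => [|psi]; first by rewrite ltr_wpDl// mulr_ge0// exprn_ge0.
apply: (@le_trans _ _ (C * 6 ^+ n * nrm psi)); last by rewrite ler_wpM2r ?nrm_ge0// lerDl.
have tr L : nrm (Rop (truncA L b) psi) <= C * 6 ^+ n * nrm psi.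
  have -> : Rop (truncA L b) psi = \sum_(q <- exhaust n L) b q *: Rop (ncdelta theta q) psi.
    rewrite /truncA; elim: (exhaust _) => [|q s IH]; first by rewrite !big_nil Rop0.
    by rewrite !big_cons RopD RopZ IH.
  apply: le_trans (nrm_sum _ _) _.
  under eq_bigr do rewrite nrmZ nrm_Rop_delta.
  rewrite -mulr_suml ler_wpM2r ?nrm_ge0//.
  apply: le_trans (sum_om_scaled C0 (exhaust_uniq n L)); apply: ler_sum => q _; exact: (hC tt).
have st : stend (fun L => Rop (truncA L b) psi) (Rop b psi).
  apply: stend_Rop (stend_cst psi) => [|m].
    apply: (@sbf_le _ _ _ _ (fun _ => b) 1 0); last exact: smooth_sbf (ncP b).
    by move=> L m; rewrite !mul1r truncAE; case: ifP => _; [exact: lexx|rewrite cnorm0; exact: cnorm_ge0].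
  move=> e e0; exists (choice.pickle m).+1 => L mL; rewrite truncAE ifT ?subrr ?cnorm0 ?ltW//.
  exact: mem_exhaust.
have c0 : 0 <= C * 6 ^+ n * nrm psi by rewrite !mulr_ge0 ?nrm_ge0// exprn_ge0.
rewrite -ler_sqr ?nnegrE ?nrm_ge0// sqr_nrm; apply/ler_addgt0Pr => e e0.
have [k0 /(_ k0 (leqnn _)) h] := rip_cont st st e0.
have : `|rip (Rop (truncA k0 b) psi) (Rop (truncA k0 b) psi) - rip (Rop b psi) (Rop b psi)| <= e.
  by rewrite /rip -ReN -ReD; apply: le_trans (Re_le_cnorm _) h.
have : rip (Rop (truncA k0 b) psi) (Rop (truncA k0 b) psi) <= (C * 6 ^+ n * nrm psi) ^+ 2.
  by rewrite -sqr_nrm ler_sqr ?nnegrE ?nrm_ge0.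
move: (rip _ _) (rip _ _) (_ ^+ 2) => x z y; rewrite ler_norml => h1 /andP[h2 _]; lra.
Qed.

(** [X^2 <= M X] when [0 <= X <= M], without using a square root of [X]: positivity is tested on
    [psi - X psi / M], and [X <= M] on [X psi]. *)
Lemma pos_sqr_le (X : {linear S -> S}) (M : R) : 0 < M ->
  (forall phi psi, rip (X phi) psi = rip phi (X psi)) ->
  (forall psi, 0 <= rip psi (X psi)) ->
  (forall psi, rip (X psi) (X psi) <= M ^+ 2 * rip psi psi) ->
  forall psi, rip (X psi) (X psi) <= M * rip psi (X psi).
Proof.
move=> M0 sym pos bnd psi.
have hXX (v : S) : rip v (X v) <= M * rip v v.
  have := rip_ge0 (X v + (- M)%:C *: v); rewrite rip_quad (ripC (X v)).
  have := bnd v => h1 h2.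
  have : M * rip v (X v) <= M * (M * rip v v) by nra.
  by rewrite ler_pM2l.
have := pos (psi + (- M^-1)%:C *: X psi).
rewrite linearD linearZ /= !(ripDl, ripDr, ripZl, ripZr) -(sym psi (X psi)).
have := hXX (X psi); set a := rip psi (X psi); set b := rip (X psi) (X psi); set c := rip (X psi) (X (X psi)).
move=> h1 h2.
have h3 : a - 2 * M^-1 * b + M^-1 ^+ 2 * c >= 0 by apply: le_trans h2 _; rewrite le_eqVlt; apply/orP; left; apply/eqP; ring.
have h4 : M^-1 ^+ 2 * c <= M^-1 * b.
  by rewrite expr2 -mulrA ler_wpM2l ?invr_ge0 ?(ltW M0)// mulrC ler_pdivrMr// mulrC.
have : M^-1 * b <= a by lra.
by rewrite mulrC ler_pdivrMr// mulrC.
Qed.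

(** An elementary argument on a space that is not complete. Since [X^2 = Y^2], the difference
    [W = X - Y] satisfies [(M + Y) W = W (M - X)]. The factor [M + Y] expands squared norms by at
    least [M^2 + 2 M eps], while [M - X] expands them by at most [M^2]. Any bound on [W] thus
    improves by the ratio [r < 1], and iteration gives [W = 0]. *)
Lemma pos_sqrt_unique (X Y : {linear S -> S}) (M eps : R) : 0 < M -> 0 < eps ->
  (forall phi psi, rip (X phi) psi = rip phi (X psi)) ->
  (forall psi, 0 <= rip psi (X psi)) ->
  (forall phi psi, rip (Y phi) psi = rip phi (Y psi)) ->
  (forall psi, eps * rip psi psi <= rip psi (Y psi)) ->
  (forall psi, rip (Y psi) (Y psi) <= M ^+ 2 * rip psi psi) ->
  (forall psi, X (X psi) = Y (Y psi)) -> X =1 Y.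
Proof.
move=> M0 eps0 Xs Xp Ys Yp Yb XY.
have Xb psi : rip (X psi) (X psi) = rip (Y psi) (Y psi) by rewrite Xs XY -Ys.
have Xb' psi : rip (X psi) (X psi) <= M ^+ 2 * rip psi psi by rewrite Xb Yb.
have Xle := pos_sqr_le M0 Xs Xp Xb'.
have [W WE] : exists W : S -> S, forall u, W u = X u - Y u by exists (fun u => X u - Y u).
have intertwine w : M%:C *: W w + Y (W w) = W (M%:C *: w - X w).
  rewrite !WE scalerBr (linearB X) !(linearB Y) (linearZ_LR X) (linearZ_LR Y) XY opprB.
  by rewrite addrACA [RHS]addrACA; congr (_ + _); rewrite addrC.
pose r := M ^+ 2 / (M ^+ 2 + 2 * M * eps).
have den : 0 < M ^+ 2 + 2 * M * eps by rewrite addr_gt0 ?exprn_gt0 ?mulr_gt0.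
have r01 : 0 <= r < 1.
  rewrite divr_ge0 ?exprn_ge0 ?(ltW M0) ?(ltW den)//= ltr_pdivrMr// mul1r ltrDl.
  by rewrite !mulr_gt0.
have step C : (forall w, rip (W w) (W w) <= C * rip w w) -> 0 <= C ->
    forall w, rip (W w) (W w) <= C * r * rip w w.
  move=> hC C0 w; have := hC (M%:C *: w - X w); rewrite -intertwine.
  have -> : rip (M%:C *: W w + Y (W w)) (M%:C *: W w + Y (W w)) =
     M ^+ 2 * rip (W w) (W w) + 2 * M * rip (W w) (Y (W w)) + rip (Y (W w)) (Y (W w)).
    by rewrite !(ripDl, ripDr, ripZl, ripZr) (ripC (Y (W w)) (W w)); ring.
  have -> : rip (M%:C *: w - X w) (M%:C *: w - X w) = M ^+ 2 * rip w w - 2 * M * rip w (X w) + rip (X w) (X w).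
    by rewrite !(ripDl, ripDr, ripZl, ripZr, ripNl, ripNr) (ripC (X w) w); ring.
  have := Yp (W w); have := rip_ge0 (Y (W w)); have := Xle w; have := rip_ge0 (W w); have := Xp w.
  set a := rip (W w) (W w); set b := rip w w; move=> h0 h1 h2 h3 h4 h5.
  have h6 : (M ^+ 2 + 2 * M * eps) * a <= C * (M ^+ 2 * b).
    have e1 : 2 * M * (eps * a) <= 2 * M * rip (W w) (Y (W w)) by rewrite ler_pM2l ?mulr_gt0.
    have e2 : M ^+ 2 * b - 2 * M * rip w (X w) + rip (X w) (X w) <= M ^+ 2 * b.
      by have : 0 <= M * rip w (X w); [rewrite mulr_ge0// ltW|lra].
    have e3 := ler_wpM2l C0 e2; lra.
  rewrite /r -(ler_pM2l den).
  have -> : (M ^+ 2 + 2 * M * eps) * (C * (M ^+ 2 / (M ^+ 2 + 2 * M * eps)) * b) = C * (M ^+ 2 * b).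
    by field; rewrite gt_eqF.
  exact: h6.
have [r0 r1] := andP r01.
have all k w : rip (W w) (W w) <= 4 * M ^+ 2 * r ^+ k * rip w w.
  elim: k w => [|k IH] w.
    rewrite mulr1 !WE !(ripDl, ripDr, ripNl, ripNr) (ripC (Y w) (X w)).
    have := rip_ge0 (X w + Y w); rewrite !(ripDl, ripDr) (ripC (Y w) (X w)).
    have := Xb' w; have := Yb w; lra.
  by rewrite (exprSr r k) [X in X * rip _ _]mulrA; apply: step => //; rewrite !mulr_ge0 ?exprn_ge0// ltW.
move=> w; apply/eqP; rewrite -subr_eq0 -WE; apply/eqP/rip_eq0.
apply/ler_addgt0Pr => e e0; rewrite add0r.
have [k hk] := expr_small (4 * M ^+ 2 * rip w w) r01 e0.
by apply: le_trans (all k w) _; rewrite mulrAC.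
Qed.

End Norm.

Variables (k h : A).
Hypothesis kh : k * h = 1.
Hypothesis hk : h * k = 1.
Hypothesis k_pos : forall a : Z -> R[i], smooth a -> 0 <= csum (fun m => (a m)^* * mulA a k m).

Section PosOp.
Context {N : nat}.
Local Notation S := (sspinor R n N).

Lemma inner_Rop_ge0 (psi : S) : 0 <= inner psi (Rop k psi).
Proof.
have [C hC] : exists C : R, forall i, sdom C (fun m => (psi m i 0)^* * mulA (fun l => psi l i 0) k m).
  have /choice[D hD] i : exists D : R, sdom D (fun m => (psi m i 0)^* * mulA (fun l => psi l i 0) k m).
    have [C hC] := sbf_sdom (smooth_sbf unit (smooth_mulA theta (spP psi i) (ncP k))).
    have [B B0 hB] := sbf_ge0 0 (smooth_sbf unit (spP psi i)).
    exists (B * C) => m; rewrite cnormM cnorm_conj -mulrA; apply: ler_pM; rewrite ?cnorm_ge0//.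
      by have := hB tt m; rewrite expr0 mulr1.
    exact: (hC tt).
  exists (\sum_i `|D i|) => i; apply: sdom_le (hD i).
  by apply: le_trans (ler_norm _) _; rewrite (bigD1 i)//= lerDl sumr_ge0.
have -> : inner psi (Rop k psi) = \sum_i csum (fun m => (psi m i 0)^* * mulA (fun l => psi l i 0) k m).
  rewrite -big_enum -(csum_sum (enum 'I_N) hC); congr csum; apply/funext => m.
  by rewrite big_enum; apply: eq_bigr => i _; rewrite RopE.
by apply: sumr_ge0 => i _; apply: k_pos; exact: spP.
Qed.

Lemma inner_Ropk (phi psi : S) : inner (Rop k phi) psi = inner phi (Rop k psi).
Proof. by apply: (herm_of_real (X := Rop k)) => u; exact: ger0_Im (inner_Rop_ge0 u). Qed.

Lemma rip_Ropk (phi psi : S) : rip (Rop k phi) psi = rip phi (Rop k psi).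
Proof. by rewrite /rip inner_Ropk. Qed.

Lemma rip_Ropk_ge0 (psi : S) : 0 <= rip psi (Rop k psi).
Proof. by have := inner_Rop_ge0 psi; rewrite lecE /= => /andP[_]. Qed.

(** The two estimates are shaped for a Neumann series: for [y = 1 - k / M] they give
    [|y psi|^2 <= (1 - eps) |psi|^2]. The lower one comes from the boundedness of the inverse
    [h]. *)
Lemma Ropk_bounds : exists M eps : R, [/\ 0 < M, 0 < eps, eps < 1,
  forall psi : S, rip (Rop k psi) (Rop k psi) <= M * rip psi (Rop k psi) &
  forall psi : S, eps * M * rip psi psi <= rip psi (Rop k psi)].
Proof.
have [M M0 hM] := @Rop_bounded N k; have [H H0 hH] := @Rop_bounded N h.
have b1 (psi : S) : rip (Rop k psi) (Rop k psi) <= M ^+ 2 * rip psi psi.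
  by rewrite -!sqr_nrm -exprMn ler_sqr ?nnegrE ?mulr_ge0 ?nrm_ge0// ltW.
have b2 := pos_sqr_le M0 rip_Ropk rip_Ropk_ge0 b1.
have b3 (psi : S) : rip psi psi <= H ^+ 2 * rip (Rop k psi) (Rop k psi).
  have := hH (Rop k psi); rewrite -RopM kh Rop1 => hh.
  by rewrite -!sqr_nrm -exprMn ler_sqr ?nnegrE ?mulr_ge0 ?nrm_ge0// ltW.
pose e : R := (M ^+ 2 * H ^+ 2 + 1)^-1.
have q0 : 0 < M ^+ 2 * H ^+ 2 by rewrite mulr_gt0 ?exprn_gt0.
have e0 : 0 < e by rewrite invr_gt0 addr_gt0.
exists M, e; split=> //; first by rewrite invf_lt1 ?ltrDr// addr_gt0.
move=> psi; have p0 := rip_ge0 psi.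
have h1 : rip psi psi <= H ^+ 2 * (M * rip psi (Rop k psi)).
  by apply: le_trans (b3 psi) _; rewrite ler_wpM2l ?b2// exprn_ge0// ltW.
have c0 := rip_Ropk_ge0 psi.
rewrite /e -mulrA ler_pdivrMl ?addr_gt0//.
have : M * rip psi psi <= M * (H ^+ 2 * (M * rip psi (Rop k psi))) by rewrite ler_pM2l.
move=> h2; apply: le_trans h2 _; rewrite mulrDl mul1r.
by rewrite ler_wpDr//; rewrite le_eqVlt; apply/orP; left; apply/eqP; ring.
Qed.

End PosOp.

Section LogDerivative.
Variable j : 'I_n.
Local Notation d := (nder j).
Local Notation tau a := ((a : A) 0).

Lemma tau_der (a : A) : tau (d a) = 0.
Proof. by rewrite /= mxE mul0r. Qed.

(** In the algebra [d y] need not commute with [y], so the power rule fails there; under the trace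
    cyclicity restores it. *)
Lemma tau_powS (y : A) a b : tau (y ^+ a * d (y ^+ b.+1)) = b.+1%:R * tau (y ^+ (a + b) * d y).
Proof.
elim: b a => [|b IH] a; first by rewrite expr1 addn0 mul1r.
rewrite exprS nderM mulrDr ncDE tauC// -mulrA -exprD tauC// addnC.
rewrite [X in _ + tau X]mulrA -exprSr IH addSnnS.
by rewrite -[in RHS]natr1 mulrDl mul1r addrC.
Qed.

Lemma tau_pow_der (y : A) m : tau (y ^+ m * d y) = 0.
Proof.
have := tau_powS y 0 m; rewrite expr0 mul1r tau_der add0n => /esym/eqP.
by rewrite mulf_eq0 pnatr_eq0 /= => /eqP.
Qed.

(* k = M (1 - y) with ||y|| < 1, and h (d k) = - (1 + y + y^2 + ...) (d y); the
   powers of y contribute nothing to the trace and the remainder tends to 0. *)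
Lemma tau_log_der : tau (h * d k) = 0.
Proof.
have [M [eps [M0 eps0 eps1 b2 b3]]] := @Ropk_bounds 1.
pose y : A := 1 - (M^-1)%:C *: k; pose g : A := M%:C *: h.
have MM : (M%:C * (M^-1)%:C : R[i]) = 1 by rewrite -rmorphM /= divff ?gt_eqF.
have gy : g = 1 + y * g.
  by rewrite /y /g mulrBl mul1r -ncZAl -ncZAr kh scalerA mulrC MM scale1r addrC subrK.
have ky : k = M%:C *: (1 - y) by rewrite /y opprB addrC subrK scalerA MM scale1r.
have gpow L : g = \sum_(m < L) y ^+ m + y ^+ L * g.
  elim: L => [|L IH]; first by rewrite big_ord0 add0r mul1r.
  rewrite big_ord_recr /= {1}IH -addrA; congr (_ + _).
  by rewrite {1}gy mulrDr mulr1 mulrA exprSr.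
have -> : h * d k = - (g * d y).
  rewrite ky /g linearZ linearB /= nder1 sub0r scalerN mulrN -ncZAl -ncZAr.
  by [].
rewrite ncNE; apply/eqP; rewrite oppr_eq0; apply/eqP/cnorm_le_eps0 => e e0.
pose v := col1 (g * d y).
have [r r01 hr] : exists2 r : R, 0 <= r < 1 & forall psi : sspinor R n 1, rip (Rop y psi) (Rop y psi) <= r * rip psi psi.
  exists (1 - eps) => [|psi]; first by rewrite subr_ge0 ltW//= ltrBlDr ltrDl.
  have -> : Rop y psi = psi + (- M^-1)%:C *: Rop k psi.
    by rewrite /y -scaleN1r scalerA mulN1r addrC Rop_lin Rop1 addrC -rmorphN.
  rewrite rip_quad; have := b2 psi; have := b3 psi.
  set a := rip psi psi; set b := rip psi (Rop k psi); set c := rip (Rop k psi) _ => h1 h2.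
  have h3 : M^-1 ^+ 2 * c <= M^-1 * b.
    by rewrite expr2 -mulrA ler_wpM2l ?invr_ge0 ?(ltW M0)// mulrC ler_pdivrMr// mulrC.
  have h4 : eps * a <= M^-1 * b by rewrite [leRHS]mulrC ler_pdivlMr// mulrAC.
  by rewrite sqrrN; lra.
have [r0 r1] := andP r01.
have bnd L : rip (Rop (y ^+ L) v) (Rop (y ^+ L) v) <= r ^+ L * rip v v.
  elim: L => [|L IH]; first by rewrite !expr0 Rop1 mul1r.
  by rewrite exprSr RopM exprS -mulrA; apply: le_trans (hr _) _; exact: ler_wpM2l.
have tauL L : tau (g * d y) = tau ((g * d y) * y ^+ L).
  rewrite {1}(gpow L) mulrDl ncDE mulr_suml nc_sumE big1 ?add0r => [|i _]; last exact: tau_pow_der.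
  by rewrite -mulrA tauC.
have e2 : 0 < e ^+ 2 by rewrite exprn_gt0.
have [L hL] := expr_small (rip v v) r01 e2.
rewrite (tauL L) -ler_sqr ?nnegrE ?cnorm_ge0 ?(ltW e0)//.
have := rip_ge_part (Rop (y ^+ L) v) 0 0; rewrite Rop_col1 col1E => /le_trans; apply.
by rewrite -Rop_col1; apply: le_trans (bnd L) _; rewrite mulrC.
Qed.

(** The integer powers of [k], with [h] standing for the inverse; by [pw_cases] each of them is a
    power of one of the two generators. *)
Definition pw (w : A) := exists a b, w = k ^+ a * h ^+ b.

Lemma kh_comm : GRing.comm k h.
Proof. by rewrite /GRing.comm kh hk. Qed.

Lemma kh_pow a b : GRing.comm (k ^+ a) (h ^+ b).
Proof. by apply: commrX; apply: commr_sym; apply: commrX; apply: commr_sym; exact: kh_comm. Qed.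

Lemma khX a : k ^+ a * h ^+ a = 1.
Proof. by rewrite -exprMn_comm ?kh ?expr1n//; exact: kh_comm. Qed.

Lemma pw1 : pw 1. Proof. by exists 0, 0; rewrite mulr1. Qed.

Lemma pwk : pw k. Proof. by exists 1, 0; rewrite mulr1 expr1. Qed.

Lemma pwh : pw h. Proof. by exists 0, 1; rewrite mul1r expr1. Qed.

Lemma pwM w v : pw w -> pw v -> pw (w * v).
Proof.
move=> [a [b ->]] [c [e ->]]; exists (a + c)%N, (b + e)%N.
have E : h ^+ b * k ^+ c = k ^+ c * h ^+ b by exact: commr_sym (kh_pow c b).
by rewrite mulrA -(mulrA (k ^+ a)) E mulrA -exprD -mulrA -exprD.
Qed.

Lemma pwX w m : pw w -> pw (w ^+ m).
Proof. by move=> pww; elim: m => [|m IH]; [exact: pw1|rewrite exprS; exact: pwM]. Qed.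

Lemma pw_comm w v : pw w -> pw v -> w * v = v * w.
Proof.
move=> [a [b ->]] [c [e ->]].
have C1 x y : GRing.comm (k ^+ x) (k ^+ y) by rewrite /GRing.comm -!exprD addnC.
have C2 x y : GRing.comm (h ^+ x) (h ^+ y) by rewrite /GRing.comm -!exprD addnC.
apply: commrM; apply: commr_sym; apply: commrM; apply: commr_sym.
- exact: C1.
- exact/commr_sym/kh_pow.
- exact: kh_pow.
- exact: C2.
Qed.

Lemma pw_cases w : pw w -> (exists m, w = k ^+ m) \/ (exists m, w = h ^+ m).
Proof.
move=> [a [b ->]]; have [ab|ba] := leqP a b.
  by right; exists (b - a)%N; rewrite -{1}(subnKC ab) exprD mulrA khX mul1r.
left; exists (a - b)%N; rewrite -{1}(subnK (ltnW ba)) exprD -mulrA khX mulr1.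
by [].
Qed.

Lemma der_inv : d h = - (h * d k * h).
Proof.
have := nderM j k h; rewrite kh nder1 => /esym/eqP; rewrite addr_eq0 => /eqP e.
by rewrite -[d h]mul1r -hk -mulrA -[k * d h]opprK -e mulrN mulrA.
Qed.

(** For exponents other than -1 the expression is, under the trace, a derivative up to a constant
    factor; negative ones reduce to powers of [h] by [d h = - h (d k) h]. The exponent -1 is the
    logarithmic derivative. *)
Lemma tau_pw_k w : pw w -> tau (w * d k) = 0.
Proof.
case/pw_cases => [[m ->]|[[|[|m]] ->]]; first exact: tau_pow_der.
- by rewrite mul1r tau_der.
- by rewrite expr1 tau_log_der.
have -> : h ^+ m.+2 * d k = h * (h ^+ m * (h * d k)) by rewrite exprS exprSr !mulrA.
by rewrite tauC// -mulrA -[h * d k * h]opprK -der_inv mulrN ncNE tau_pow_der oppr0.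
Qed.

Lemma tau_pw w v : pw w -> pw v -> tau (w * d v) = 0.
Proof.
move=> pw_w /pw_cases[[m ->]|[m ->]]; elim: m w pw_w => [|m IH] w pw_w.
- by rewrite expr0 nder1 mulr0.
- rewrite exprS nderM mulrDr ncDE mulrA tauC// mulrA tau_pw_k ?add0r; last exact: pwM (pwX _ pwk) pw_w.
  by rewrite mulrA IH//; exact: pwM pw_w pwk.
- by rewrite expr0 nder1 mulr0.
- rewrite exprS nderM mulrDr ncDE mulrA tauC// der_inv !mulrN ncNE.
  rewrite [X in - tau X](_ : _ = h ^+ m * w * h * d k * h); last by rewrite !mulrA.
  rewrite tauC// !mulrA tau_pw_k ?oppr0 ?add0r; last first.
    by apply: pwM pwh; apply: pwM pw_w; rewrite -exprS; exact: pwX pwh.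
  by rewrite IH//; exact: pwM pw_w pwh.
Qed.

End LogDerivative.
End Positivity.

(** * Taylor expansion of symbols *)

Section TaylorReal.
Context {R : realType} {n : nat}.
Implicit Types (F : 'rV[R]_n -> R) (x y xi : 'rV[R]_n).

Lemma line_is_derive F xi y s : differentiable F (xi + s *: y) ->
  is_derive s (1 : R) (fun r : R => F (xi + r *: y)) ('D_y F (xi + s *: y)).
Proof.
move=> dF.
have E : (fun r : R => r^-1 *: (((fun r : R => F (xi + r *: y)) \o shift s) (r *: 1) - F (xi + s *: y))) =
         (fun r : R => r^-1 *: ((F \o shift (xi + s *: y)) (r *: y) - F (xi + s *: y))).
  apply/funext => r /=; congr (_ *: (F _ - _)).
  have -> : r%:A = r :> R by exact: mulr1.
  by rewrite scalerDl addrCA.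
apply: DeriveDef; last by rewrite /derive E.
by rewrite /derivable E; exact: diff_derivable.
Qed.

Lemma derive_coord F a y : differentiable F a ->
  'D_y F a = \sum_l y 0 l * 'D_(delta_mx 0 l) F a.
Proof.
move=> dF; rewrite deriveE// {1}[y]row_sum_delta linear_sum; apply: eq_bigr => l _.
by rewrite linearZ /= deriveE.
Qed.

Lemma MVT01 (g dg : R -> R) : (forall s : R, 0 <= s <= 1 -> is_derive s (1 : R) g (dg s)) ->
  forall a : R, 0 < a <= 1 -> exists2 c, 0 < c < a & g a - g 0 = dg c * a.
Proof.
move=> gd a /andP[a0 a1].
have [||c] := @MVT _ g dg 0 a a0.
- move=> s; rewrite in_itv /= => /andP[s0 sa]; apply: gd; rewrite (ltW s0)/= ltW//.
  exact: lt_le_trans a1.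
- apply: derivable_within_continuous => s; rewrite in_itv /= => /andP[s0 sa].
  by have := gd s; rewrite s0 (le_trans sa a1) => /(_ isT) [].
by rewrite in_itv /= subr0 => hc e; exists c.
Qed.

(** The mean value theorem is applied twice along the segment, to [g] at some [c] and then to its
    derivative on the interval from 0 to [c]; the remainder is [g2 c' * c] with [c < 1]. *)
Lemma taylor_real F (F1 : 'I_n -> 'rV[R]_n -> R) xi y (B : R) :
  (forall s : R, 0 <= s <= 1 -> differentiable F (xi + s *: y)) ->
  (forall l eta, F1 l eta = 'D_(delta_mx 0 l) F eta) ->
  (forall l (s : R), 0 <= s <= 1 -> differentiable (F1 l) (xi + s *: y)) ->
  (forall l m (s : R), 0 <= s <= 1 -> `|'D_(delta_mx 0 m) (F1 l) (xi + s *: y)| <= B) ->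
  `|F (xi + y) - F xi - \sum_l y 0 l * F1 l xi| <= B * (\sum_l `|y 0 l|) ^+ 2.
Proof.
move=> dF hF1 dF1 hB.
pose g s := F (xi + s *: y); pose g1 s := \sum_l y 0 l * F1 l (xi + s *: y).
pose g2 s := \sum_l y 0 l * 'D_y (F1 l) (xi + s *: y).
have gd (s : R) : 0 <= s <= 1 -> is_derive s (1 : R) g (g1 s).
  move=> hs; have := line_is_derive (dF s hs); rewrite (derive_coord y (dF s hs)).
  by rewrite /g1; under [X in _ -> is_derive _ _ _ X]eq_bigr do rewrite hF1.
have g1d (s : R) : 0 <= s <= 1 -> is_derive s (1 : R) g1 (g2 s).
  move=> hs; rewrite /g1 /g2.
  have -> : (fun s => \sum_l y 0 l * F1 l (xi + s *: y)) = \sum_l (fun s => y 0 l *: F1 l (xi + s *: y)).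
    by apply/funext => r; rewrite fct_sumE.
  apply: is_derive_sum => l; apply: is_deriveZ; exact: line_is_derive (dF1 l s hs).
have [|c /andP[c0 c1] e1] := MVT01 gd (a := 1); first by rewrite ltr01 lexx.
have [|c' /andP[c'0 c'1] e2] := MVT01 g1d (a := c); first by rewrite c0 ltW.
have -> : F (xi + y) - F xi - \sum_l y 0 l * F1 l xi = g2 c' * c.
  rewrite -e2; have := e1; rewrite /g scale1r scale0r addr0 mulr1 => ->.
  by congr (_ - _); rewrite /g1; apply: eq_bigr => l _; rewrite scale0r addr0.
have hc' : 0 <= c' <= 1 by rewrite (ltW c'0)/= ltW// (lt_trans c'1).
have B0 : 0 <= B \/ (forall l : 'I_n, False).
  have [|] := ltP B 0; last by left.
  by move=> Bn; right => l; have := hB l l _ hc'; rewrite leNgt (lt_le_trans Bn).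
rewrite normrM (gtr0_norm c0); apply: (@le_trans _ _ `|g2 c'|); first by rewrite ler_piMr// ltW.
apply: le_trans (ler_norm_sum _ _ _) _; rewrite expr2 mulrA mulr_sumr.
apply: ler_sum => l _; rewrite normrM mulrC ler_wpM2r//.
rewrite (derive_coord y (dF1 l c' hc')); apply: le_trans (ler_norm_sum _ _ _) _.
rewrite mulr_sumr; apply: ler_sum => m _; rewrite normrM mulrC ler_wpM2r//.
exact: hB.
Qed.

End TaylorReal.

Section ExprzBounds.
Context {R : realType}.

Lemma exprz_abs (a b : R) (z : int) : 1 <= a -> a <= b -> a ^ z <= b ^+ `|z|%N.
Proof.
move=> a1 ab; have a0 : 0 < a by exact: lt_le_trans a1.
case: z => m /=; first by rewrite lerXn2r ?nnegrE ?(ltW a0) ?(le_trans (ltW a0) ab).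
apply: (@le_trans _ _ 1); last by rewrite exprn_ege1// (le_trans a1).
by rewrite NegzE -exprnN invf_le1 ?exprn_gt0 ?exprn_ege1.
Qed.

Lemma exprz_le (a : R) (z z' : int) : 1 <= a -> z <= z' -> a ^ z <= a ^ z'.
Proof. by move=> a1 zz'; rewrite ler_weXz2l. Qed.

(** Nonnegative exponents use the first comparison of [a] with [t], negative ones the second. *)
Lemma peetre_z (D a t y : R) (z : int) : 1 <= D -> 1 <= a -> 1 <= t -> 1 <= y ->
  a <= D * t * y -> t <= D * a * y -> a ^ z <= D ^+ `|z|%N * t ^ z * y ^+ `|z|%N.
Proof.
move=> D1 a1 t1 y1 h1 h2.
have [D0 a0 t0 y0] : [/\ 0 < D, 0 < a, 0 < t & 0 < y] by split; exact: lt_le_trans ltr01 _.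
case: z => m /=.
  have := lerXn2r m (ltW a0 : a \in Num.nneg) (ltW (lt_le_trans a0 h1) : D * t * y \in Num.nneg) h1.
  by rewrite !exprMn.
rewrite NegzE -!exprnN -(ler_pM2l (exprn_gt0 m.+1 a0)) mulfV ?expf_neq0 ?gt_eqF//.
rewrite -(ler_pM2l (exprn_gt0 m.+1 t0)) mulr1.
have -> : t ^+ m.+1 * (a ^+ m.+1 * (D ^+ m.+1 / t ^+ m.+1 * y ^+ m.+1)) = (D * a * y) ^+ m.+1.
  by rewrite !exprMn; field; rewrite expf_neq0// gt_eqF.
exact: (lerXn2r m.+1 (ltW t0 : t \in Num.nneg) (ltW (lt_le_trans t0 h2) : D * a * y \in Num.nneg) h2).
Qed.

End ExprzBounds.

Section Symbols.
Context {R : realType} {n N : nat}.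
Variable theta : 'M[R]_n.
Local Notation Z := 'rV[int]_n.
Local Notation op := (@operator R n N).

Definition ent (X : op) (p q : Z) (i j : 'I_N) : R[i] := X (spin_basis q j) p i 0.

Lemma sum_coord_le (y : 'rV[R]_n) : \sum_l `|y 0 l| <= n%:R * enorm y.
Proof.
rewrite -[X in X%:R]card_ord mulr_natl -sumr_const; apply: ler_sum => l _; exact: coord_le_enorm.
Qed.

(** The symbol estimates hold on [1 <= |eta|] only; [2 <= |xi|] and [|y| <= |xi| / 2] keep the whole
    segment in that region. The weight in [p - q] passes through since the estimates already contain
    it. *)
Lemma homogeneous_near (e : int) (h : 'rV[R]_n -> op) (xi : 'rV[R]_n) :
  homogeneous theta e h -> 2 <= enorm xi ->
  forall K, exists2 C : R, 0 <= C & forall y p q i j, enorm y <= enorm xi / 2 ->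
    cnorm (ent (h (xi + y)) p q i j - ent (h xi) p q i j
           - \sum_l (y 0 l)%:C * ent (dxi l h xi) p q i j) * wt (p - q) ^+ K <= C * enorm y ^+ 2.
Proof.
move=> [hs hb _] xi2 K.
have /choice[C hC] (lm : 'I_n * 'I_n) := hb [:: lm.2; lm.1] K.
pose C1 := \sum_lm `|C lm|; have C10 : 0 <= C1 by exact: sumr_ge0.
(* Bounds all second derivatives on the segment, where [|eta| <= 2 |xi|]; the absolute value of the
   exponent serves both signs of [e - 2]. *)
pose D : R := C1 * (1 + 2 * enorm xi) ^+ `|e - 2|%N.
have D0 : 0 <= D by rewrite mulr_ge0// exprn_ge0// addr_ge0// mulr_ge0 ?enorm_ge0.
exists (2 * (D * n%:R ^+ 2)) => [|y p q i j hy]; first by rewrite mulr_ge0// mulr_ge0// exprn_ge0.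
pose w : R := wt (p - q) ^+ K; have w0 : 0 < w by exact: wtX_gt0.
have seg (s : R) : 0 <= s <= 1 -> 1 <= enorm (xi + s *: y) <= 2 * enorm xi.
  move=> /andP[s0 s1].
  have sy : enorm (s *: y) <= enorm xi / 2.
    by rewrite enormZ ger0_norm//; apply: le_trans hy; rewrite ler_piMl ?enorm_ge0.
  apply/andP; split; last by apply: le_trans (enormD _ _) _; lra.
  have := enormD (xi + s *: y) (- (s *: y)); rewrite addrK enormN; lra.
have seg0 (s : R) : 0 <= s <= 1 -> xi + s *: y != 0.
  by move=> /seg /andP[h1 _]; rewrite -enorm_gt0; exact: lt_le_trans h1.
have sb := @smooth_basis R n N q j.
have bnd l m (s : R) : 0 <= s <= 1 ->
   cnorm (dxis [:: m; l] h (xi + s *: y) (spin_basis q j) p i 0) <= D / w.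
  move=> hs01; have /andP[s1 s2] := seg s hs01.
  rewrite ler_pdivlMr//; have := hC (l, m) _ s1 p q i j; move/le_trans; apply.
  have p0 : 0 <= 1 + enorm (xi + s *: y) by rewrite addr_ge0 ?enorm_ge0.
  apply: (@le_trans _ _ (C1 * (1 + enorm (xi + s *: y)) ^ (e - 2))).
    rewrite ler_wpM2r ?exprz_ge0//; apply: le_trans (ler_norm _) _.
    by rewrite /C1 (bigD1 (l, m))//= lerDl sumr_ge0.
  by rewrite ler_wpM2l// exprz_abs ?lerDl ?enorm_ge0// lerD2l.
have Dw : 0 <= D / w by rewrite divr_ge0// ltW.
have fin : D / w * (\sum_l `|y 0 l|) ^+ 2 <= D / w * (n%:R ^+ 2 * enorm y ^+ 2).
  rewrite ler_wpM2l// -exprMn lerXn2r ?nnegrE ?sumr_ge0 ?mulr_ge0 ?enorm_ge0//.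
  exact: sum_coord_le.
rewrite -[leRHS](divfK (lt0r_neq0 w0)) ler_wpM2r ?(ltW w0)//.
apply: le_trans (cnorm_le_ReIm _) _.
have -> : 2 * (D * n%:R ^+ 2) * enorm y ^+ 2 / w = D / w * (n%:R ^+ 2 * enorm y ^+ 2) + D / w * (n%:R ^+ 2 * enorm y ^+ 2).
  by ring.
have ReE (X : 'I_n -> R[i]) : complex.Re (\sum_l (y 0 l)%:C * X l) = \sum_l y 0 l * complex.Re (X l).
  by rewrite Re_sum; apply: eq_bigr => l _; rewrite ReMr.
have ImE (X : 'I_n -> R[i]) : complex.Im (\sum_l (y 0 l)%:C * X l) = \sum_l y 0 l * complex.Im (X l).
  by rewrite Im_sum; apply: eq_bigr => l _; rewrite ImMr.
rewrite !ReD !ReN !ImD !ImN ReE ImE; apply: lerD; apply: le_trans fin.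
- apply: (@taylor_real _ _ (fun eta => complex.Re (ent (h eta) p q i j))
    (fun l eta => complex.Re (ent (dxi l h eta) p q i j))) => [s hs01|l eta|l s hs01|l m s hs01].
  + by have [_ /(_ _ sb p i)[]] := hs [::] _ (seg0 s hs01).
  + by rewrite /ent mxE.
  + by have [_ /(_ _ sb p i)[]] := hs [:: l] _ (seg0 s hs01).
  + by apply: le_trans (bnd l m s hs01); apply: le_trans (Re_le_cnorm _); rewrite mxE.
- apply: (@taylor_real _ _ (fun eta => complex.Im (ent (h eta) p q i j))
    (fun l eta => complex.Im (ent (dxi l h eta) p q i j))) => [s hs01|l eta|l s hs01|l m s hs01].
  + by have [_ /(_ _ sb p i)[]] := hs [::] _ (seg0 s hs01).
  + by rewrite /ent mxE.
  + by have [_ /(_ _ sb p i)[]] := hs [:: l] _ (seg0 s hs01).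
  + by apply: le_trans (bnd l m s hs01); apply: le_trans (Im_le_cnorm _); rewrite mxE.
Qed.

Lemma peetre_line (t : R) (xi x : 'rV[R]_n) : 1 <= t -> 1 <= enorm xi ->
  1 + enorm (t *: xi + x) <= (1 + enorm xi) * t * (1 + enorm x) /\
  t <= (1 + enorm xi) * (1 + enorm (t *: xi + x)) * (1 + enorm x).
Proof.
move=> t1 xi1; have t0 : 0 < t by exact: lt_le_trans t1.
have := enormD (t *: xi) x; have := enormD (t *: xi + x) (- x).
rewrite addrK enormN enormZ (gtr0_norm t0).
have := enorm_ge0 (t *: xi + x); have := enorm_ge0 x.
move: (enorm _) (enorm _) (enorm _) xi1 => a b u u1 a0 b0 h1 h2.
have e1 : 0 <= (t - 1) * (1 + b) by rewrite mulr_ge0 ?subr_ge0 ?addr_ge0.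
have e2 : 0 <= u * t * b by rewrite !mulr_ge0 ?(ltW t0)// (le_trans ler01).
have e3 : t <= t * u by rewrite ler_pMr.
have e4 : 0 <= b * a by rewrite mulr_ge0.
have e5 : 0 <= u * ((1 + b) * (1 + a)) by rewrite !mulr_ge0 ?addr_ge0// (le_trans ler01).
split; lra.
Qed.

(* A lattice point [t xi + x] is compared with [t xi] by Taylor's formula when
   [x] is small against [t xi], and trivially, using [t <= 1 + |x|], otherwise. *)
Lemma homogeneous_taylor (e : int) (h : 'rV[R]_n -> op) (xi : 'rV[R]_n) :
  homogeneous theta e h -> 2 <= enorm xi ->
  exists L, forall K, exists2 C : R, 0 <= C & forall (t : R) x p q i j, 1 <= t -> 1 <= enorm (t *: xi + x) ->
    cnorm (ent (h (t *: xi + x)) p q i j - (t ^ e)%:C * ent (h xi) p q i j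
           - (t ^ (e - 1))%:C * \sum_l (x 0 l)%:C * ent (dxi l h xi) p q i j) * wt (p - q) ^+ K
    <= C * (t ^ (e - 2) * (1 + enorm x) ^+ L).
Proof.
move=> hh xi2; exists (`|e|%N + 2)%N => K.
have [C1 C10 near] := homogeneous_near hh xi2 K; have [hs hb hom] := hh.
have [C hC] := hb [::] K; have /choice[C' hC'] l := hb [:: l] K.
have xi1 : 1 <= enorm xi by apply: le_trans xi2; rewrite ler1n.
pose D : R := 1 + enorm xi; have D1 : 1 <= D by rewrite lerDl enorm_ge0.
pose E0 : R := `|C| * D ^+ `|e|%N; pose E1 : R := \sum_l `|C' l| * D ^+ `|e - 1|%N.
have E00 : 0 <= E0 by rewrite mulr_ge0// exprn_ge0// addr_ge0 ?enorm_ge0.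
have E10 : 0 <= E1 by apply: sumr_ge0 => l _; rewrite mulr_ge0// exprn_ge0// addr_ge0 ?enorm_ge0.
exists (C1 + (E0 + E0 + E1)) => [|t x p q i j t1 tx1]; first by rewrite !addr_ge0.
pose w : R := wt (p - q) ^+ K; have w0 : 0 < w by exact: wtX_gt0.
have t0 : 0 < t by exact: lt_le_trans t1.
pose Y : R := 1 + enorm x; have Y1 : 1 <= Y by rewrite lerDl enorm_ge0.
have Y0 : 0 < Y by exact: lt_le_trans Y1.
have te2 : 0 <= t ^ (e - 2) by rewrite exprz_ge0// ltW.
have [hx|hx] := leP (enorm (t^-1 *: x)) (enorm xi / 2).
  have -> : t *: xi + x = t *: (xi + t^-1 *: x) by rewrite scalerDr scalerA divff ?gt_eqF// scale1r.
  have xn0 : xi + t^-1 *: x != 0.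
    rewrite -enorm_gt0; have := enormD (xi + t^-1 *: x) (- (t^-1 *: x)); rewrite addrK enormN.
    by move: hx xi1; lra.
  have -> : ent (h (t *: (xi + t^-1 *: x))) p q i j = (t ^ e)%:C * ent (h (xi + t^-1 *: x)) p q i j.
    by rewrite /ent (hom _ _ _ t0 xn0 (@smooth_basis R n N q j)) mxE.
  have te1 : t ^ (e - 1) = t ^ e * t^-1 by rewrite expfzDr ?gt_eqF.
  rewrite te1 rmorphM /= -mulrA mulr_sumr -!mulrBr cnormM cnorm_real ger0_norm ?exprz_ge0 ?(ltW t0)//.
  have := near (t^-1 *: x) p q i j hx; rewrite -/w.
  under [X in cnorm (_ - X)]eq_bigr do rewrite mxE rmorphM /= -mulrA.
  rewrite enormZ => hn; rewrite -mulrA; apply: le_trans (ler_wpM2l (exprz_ge0 _ (ltW t0)) hn) _.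
  rewrite ger0_norm ?invr_ge0 ?(ltW t0)// exprMn.
  have -> : t ^ e * (C1 * (t^-1 ^+ 2 * enorm x ^+ 2)) = C1 * (t ^ (e - 2) * enorm x ^+ 2).
    by rewrite expfzDr ?gt_eqF// -[-2]/(- 2%:Z) -exprnN exprVn; ring.
  apply: ler_pM; rewrite ?mulr_ge0 ?exprn_ge0 ?enorm_ge0// ?lerDl ?addr_ge0//.
  rewrite ler_wpM2l//; apply: (@le_trans _ _ (Y ^+ 2)).
    by rewrite lerXn2r ?nnegrE ?enorm_ge0 ?(ltW Y0)// lerDr.
  by rewrite ler_weXn2l// leq_addl.
have tY : t <= Y.
  move: hx; rewrite enormZ ger0_norm ?invr_ge0 ?(ltW t0)// [ltRHS]mulrC ltr_pdivlMr//.
  rewrite /Y; have := ler_wpM2r (ltW t0) xi2; lra.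
have Yle a b : (a <= b)%N -> Y ^+ a <= Y ^+ b by move=> ab; rewrite ler_weXn2l.
have tee : t ^ e <= t ^ (e - 2) * Y ^+ 2.
  have -> : t ^ e = t ^ (e - 2) * t ^+ 2 by rewrite -[t ^+ 2]/(t ^ 2) -expfzDr ?gt_eqF// subrK.
  by rewrite ler_wpM2l// lerXn2r ?nnegrE ?(ltW t0) ?(ltW Y0).
have te1 : t ^ (e - 1) * Y <= t ^ (e - 2) * Y ^+ 2.
  have -> : t ^ (e - 1) = t ^ (e - 2) * t.
    by rewrite -[X in _ * X]/(t ^ 1) -expfzDr ?gt_eqF// -addrA.
  by rewrite -mulrA ler_wpM2l// expr2 ler_wpM2r ?(ltW Y0).
rewrite -[leRHS](divfK (lt0r_neq0 w0)) ler_wpM2r ?(ltW w0)//.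
have b1 : cnorm (ent (h (t *: xi + x)) p q i j) <= E0 * (t ^ (e - 2) * Y ^+ (`|e| + 2)) / w.
  rewrite ler_pdivlMr//; apply: le_trans (hC _ tx1 p q i j) _.
  rewrite /= subr0; have a1 : 1 <= 1 + enorm (t *: xi + x) by rewrite lerDl enorm_ge0.
  have p1 : 1 + enorm (t *: xi + x) <= D * t * Y.
    by have [] := @peetre_line t xi x t1 xi1.
  have p2 : t <= D * (1 + enorm (t *: xi + x)) * Y.
    apply: le_trans tY _; rewrite -[leLHS]mul1r ler_wpM2r ?(ltW Y0)//.
    exact: mulr_ege1.
  have := peetre_z e D1 a1 t1 Y1 p1 p2 => hp.
  apply: (@le_trans _ _ (`|C| * (D ^+ `|e| * t ^ e * Y ^+ `|e|))).
    apply: le_trans (ler_wpM2l (normr_ge0 C) hp).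
    by rewrite ler_wpM2r ?ler_norm// exprz_ge0// addr_ge0 ?enorm_ge0.
  rewrite /E0 -!mulrA !ler_wpM2l// ?exprn_ge0 ?addr_ge0 ?enorm_ge0//.
  rewrite [(`|e| + 2)%N]addnC exprD mulrA.
  by apply: ler_wpM2r; rewrite ?exprn_ge0 ?(ltW Y0).
have b2 : cnorm ((t ^ e)%:C * ent (h xi) p q i j) <= E0 * (t ^ (e - 2) * Y ^+ (`|e| + 2)) / w.
  rewrite cnormM cnorm_real ger0_norm ?exprz_ge0 ?(ltW t0)//.
  have : cnorm (ent (h xi) p q i j) <= E0 / w.
    rewrite ler_pdivlMr//; apply: le_trans (hC _ xi1 p q i j) _; rewrite /= subr0.
    apply: le_trans (ler_wpM2l (normr_ge0 C) (exprz_abs e D1 (lexx D))).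
    by rewrite ler_wpM2r ?ler_norm// exprz_ge0// addr_ge0 ?enorm_ge0.
  have teG : t ^ e <= t ^ (e - 2) * Y ^+ (`|e| + 2).
    by apply: le_trans tee _; rewrite ler_wpM2l//; apply: Yle; exact: leq_addl.
  move=> hc; apply: le_trans (ler_pM (exprz_ge0 _ (ltW t0)) (cnorm_ge0 _) teG hc) _.
  by rewrite mulrC mulrAC.
have b3 : cnorm ((t ^ (e - 1))%:C * \sum_l (x 0 l)%:C * ent (dxi l h xi) p q i j)
    <= E1 * (t ^ (e - 2) * Y ^+ (`|e| + 2)) / w.
  rewrite cnormM cnorm_real ger0_norm ?exprz_ge0 ?(ltW t0)//.
  have : cnorm (\sum_l (x 0 l)%:C * ent (dxi l h xi) p q i j) <= Y * (E1 / w).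
    apply: le_trans (cnorm_sum _ _ _) _; rewrite /E1 mulr_suml mulr_sumr; apply: ler_sum => l _.
    rewrite cnormM cnorm_real; apply: ler_pM; rewrite ?cnorm_ge0//.
      by apply: le_trans (coord_le_enorm x l) _; rewrite lerDr.
    rewrite ler_pdivlMr//; apply: le_trans (hC' l _ xi1 p q i j) _ => /=.
    apply: le_trans (ler_wpM2l (normr_ge0 (C' l)) (exprz_abs (e - 1) D1 (lexx D))).
    by rewrite ler_wpM2r ?ler_norm// exprz_ge0// addr_ge0 ?enorm_ge0.
  move=> hc; apply: le_trans (ler_wpM2l (exprz_ge0 _ (ltW t0)) hc) _.
  rewrite [leLHS]mulrA; apply: le_trans (ler_wpM2r _ te1) _; first by rewrite divr_ge0 ?(ltW w0).
  have -> : E1 * (t ^ (e - 2) * Y ^+ (`|e| + 2)) / w = t ^ (e - 2) * Y ^+ (`|e| + 2) * (E1 / w) by ring.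
  rewrite ler_wpM2r ?divr_ge0 ?(ltW w0)// ler_wpM2l//; apply: Yle; exact: leq_addl.
have c1 : 0 <= C1 * (t ^ (e - 2) * Y ^+ (`|e| + 2)) / w.
  by rewrite !mulr_ge0 ?invr_ge0 ?(ltW w0) ?exprn_ge0 ?(ltW Y0).
have -> : (C1 + (E0 + E0 + E1)) * (t ^ (e - 2) * (1 + enorm x) ^+ (`|e| + 2)) / w =
  C1 * (t ^ (e - 2) * Y ^+ (`|e| + 2)) / w + (E0 * (t ^ (e - 2) * Y ^+ (`|e| + 2)) / w +
  E0 * (t ^ (e - 2) * Y ^+ (`|e| + 2)) / w + E1 * (t ^ (e - 2) * Y ^+ (`|e| + 2)) / w).
  by rewrite /Y; ring.
apply: ler_wpDl => //; apply: le_trans (cnormB _ _) _; apply: lerD => //.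
by apply: le_trans (cnormB _ _) _; apply: lerD.
Qed.

Lemma homogeneous_bound (e : int) (h : 'rV[R]_n -> op) (xi : 'rV[R]_n) K :
  homogeneous theta e h -> 1 <= enorm xi ->
  exists2 C : R, 0 <= C & forall p q i j, cnorm (ent (h xi) p q i j) * wt (p - q) ^+ K <= C.
Proof.
move=> [_ hb _] xi1; have [C hC] := hb [::] K.
exists `|C * (1 + enorm xi) ^ e| => // p q i j.
by apply: le_trans (ler_norm _); have := hC _ xi1 p q i j; rewrite /= subr0.
Qed.

Lemma homogeneous_dbound (e : int) (h : 'rV[R]_n -> op) (xi : 'rV[R]_n) K :
  homogeneous theta e h -> 1 <= enorm xi ->
  exists2 C : R, 0 <= C & forall (x : 'rV[R]_n) p q i j,
    cnorm (\sum_l (x 0 l)%:C * ent (dxi l h xi) p q i j) * wt (p - q) ^+ K <= C * (1 + enorm x).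
Proof.
move=> [_ hb _] xi1; have /choice[C hC] l := hb [:: l] K.
exists (\sum_l `|C l * (1 + enorm xi) ^ (e - 1)|) => [|x p q i j]; first exact: sumr_ge0.
apply: le_trans (ler_wpM2r (wtX_ge0 _ _) (cnorm_sum _ _ _)) _.
rewrite !mulr_suml; apply: ler_sum => l _; rewrite cnormM cnorm_real -mulrA mulrC.
apply: ler_pM; rewrite ?mulr_ge0 ?cnorm_ge0 ?wtX_ge0//.
  by apply: le_trans (ler_norm _); exact: (hC l _ xi1 p q i j).
by apply: le_trans (coord_le_enorm x l) _; rewrite lerDr.
Qed.

Lemma homogeneous_taylor0 (e : int) (h : 'rV[R]_n -> op) (xi : 'rV[R]_n) :
  homogeneous theta e h -> 2 <= enorm xi ->
  exists L, forall K, exists2 C : R, 0 <= C & forall (t : R) x p q i j, 1 <= t -> 1 <= enorm (t *: xi + x) ->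
    cnorm (ent (h (t *: xi + x)) p q i j - (t ^ e)%:C * ent (h xi) p q i j) * wt (p - q) ^+ K
    <= C * (t ^ (e - 1) * (1 + enorm x) ^+ L).
Proof.
move=> hh xi2; have [L hL] := homogeneous_taylor hh xi2; exists L.+1 => K.
have xi1 : 1 <= enorm xi by apply: le_trans xi2; rewrite ler1n.
have [C C0 hC] := hL K; have [B B0 hB] := homogeneous_dbound K hh xi1.
exists (C + B) => [|t x p q i j t1 tx1]; first exact: addr_ge0.
have t0 : 0 < t by exact: lt_le_trans t1.
have Y1 : 1 <= 1 + enorm x by rewrite lerDl enorm_ge0.
have := hC t x p q i j t1 tx1; set u := _ - _ * ent _ _ _ _ _; set v := _ * \sum_l _ => h1.
have h2 : cnorm v * wt (p - q) ^+ K <= B * (t ^ (e - 1) * (1 + enorm x) ^+ L.+1).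
  rewrite /v cnormM cnorm_real ger0_norm ?exprz_ge0 ?(ltW t0)// -mulrA.
  apply: le_trans (ler_wpM2l (exprz_ge0 _ (ltW t0)) (hB x p q i j)) _.
  rewrite mulrCA ler_wpM2l// ler_wpM2l ?exprz_ge0 ?(ltW t0)//.
  by rewrite -[leLHS]expr1 ler_weXn2l.
have -> : u = (u - v) + v by rewrite subrK.
apply: le_trans (ler_wpM2r (wtX_ge0 _ _) (cnormD _ _)) _; rewrite !mulrDl; apply: lerD => //.
apply: le_trans h1 _; rewrite ler_wpM2l// ler_pM ?exprz_ge0 ?exprn_ge0 ?(ltW t0) ?(le_trans ler01 Y1)//.
  by apply: exprz_le => //; rewrite lerD2l.
by rewrite ler_weXn2l.
Qed.

Section Expansion.
Variables (d : int) (s : int -> 'rV[R]_n -> op) (rho : 'rV[R]_n -> op) (e : int).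
Hypothesis rho_bd : symbol_bound d 0 rho.
Hypothesis s_hom : forall e, homogeneous theta e (s e).
Hypothesis s_hi : forall e' (eta : 'rV[R]_n), d < e' -> eta != 0 -> op_eq (s e' eta) (fun _ _ => 0).
Hypothesis rho_asym : forall J : nat, symbol_bound (d - J%:Z) 1
   (fun xi psi p => rho xi psi p - \sum_(m < J) s (d - m%:Z) xi psi p).
Hypothesis s_top : forall e' (eta : 'rV[R]_n), e < e' -> eta != 0 -> op_eq (s e' eta) (fun _ _ => 0).

Lemma ent_null (X : op) p q i j : op_eq X (fun _ _ => 0) -> ent X p q i j = 0.
Proof. by move=> h; rewrite /ent h ?mxE//; exact: smooth_basis. Qed.

(** The order [e] may differ from the nominal order [d], because the descent to the true order of P
    starts from an arbitrary [d]. Components between [e] and [d] vanish by [s_top]. *)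
Lemma symbol_two_terms K : exists2 C : R, 0 <= C & forall eta p q i j, 1 <= enorm eta ->
  cnorm (ent (rho eta) p q i j - ent (s e eta) p q i j - ent (s (e - 1) eta) p q i j) * wt (p - q) ^+ K
  <= C * (1 + enorm eta) ^ (e - 2).
Proof.
(* The asymptotic sum must reach order [e - 1]: this takes [d - e + 2] terms if [e <= d], one term
   if [d = e - 1], and none below. *)
have main J : d - J%:Z <= e - 2 ->
   (forall eta p q i j, eta != 0 -> \sum_(m < J) ent (s (d - m%:Z) eta) p q i j =
      ent (s e eta) p q i j + ent (s (e - 1) eta) p q i j) ->
   exists2 C : R, 0 <= C & forall eta p q i j, 1 <= enorm eta ->
  cnorm (ent (rho eta) p q i j - ent (s e eta) p q i j - ent (s (e - 1) eta) p q i j) * wt (p - q) ^+ K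
  <= C * (1 + enorm eta) ^ (e - 2).
  move=> dJ sumE; have [C hC] := rho_asym J [::] K.
  exists `|C| => // eta p q i j eta1.
  have eta0 : eta != 0 by rewrite -enorm_gt0; exact: lt_le_trans eta1.
  have sE : \sum_(m < J) s (d - m%:Z) eta (spin_basis q j) p i 0 =
      ent (s e eta) p q i j + ent (s (e - 1) eta) p q i j by exact: sumE.
  have := hC _ eta1 p q i j; rewrite /= subr0 !mxE summxE sE.
  rewrite opprD addrA => h1; apply: le_trans h1 _.
  have a1 : 1 <= 1 + enorm eta by rewrite lerDl enorm_ge0.
  apply: (@le_trans _ _ (`|C| * (1 + enorm eta) ^ (d - J%:Z))).
    by rewrite ler_wpM2r ?ler_norm// exprz_ge0// (le_trans ler01).
  by rewrite ler_wpM2l// exprz_le.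
have [ed|de] := leP e d.
  have [k hk] : exists k : nat, d = e + k%:Z by exists `|d - e|%N; rewrite gez0_abs ?subr_ge0// subrKC.
  apply: (main k.+2) => [|eta p q i j eta0]; first by rewrite hk; lia.
  rewrite !big_ord_recr /= big1 ?add0r => [|m _]; last first.
    by apply: ent_null; apply: s_top => //; rewrite hk; case: m => m /= mk; lia.
  have -> : d - k%:Z = e by rewrite hk addrK.
  by have -> : d - k.+1%:Z = e - 1 by rewrite hk; lia.
have se eta p q i j : eta != 0 -> ent (s e eta) p q i j = 0 by move=> h; apply: ent_null; apply: s_hi.
have [d1|d1] := eqVneq d (e - 1).
  apply: (main 1%N) => [|eta p q i j eta0]; first by lia.
  by rewrite big_ord_recr big_ord0 /= add0r subr0 se// add0r d1.
apply: (main 0%N) => [|eta p q i j eta0]; first by lia.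
rewrite big_ord0 se// add0r ent_null//; apply: s_hi => //; lia.
Qed.

(** Off the origin the homogeneous components [e] and [e - 1] are expanded to first and zeroth
    order. At the origin they are not controlled, but there [|x| = t |xi|], so powers of [1 + |x|]
    absorb every term separately. *)
Lemma symbol_taylor (xi : 'rV[R]_n) : 2 <= enorm xi ->
  exists L, forall K, exists2 C : R, 0 <= C & forall (t : R) x p q i j, 1 <= t ->
    t *: xi + x = 0 \/ 1 <= enorm (t *: xi + x) ->
    cnorm (ent (rho (t *: xi + x)) p q i j - (t ^ e)%:C * ent (s e xi) p q i j
           - (t ^ (e - 1))%:C * (ent (s (e - 1) xi) p q i j + \sum_l (x 0 l)%:C * ent (dxi l (s e) xi) p q i j))
      * wt (p - q) ^+ K
    <= C * (t ^ (e - 2) * (1 + enorm x) ^+ L).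
Proof.
move=> xi2; have xi1 : 1 <= enorm xi by apply: le_trans xi2; rewrite ler1n.
have [L1 hL1] := homogeneous_taylor (s_hom e) xi2.
have [L2 hL2] := homogeneous_taylor0 (s_hom (e - 1)) xi2.
pose M := `|e - 2|%N; exists (maxn (maxn L1 L2) (maxn M 2)) => K.
set L := maxn _ _.
have [C1 C10 h1] := hL1 K; have [C2 C20 h2] := hL2 K; have [C3 C30 h3] := symbol_two_terms K.
have [C4 h4] := rho_bd [::] K.
have [C5 C50 h5] := homogeneous_bound K (s_hom e) xi1.
have [C6 C60 h6] := homogeneous_bound K (s_hom (e - 1)) xi1.
have [C7 C70 h7] := homogeneous_dbound K (s_hom e) xi1.
pose D : R := 1 + enorm xi; have D1 : 1 <= D by rewrite lerDl enorm_ge0.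
pose C8 := C3 * D ^+ M; have C80 : 0 <= C8 by rewrite mulr_ge0// exprn_ge0// (le_trans ler01).
exists (C1 + C2 + C8 + (`|C4| + C5 + (C6 + C7))) => [|t x p q i j t1 cas]; first by rewrite !addr_ge0.
have t0 : 0 < t by exact: lt_le_trans t1.
pose Y : R := 1 + enorm x; have Y1 : 1 <= Y by rewrite lerDl enorm_ge0.
have Y0 : 0 < Y by exact: lt_le_trans Y1.
have te2 : 0 <= t ^ (e - 2) by rewrite exprz_ge0// ltW.
pose G := t ^ (e - 2) * Y ^+ L; have G0 : 0 <= G by rewrite mulr_ge0// exprn_ge0// ltW.
have YL k : (k <= L)%N -> t ^ (e - 2) * Y ^+ k <= G by move=> kL; rewrite ler_wpM2l// ler_weXn2l.
have L1L : (L1 <= L)%N by rewrite /L !leq_max leqnn.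
have L2L : (L2 <= L)%N by rewrite /L !leq_max leqnn !orbT.
have ML : (M <= L)%N by rewrite /L !leq_max leqnn !orbT.
have twoL : (2 <= L)%N by rewrite /L !leq_max leqnn !orbT.
rewrite -/Y -/G; pose w : R := wt (p - q) ^+ K; have w0 : 0 <= w by exact: wtX_ge0.
rewrite -/w; case: cas => [tx0|tx1]; last first.
  have -> : ent (rho (t *: xi + x)) p q i j - (t ^ e)%:C * ent (s e xi) p q i j
     - (t ^ (e - 1))%:C * (ent (s (e - 1) xi) p q i j + \sum_l (x 0 l)%:C * ent (dxi l (s e) xi) p q i j) =
     (ent (s e (t *: xi + x)) p q i j - (t ^ e)%:C * ent (s e xi) p q i j - (t ^ (e - 1))%:C * \sum_l (x 0 l)%:C * ent (dxi l (s e) xi) p q i j) +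
     (ent (s (e - 1) (t *: xi + x)) p q i j - (t ^ (e - 1))%:C * ent (s (e - 1) xi) p q i j) +
     (ent (rho (t *: xi + x)) p q i j - ent (s e (t *: xi + x)) p q i j - ent (s (e - 1) (t *: xi + x)) p q i j) by ring.
  apply: le_trans (ler_wpM2r w0 (cnormD _ _)) _; rewrite mulrDl [leRHS]mulrDl.
  apply: (@le_trans _ _ ((C1 + C2) * G + C8 * G)); last by rewrite (mulrDl (C1 + C2) C8 G) lerDl mulr_ge0// !addr_ge0.
  apply: lerD.
    apply: le_trans (ler_wpM2r w0 (cnormD _ _)) _; rewrite !mulrDl; apply: lerD.
      apply: le_trans (h1 t x p q i j t1 tx1) _; rewrite ler_wpM2l//; exact: YL.
    apply: le_trans (h2 t x p q i j t1 tx1) _; rewrite ler_wpM2l// -addrA; exact: YL.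
  apply: le_trans (h3 _ p q i j tx1) _; have [p1 p2] := @peetre_line t xi x t1 xi1.
  have a1 : 1 <= 1 + enorm (t *: xi + x) by rewrite lerDl enorm_ge0.
  apply: le_trans (ler_wpM2l C30 (peetre_z (e - 2) D1 a1 t1 Y1 p1 p2)) _.
  by rewrite /C8 -!mulrA ler_wpM2l// ler_wpM2l ?exprn_ge0 ?(le_trans ler01 D1)//; exact: YL.
have tY : t <= Y.
  have xE : x = - (t *: xi) by apply/eqP; rewrite -addr_eq0 addrC tx0.
  rewrite /Y [in leRHS]xE enormN enormZ (gtr0_norm t0).
  by rewrite ler_wpDl// -[leLHS]mulr1 ler_wpM2l// ltW.
have tee : t ^ e <= G.
  apply: le_trans (YL 2%N twoL).
  have -> : t ^ e = t ^ (e - 2) * t ^+ 2 by rewrite -[t ^+ 2]/(t ^ 2) -expfzDr ?gt_eqF// subrK.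
  by rewrite ler_wpM2l// lerXn2r ?nnegrE ?(ltW t0) ?(ltW Y0).
have te1 : t ^ (e - 1) * Y <= G.
  apply: le_trans (YL 2%N twoL).
  have -> : t ^ (e - 1) = t ^ (e - 2) * t.
    by rewrite -[X in _ * X]/(t ^ 1) -expfzDr ?gt_eqF// -addrA.
  by rewrite -mulrA ler_wpM2l// expr2 ler_wpM2r ?(ltW Y0).
have te1' : t ^ (e - 1) <= G by apply: le_trans te1; rewrite ler_pMr// exprz_gt0.
(* At the origin [rho] is merely bounded, so [G] has to dominate 1; this is why [L] is at least the
   absolute value of [e - 2]. *)
have oneG : 1 <= G.
  apply: le_trans (YL M ML).
  have : t ^ (- (e - 2)) <= Y ^+ M by rewrite /M -abszN; apply: exprz_abs.
  by move/(ler_wpM2l te2); rewrite -expfzDr ?gt_eqF// subrr expr0z.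
apply: (@le_trans _ _ ((`|C4| + C5 + (C6 + C7)) * G)); last first.
  by rewrite [leRHS]mulrDl lerDr mulr_ge0// !addr_ge0.
apply: le_trans (ler_wpM2r w0 (cnormB _ _)) _; rewrite mulrDl [leRHS]mulrDl; apply: lerD.
  apply: le_trans (ler_wpM2r w0 (cnormB _ _)) _; rewrite mulrDl [leRHS]mulrDl; apply: lerD.
    rewrite tx0; have := h4 0; rewrite enorm0 lexx => /(_ isT p q i j) /= h0.
    apply: le_trans h0 _; rewrite addr0 subr0 exp1rz mulr1.
    by apply: le_trans (ler_norm _) _; rewrite ler_peMr.
  rewrite cnormM cnorm_real ger0_norm ?exprz_ge0 ?(ltW t0)// -mulrA mulrC.
  by apply: ler_pM; rewrite ?mulr_ge0 ?cnorm_ge0 ?exprz_ge0 ?(ltW t0).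
rewrite cnormM cnorm_real ger0_norm ?exprz_ge0 ?(ltW t0)// -mulrA.
apply: le_trans (ler_wpM2l (exprz_ge0 _ (ltW t0)) (ler_wpM2r w0 (cnormD _ _))) _.
rewrite mulrDl mulrDr [leRHS]mulrDl; apply: lerD.
  rewrite mulrC; apply: ler_pM; rewrite ?mulr_ge0 ?cnorm_ge0 ?exprz_ge0 ?(ltW t0)//.
apply: le_trans (ler_wpM2l (exprz_ge0 _ (ltW t0)) (h7 x p q i j)) _.
by rewrite mulrCA ler_wpM2l.
Qed.

End Expansion.

End Symbols.

(** * Operators given by matrix kernels *)

Section Kernels.
Context {R : realType} {n N : nat}.
Variable theta : 'M[R]_n.
Hypothesis thetaT : theta^T = - theta.
Local Notation Z := 'rV[int]_n.
Local Notation S := (sspinor R n N).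
Implicit Types (ka : Z -> Z -> 'I_N -> 'I_N -> R[i]).

(** Rapid decay away from the diagonal and polynomial growth along it: the matrix form of an
    operator of finite order. Uniform bounds of this kind send bounded families to bounded
    families. *)
Definition kbd ka := exists L : nat, forall K, exists2 C : R, 0 <= C &
  forall p q i j, cnorm (ka p q i j) * wt (p - q) ^+ K <= C * wt q ^+ L.

Definition krep (X : S -> S) ka :=
  kbd ka /\ forall psi p i, X psi p i 0 = csum (fun q => \sum_j psi q j 0 * ka p q i j).

Lemma kernel_bound (I : Type) (ka : I -> Z -> Z -> 'I_N -> 'I_N -> R[i]) (psi : I -> S) (L : nat) :
  (forall K, exists2 C : R, 0 <= C & forall t p q i j,
     cnorm (ka t p q i j) * wt (p - q) ^+ K <= C * wt q ^+ L) -> bfam psi ->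
  forall K, exists C : R, forall t p i,
    sdom (C / wt p ^+ K) (fun q => \sum_j psi t q j 0 * ka t p q i j).
Proof.
move=> kaP psiP K; have [C C0 hC] := kaP K.
(* [L] absorbs the growth of the kernel, [K] is the decay asked for, and [2 * n] makes the sum over
   [q] converge. *)
have /choice[B hB] j := psiP j (L + K + 2 * n)%N.
pose E := \sum_j `|B j|; exists (E * C) => t p i q.
rewrite mulrAC ler_pdivlMr ?wtX_gt0//; apply: le_trans (ler_wpM2r (wtX_ge0 _ _) (cnorm_sum _ _ _)) _.
rewrite -mulrA mulr_suml /E mulr_suml; apply: ler_sum => j _; rewrite cnormM.
have wpq : wt p ^+ K <= wt (p - q) ^+ K * wt q ^+ K :> R by rewrite -{1}(subrK q p) wtXD.
apply: le_trans (ler_wpM2l _ wpq) _; first by rewrite mulr_ge0 ?cnorm_ge0.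
have -> : cnorm (psi t q j 0) * cnorm (ka t p q i j) * (wt (p - q) ^+ K * wt q ^+ K) =
  cnorm (psi t q j 0) * wt q ^+ K * (cnorm (ka t p q i j) * wt (p - q) ^+ K) by ring.
apply: le_trans (ler_wpM2l _ (hC t p q i j)) _; first by rewrite mulr_ge0 ?cnorm_ge0 ?wtX_ge0.
have -> : cnorm (psi t q j 0) * wt q ^+ K * (C * wt q ^+ L) =
   C * (cnorm (psi t q j 0) * wt q ^+ (L + K + 2 * n)) * om q.
  rewrite /om !exprD; field; rewrite expf_neq0// gt_eqF ?wt_gt0//.
rewrite [leRHS]mulrA ler_wpM2r ?om_ge0// [leRHS]mulrC ler_wpM2l//.
exact: le_trans (hB j t q) (ler_norm _).
Qed.

Lemma kernel_bfam (I : Type) (ka : I -> Z -> Z -> 'I_N -> 'I_N -> R[i]) (phi psi : I -> S) (L : nat) :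
  (forall K, exists2 C : R, 0 <= C & forall t p q i j,
     cnorm (ka t p q i j) * wt (p - q) ^+ K <= C * wt q ^+ L) -> bfam psi ->
  (forall t p i, phi t p i 0 = csum (fun q => \sum_j psi t q j 0 * ka t p q i j)) -> bfam phi.
Proof.
move=> kaP psiP phiE i K; have [C hC] := kernel_bound kaP psiP K.
exists (2 * (C * 6 ^+ n)) => t p; rewrite phiE.
have := csum_bound (hC t p i); rewrite -ler_pdivlMr ?wtX_gt0// => h.
apply: le_trans h _; suff -> : 2 * (C / wt p ^+ K * 6 ^+ n) = 2 * (C * 6 ^+ n) / wt p ^+ K by [].
by rewrite -!mulrA; congr (2 * (C * _)); rewrite mulrC.
Qed.

Lemma kbd_sdom ka (psi : S) : kbd ka -> exists C : R, forall p i,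
  sdom C (fun q => \sum_j psi q j 0 * ka p q i j).
Proof.
move=> [L kaP]; have := @kernel_bound unit (fun=> ka) (fun=> psi) L _ (bfam_cst _ psi) 0.
case=> [K|C hC]; first by have [C C0 hC] := kaP K; exists C.
by exists C => p i; have := hC tt p i; rewrite expr0 divr1.
Qed.

Lemma kbdD ka ka' : kbd ka -> kbd ka' -> kbd (fun p q i j => ka p q i j + ka' p q i j).
Proof.
move=> [L h] [L' h']; exists (maxn L L') => K; have [C C0 hC] := h K; have [C' C'0 hC'] := h' K.
exists (C + C') => [|p q i j]; first exact: addr_ge0.
apply: le_trans (ler_wpM2r (wtX_ge0 _ _) (cnormD _ _)) _; rewrite !mulrDl; apply: lerD.
  by apply: le_trans (hC p q i j) _; rewrite ler_wpM2l// wtX_le// leq_maxl.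
by apply: le_trans (hC' p q i j) _; rewrite ler_wpM2l// wtX_le// leq_maxr.
Qed.

Lemma kbdZ (c : R[i]) ka : kbd ka -> kbd (fun p q i j => c * ka p q i j).
Proof.
move=> [L h]; exists L => K; have [C C0 hC] := h K; exists (cnorm c * C) => [|p q i j].
  by rewrite mulr_ge0 ?cnorm_ge0.
by rewrite cnormM -!mulrA ler_wpM2l ?cnorm_ge0.
Qed.

Lemma krepD X Y ka ka' : krep X ka -> krep Y ka' ->
  krep (fun psi => X psi + Y psi) (fun p q i j => ka p q i j + ka' p q i j).
Proof.
move=> [h hX] [h' hY]; split=> [|psi p i]; first exact: kbdD.
have [C hC] := kbd_sdom psi h; have [C' hC'] := kbd_sdom psi h'.
rewrite sspDE mxE hX hY -(csumD (hC p i) (hC' p i)); congr csum; apply/funext => q.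
by rewrite -big_split; apply: eq_bigr => j _; rewrite mulrDr.
Qed.

Lemma krepZ (c : R[i]) X ka : krep X ka -> krep (fun psi => c *: X psi) (fun p q i j => c * ka p q i j).
Proof.
move=> [h hX]; split=> [|psi p i]; first exact: kbdZ.
have [C hC] := kbd_sdom psi h.
rewrite sspZE mxE hX -(csumZ c (hC p i)); congr csum; apply/funext => q.
by rewrite mulr_sumr; apply: eq_bigr => j _; rewrite mulrCA.
Qed.

Lemma krep_sum (I : Type) (r : seq I) (X : I -> S -> S) (ka : I -> Z -> Z -> 'I_N -> 'I_N -> R[i]) :
  (forall t, krep (X t) (ka t)) ->
  krep (fun psi => \sum_(t <- r) X t psi) (fun p q i j => \sum_(t <- r) ka t p q i j).
Proof.
move=> h; elim: r => [|t r IH].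
  split=> [|psi p i]; first by exists 0%N => K; exists 0 => // p q i j; rewrite big_nil cnorm0 !mul0r.
  rewrite big_nil ssp0E mxE -[LHS](@csum0 R n); congr csum; apply/funext => q.
  by rewrite big1// => j _; rewrite big_nil mulr0.
have [h1 h2] := krepD (h t) IH; split=> [|psi p i].
  by move: h1; congr kbd; apply/funext => p; apply/funext => q; apply/funext => i; apply/funext => j; rewrite big_cons.
rewrite big_cons h2; congr csum; apply/funext => q; apply: eq_bigr => j _; by rewrite big_cons.
Qed.

Lemma krep_Dop l X ka : krep X ka ->
  krep (fun psi => X (Dop l psi)) (fun p q i j => (q 0 l)%:~R * ka p q i j).
Proof.
move=> [[L h] hX]; split=> [|psi p i].
  exists L.+1 => K; have [C C0 hC] := h K; exists C => // p q i j.
  rewrite cnormM -mulrA exprS [leRHS]mulrCA; apply: ler_pM; rewrite ?cnorm_ge0 ?mulr_ge0 ?cnorm_ge0 ?wtX_ge0//.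
  exact: cnorm_coord_le.
by rewrite hX; congr csum; apply/funext => q; apply: eq_bigr => j _; rewrite DopEi; ring.
Qed.

Lemma krep_shc q0 X ka : krep X ka -> krep (shc q0 X) (fun p q i j => ka (p + q0) (q + q0) i j).
Proof.
move=> [[L h] hX]; have h' : kbd (fun p q i j => ka (p + q0) (q + q0) i j).
  exists L => K; have [C C0 hC] := h K; exists (C * wt q0 ^+ L) => [|p q i j].
    by rewrite mulr_ge0 ?wtX_ge0.
  have := hC (p + q0) (q + q0) i j; rewrite opprD addrACA subrr addr0 => /le_trans; apply.
  by rewrite -mulrA ler_wpM2l// mulrC; exact: wtXD.
split=> // psi p i; rewrite /shc translE opprK hX.
have [C hC] := kbd_sdom (transl q0 psi) (ex_intro _ L h); have [C' hC'] := kbd_sdom psi h'.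
pose f q := \sum_j transl q0 psi q j 0 * ka (p + q0) q i j.
have fE : f \o (fun q => q + q0) = fun q => \sum_j psi q j 0 * ka (p + q0) (q + q0) i j.
  by apply/funext => q; apply: eq_bigr => j _; rewrite translE addrK.
rewrite -fE; apply/esym/(@csum_reindex R n C C' f _ (fun q => q - q0)).
- by move=> q; rewrite addrK.
- by move=> q; rewrite subrK.
- exact: hC.
- by rewrite fE; exact: hC'.
Qed.

Lemma krep_scont (X : {linear S -> S}) : scont X -> kbd (fun p q i j => X (basis q j) p i 0) ->
  krep X (fun p q i j => X (basis q j) p i 0).
Proof.
move=> cX h; split=> // psi p i; have [C hC] := kbd_sdom psi h.
have [_ /(_ p i) t1] := cX _ _ (stend_trunc psi).
apply: ctend_unique t1 _.
pose f q := \sum_j psi q j 0 * X (basis q j) p i 0.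
have C0 : 0 <= C := sdom_ge0 (hC p i).
pose fk k q := if q \in exhaust n k then f q else 0.
have -> : (fun k => X (trunc k psi) p i 0) = fun k => csum (fk k).
  apply/funext => k; rewrite (@csum_unique_fin _ _ (fk k) (exhaust n k)) ?exhaust_uniq//; last first.
    by move=> m /negbTE mk; rewrite /fk mk.
  rewrite /trunc linear_sum ssp_sumE summxE big_seq [RHS]big_seq; apply: eq_bigr => q qk.
  rewrite /fk qk linear_sum ssp_sumE summxE; apply: eq_bigr => j _.
  by rewrite linearZ sspZE mxE.
apply: (@csum_ctend _ _ C) => [k q||q]; last 2 first.
- exact: hC.
- move=> e e0; exists (choice.pickle q).+1 => k qk.
  by rewrite /fk mem_exhaust// subrr cnorm0 ltW.
rewrite /fk; case: ifP => _; first exact: hC.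
by rewrite cnorm0 mulr_ge0 ?om_ge0.
Qed.

(** Column [q] of the matrix is column 0 of the operator conjugated by the translation by [q]; the
    conjugates stay bounded uniformly in [q], so there is no growth along the diagonal. *)
Lemma krep_hop (ws : seq (@word R n N theta)) : krep (hop ws) (fun p q i j => hop ws (basis q j) p i 0).
Proof.
apply: krep_scont; first by apply: (scont_hat thetaT); exists ws.
exists 0%N => K.
have B (j : 'I_N) : bfam (fun q : Z => shc q (hop ws) (basis 0 j)).
  exact: (@bfam_hop _ _ _ _ _ (fun q : Z => q) ws (fun=> basis 0 j)) (bfam_cst _ _).
have /choice[C hC] (ij : 'I_N * 'I_N) := B ij.2 ij.1 K.
exists (\sum_ij `|C ij|) => [|p q i j]; first exact: sumr_ge0.
have := hC (i, j) q (p - q); rewrite /= opprK.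
have -> : transl q (basis 0 j) = basis q j :> S.
  apply: sspinor_eqP => m l; rewrite translE !basisE.
  by congr ((_ && _)%:R); rewrite subr_eq0.
rewrite subrK expr0 mulr1 => /le_trans; apply.
by apply: le_trans (ler_norm _) _; rewrite (bigD1 (i, j))//= lerDl sumr_ge0.
Qed.

End Kernels.

(** * Two-term expansion of a translated pseudodifferential operator *)

Section ExpandOperator.
Context {R : realType} {n N : nat}.
Variable theta : 'M[R]_n.
Hypothesis thetaT : theta^T = - theta.
Local Notation Z := 'rV[int]_n.
Local Notation S := (sspinor R n N).
Local Notation op := (@operator R n N).
Variables (d : int) (s : int -> 'rV[R]_n -> op) (rho : 'rV[R]_n -> op) (e : int).
Hypothesis rho_bd : symbol_bound d 0 rho.
Hypothesis s_hom : forall e, homogeneous theta e (s e).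
Hypothesis s_hi : forall e' (eta : 'rV[R]_n), d < e' -> eta != 0 -> op_eq (s e' eta) (fun _ _ => 0).
Hypothesis rho_asym : forall J : nat, symbol_bound (d - J%:Z) 1
   (fun xi psi p => rho xi psi p - \sum_(m < J) s (d - m%:Z) xi psi p).
Hypothesis s_top : forall e' (eta : 'rV[R]_n), e < e' -> eta != 0 -> op_eq (s e' eta) (fun _ _ => 0).
Variable P : S -> S.
Hypothesis PE : forall psi : S, P psi = quantize rho psi :> spinor.
Variable xi : 'rV[R]_n.
Hypothesis xi2 : 2 <= enorm xi.
Variables (Nn : nat -> nat) (q : nat -> Z).
Hypothesis Nn_gt : forall k, (k < Nn k)%N.
Definition veps k (l : 'I_n) : R := (q k 0 l)%:~R - (Nn k)%:R * xi 0 l.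
Hypothesis q_near : forall k j, `|veps k j| <= k.+1%:R^-1.
Variables (w0 w1 : seq (@word R n N theta)) (wl : 'I_n -> seq (@word R n N theta)).
Hypothesis w0E : forall psi : S, s e xi psi = hop w0 psi.
Hypothesis w1E : forall psi : S, s (e - 1) xi psi = hop w1 psi.
Hypothesis wlE : forall l (psi : S), dxi l (s e) xi psi = hop (wl l) psi.

Lemma krep_quantize : krep P (fun p q i j => ent (rho (realv q)) p q i j).
Proof.
split=> [|psi p i]; last by rewrite PE mxE.
exists `|d|%N => K; have [C hC] := rho_bd [::] K; exists `|C| => // p r i j.
have := hC (realv r) (enorm_ge0 _) p r i j; rewrite /= subr0 => h; apply: le_trans h _.
apply: (@le_trans _ _ (`|C| * wt r ^ d)).
  by rewrite ler_wpM2r ?ler_norm// exprz_ge0 ?wt_ge0.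
by rewrite ler_wpM2l//; apply: exprz_abs => //; exact: wt_ge1.
Qed.

Lemma realv_lattice (r : Z) : realv r = 0 :> 'rV[R]_n \/ 1 <= enorm (realv r : 'rV[R]_n).
Proof.
have [->|r0] := eqVneq r 0; [by left; exact: realv0|right].
have /existsP[j jr] : [exists j, r 0 j != 0].
  apply: contraNT r0 => /existsPn h; apply/eqP/rowP => j; rewrite mxE.
  by have := h j; rewrite negbK => /eqP.
apply: le_trans (coord_le_enorm _ j); rewrite mxE -intr_norm ler1z.
by rewrite -gtz0_ge1 normr_gt0.
Qed.

(** The remainder after two terms, multiplied by [N^2], is bounded uniformly in [k]: its kernel is
    estimated by [symbol_taylor] with [t = N]. The displacement [x] is the lattice point plus
    [veps], so the first-order term of the Taylor expansion produces the derivation [Dop l] and a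
    correction by [veps]. *)
Lemma expand_operator (psi : nat -> S) : bfam psi ->
  bfam (fun k => ((Nn k)%:R ^+ 2)%:C *: (((Nn k)%:R ^ (- e))%:C *: shc (q k) P (psi k)
    - (shc (q k) (hop w0) (psi k)
    + ((Nn k)%:R^-1)%:C *: (shc (q k) (hop w1) (psi k) +
      \sum_l (shc (q k) (hop (wl l)) (Dop l (psi k)) + (veps k l)%:C *: shc (q k) (hop (wl l)) (psi k)))))).
Proof.
move=> psiP; have [L hL] := symbol_taylor rho_bd s_hom s_hi rho_asym s_top xi2.
have Y k l := krepD (krep_Dop l (krep_shc (q k) (krep_hop thetaT (wl l))))
  (krepZ (veps k l)%:C (krep_shc (q k) (krep_hop thetaT (wl l)))).
have X1 k := krepD (krep_shc (q k) (krep_hop thetaT w1)) (krep_sum (index_enum 'I_n) (Y k)).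
have X0 k := krepD (krep_shc (q k) (krep_hop thetaT w0)) (krepZ ((Nn k)%:R^-1)%:C (X1 k)).
have X k := krepZ ((Nn k)%:R ^+ 2)%:C (krepD (krepZ ((Nn k)%:R ^ (- e))%:C (krep_shc (q k) krep_quantize)) (krepZ (-1) (X0 k))).
apply: (kernel_bfam (L := L) _ psiP (fun k p i => _)); last first.
  by move=> k p i; have [_ /(_ (psi k) p i) h] := X k; rewrite -scaleN1r; exact: h.
move=> K; have [C C0 hC] := hL K; exists (C * (1 + n%:R) ^+ L) => [|k p r i j].
  by rewrite mulr_ge0// exprn_ge0// addr_ge0.
pose t : R := (Nn k)%:R; have t1 : 1 <= t by rewrite ler1n; apply: leq_ltn_trans (Nn_gt k).
have t0 : 0 < t by exact: lt_le_trans t1.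
have tn0 : t%:C != 0 by rewrite fmorph_eq0 gt_eqF.
pose x : 'rV[R]_n := realv r + \row_l veps k l.
(* Column [r] of the translated operator evaluates the symbol at [r + q k]. *)
have rE : realv (r + q k) = t *: xi + x :> 'rV[R]_n.
  by rewrite /x; apply/rowP => l; rewrite !mxE intrD /veps /t; ring.
have xle : 1 + enorm x <= (1 + n%:R) * wt r.
  apply: (@le_trans _ _ (1 + (enorm (realv r : 'rV[R]_n) + n%:R))).
    rewrite lerD2l; apply: le_trans (enormD _ _) _; rewrite lerD2l.
    apply: le_trans (enorm_le_sum _) _; rewrite -[leRHS]mulr1n -[X in X%:R]card_ord mulr1n -sum1_card natr_sum.
    apply: ler_sum => l _; rewrite mxE; apply: le_trans (q_near k l) _.
    by rewrite invf_le1 ?ltr0n// ler1n.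
  rewrite /wt; have := enorm_ge0 (realv r : 'rV[R]_n); have := ler0n R n; move: (n%:R : R) (enorm _) => a b a0 b0.
  have := mulr_ge0 a0 b0; lra.
have cas : t *: xi + x = 0 \/ 1 <= enorm (t *: xi + x) by rewrite -rE; exact: realv_lattice.
have := hC t x (p + q k) (r + q k) i j t1 cas; rewrite -rE.
have -> : p + q k - (r + q k) = p - r by rewrite opprD addrACA subrr addr0.
have e0 : ent (s e xi) (p + q k) (r + q k) i j = hop w0 (basis (r + q k) j) (p + q k) i 0.
  by rewrite -w0E.
have e1 : ent (s (e - 1) xi) (p + q k) (r + q k) i j = hop w1 (basis (r + q k) j) (p + q k) i 0.
  by rewrite -w1E.
have el : \sum_l (x 0 l)%:C * ent (dxi l (s e) xi) (p + q k) (r + q k) i j =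
   \sum_l ((r 0 l)%:~R * hop (wl l) (basis (r + q k) j) (p + q k) i 0 +
           (veps k l)%:C * hop (wl l) (basis (r + q k) j) (p + q k) i 0).
  apply: eq_bigr => l _; rewrite -mulrDl -wlE; congr (_ * _); rewrite !mxE rmorphD /=; congr (_ + _).
  exact: (rmorph_int (real_complex R)).
rewrite e0 e1 el -/t; set A := ent _ _ _ _ _; set B := hop w0 _ _ _ _; set D := (X in _ - _ * X).
have tE : (t ^ e)%:C != 0 by rewrite fmorph_eq0 gt_eqF// exprz_gt0.
have -> : A - (t ^ e)%:C * B - (t ^ (e - 1))%:C * D =
   (t ^ (e - 2))%:C * ((t ^+ 2)%:C * ((t ^ (- e))%:C * A + -1 * (B + (t^-1)%:C * D))).
  have -> : t ^ (e - 2) = t ^ e * t^-1 * t^-1.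
    by rewrite expfzDr ?gt_eqF// -[-2]/(- 2%:Z) -exprnN expr2 invfM mulrA.
  have -> : t ^ (e - 1) = t ^ e * t^-1 by rewrite expfzDr ?gt_eqF.
  have -> : t ^ (- e) = (t ^ e)^-1 by rewrite -invr_expz.
  rewrite !rmorphM !fmorphV /=; field.
  by rewrite [X in _ && X]tE andbT pnatr_eq0 -lt0n (leq_ltn_trans _ (Nn_gt k)).
rewrite cnormM cnorm_real ger0_norm ?exprz_ge0 ?(ltW t0)// -mulrA [X in _ <= X -> _]mulrCA.
rewrite ler_pM2l ?exprz_gt0// => h; apply: le_trans h _.
rewrite -mulrA ler_wpM2l// -exprMn lerXn2r ?nnegrE ?addr_ge0 ?enorm_ge0//.
by apply: mulr_ge0; [exact: addr_ge0 | exact: wt_ge0].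
Qed.

End ExpandOperator.

(** * Jets of operators *)

Section Jets.
Context {R : realType} {n N : nat}.
Variable theta : 'M[R]_n.
Hypothesis thetaT : theta^T = - theta.
Local Notation Z := 'rV[int]_n.
Local Notation S := (sspinor R n N).
Variables (xi : 'rV[R]_n) (Nn : nat -> nat) (q : nat -> Z).
Hypothesis Nn_gt : forall k, (k < Nn k)%N.
Hypothesis q_near : forall k j, `|veps xi Nn q k j| <= k.+1%:R^-1.
Hypothesis q_rec : forall r, ctend (fun k => phase theta r (q k)) 1.
Local Notation eps := (veps xi Nn q).
Local Notation hat := (@hat R n N theta).
Implicit Types (s t : S -> S) (X Y : nat -> S -> S).

Lemma linearfD (f : S -> S) u v : linear f -> f (u + v) = f u + f v.
Proof. by move=> h; have := h 1 u v; rewrite !scale1r. Qed.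

Lemma linearfZ (f : S -> S) c u : linear f -> f (c *: u) = c *: f u.
Proof.
move=> h; have f0 : f 0 = 0.
  by have := linearfD 0 0 h; rewrite addr0 => /eqP; rewrite -subr_eq0 opprD addrA subrr sub0r oppr_eq0 => /eqP.
by have := h c u 0; rewrite f0 !addr0.
Qed.

Definition hN k : R[i] := ((Nn k)%:R^-1)%:C.

Lemma Nn_neq0 k : (Nn k)%:R != 0 :> R.
Proof. by rewrite pnatr_eq0 -lt0n (leq_ltn_trans _ (Nn_gt k)). Qed.

Lemma inv_small (e : R) : 0 < e -> exists k0, forall k, (k0 <= k)%N -> k.+1%:R^-1 <= e.
Proof.
move=> e0; exists (Num.truncn e^-1) => k hN.
rewrite -[leRHS]invrK lef_pV2 ?posrE ?invr_gt0// ltW//.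
apply: lt_le_trans (truncnS_gt _) _.
by rewrite ler_nat ltnS.
Qed.

Lemma hk_le k : cnorm (hN k) <= k.+1%:R^-1.
Proof.
rewrite cnorm_real ger0_norm ?invr_ge0// lef_pV2 ?posrE ?ltr0n ?(leq_ltn_trans _ (Nn_gt k))//.
by rewrite ler_nat.
Qed.

Lemma hk_le1 k : cnorm (hN k) <= 1.
Proof. by apply: le_trans (hk_le k) _; rewrite invf_le1 ?ltr0n// ler1n. Qed.

Lemma hk0 : ctend hN 0.
Proof.
move=> e /inv_small[k0 h]; exists k0 => k /h; rewrite subr0; exact: le_trans (hk_le k).
Qed.

Lemma eps0 l : ctend (fun k => (eps k l)%:C) 0.
Proof.
move=> e /inv_small[k0 h]; exists k0 => k /h; rewrite subr0 cnorm_real; exact: le_trans (q_near k l).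
Qed.

Lemma eps_le1 k l : cnorm (eps k l)%:C <= 1.
Proof. by rewrite cnorm_real; apply: le_trans (q_near k l) _; rewrite invf_le1 ?ltr0n// ler1n. Qed.

(* [sg m] tends to [s], with bounds uniform in [m]. *)
Definition tame (sg : nat -> S -> S) (s : S -> S) :=
  [/\ forall k, linear (sg k),
      forall psi, bfam psi -> bfam (fun k => sg k (psi k)) &
      forall psi phi, stend psi phi -> stend (fun k => sg k (psi k)) (s phi)].

Lemma shcD p s t (psi : S) : shc p (fun psi => s psi + t psi) psi = shc p s psi + shc p t psi.
Proof. by rewrite /shc linearD. Qed.

Lemma shcZ p c s (psi : S) : shc p (fun psi => c *: s psi) psi = c *: shc p s psi.
Proof. by rewrite /shc linearZ. Qed.

Lemma bfam_hkZ (psi : nat -> S) : bfam psi -> bfam (fun k => hN k *: psi k).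
Proof. exact: bfamZ hk_le1. Qed.

Lemma stend_hkZ (v : nat -> S) : bfam v -> stend (fun k => hN k *: v k) 0.
Proof.
move=> b; split=> [|m j]; first exact: bfam_hkZ.
have [C C0 hC] := sbf_ge0 0 (b j) => e e0.
have [|k0 hk0] := @hk0 (e / (C + 1)); first by rewrite divr_gt0// ltr_wpDl.
exists k0 => k /hk0; rewrite subr0 => h1; rewrite sspZE ssp0E !mxE subr0 cnormM.
have := hC k m; rewrite expr0 mulr1 => h2.
apply: le_trans (ler_pM (cnorm_ge0 _) (cnorm_ge0 _) h1 h2) _.
rewrite -mulrA ler_piMr ?(ltW e0)// mulrC ler_pdivrMr ?ltr_wpDl// mul1r lerDl ler01//.
Qed.

Lemma tame_comp sg s tau t : tame sg s -> tame tau t ->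
  tame (fun k psi => sg k (tau k psi)) (fun psi => s (t psi)).
Proof.
move=> [h1 h2 h3] [g1 g2 g3]; split=> [k c u v|psi /g2 /h2//|psi phi /g3 /h3//].
by rewrite g1 h1.
Qed.

Lemma tameD sg s tau t : tame sg s -> tame tau t ->
  tame (fun k psi => sg k psi + tau k psi) (fun psi => s psi + t psi).
Proof.
move=> [h1 h2 h3] [g1 g2 g3]; split=> [k c u v|psi hp|psi phi hp].
- by rewrite g1 h1 scalerDr addrACA.
- exact: bfamD (h2 _ hp) (g2 _ hp).
- exact: stendD (h3 _ _ hp) (g3 _ _ hp).
Qed.

Lemma tame0 : tame (fun _ _ => 0) (fun=> 0).
Proof.
split=> [k c u v|psi _|psi phi _]; first by rewrite scaler0 addr0.
- exact: bfam_cst.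
- exact: stend_cst.
Qed.

Lemma tameZ (c : nat -> R[i]) c' sg s : (forall k, cnorm (c k) <= 1) -> ctend c c' -> tame sg s ->
  tame (fun k psi => c k *: sg k psi) (fun psi => c' *: s psi).
Proof.
move=> c1 ct [h1 h2 h3]; split=> [k a u v|psi hp|psi phi hp].
- by rewrite h1 scalerDr !scalerA mulrC.
- exact: bfamZ c1 (h2 _ hp).
- exact: stendZ ct (h3 _ _ hp).
Qed.

Lemma tame_cstZ (c : R[i]) sg s : tame sg s ->
  tame (fun k psi => c *: sg k psi) (fun psi => c *: s psi).
Proof.
move=> [h1 h2 h3]; split=> [k a u v|psi hp|psi phi hp].
- by rewrite h1 scalerDr !scalerA mulrC.
- by apply: (@bfamZ _ _ _ _ (fun=> c) (cnorm c)) => //; exact: h2.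
- exact: stendZ (ctend_cst c) (h3 _ _ hp).
Qed.

Lemma tame_sum (I : Type) (r : seq I) (sg : I -> nat -> S -> S) (s : I -> S -> S) :
  (forall i, tame (sg i) (s i)) ->
  tame (fun k psi => \sum_(i <- r) sg i k psi) (fun psi => \sum_(i <- r) s i psi).
Proof.
move=> h; split=> [k c u v|psi hp|psi phi hp].
- rewrite scaler_sumr -big_split; apply: eq_bigr => i _; have [h1 _ _] := h i; exact: h1.
- apply: (@bfam_sum _ _ _ _ _ r (fun i k => sg i k (psi k))) => i; have [_ h2 _] := h i; exact: h2.
- apply: (@stend_sum _ _ _ _ r (fun i k => sg i k (psi k))) => i; have [_ _ h3] := h i; exact: h3.
Qed.

Lemma tame_Dop l : tame (fun=> Dop l) (Dop l).
Proof.
split=> [k c u v|psi|psi phi]; first by rewrite linearP.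
- exact: bfam_Dop.
- by move=> h; exact: (scont_Dop l h).
Qed.

Lemma tame_shc s : hat s -> tame (fun k => shc (q k) s) s.
Proof.
move=> hs; have [ws hw] := hs; split=> [k c u v|psi hp|psi phi hp].
- have E psi : shc (q k) s psi = shc (q k) (hop ws) psi by rewrite /shc hw.
  by rewrite !E /shc !linearP.
- exact: bfam_hat hs hp.
- exact: stend_hat q_rec hs hp.
Qed.

(* [X m = shc (q m) s + hN m (s' + o(1))], where the first-order coefficient
   converges only in the limit while the zeroth-order one is exact for every
   [m]: equality of two limits [s] then lets the first orders be compared. *)
Definition jet (X : nat -> S -> S) s s' :=
  hat s /\ exists2 sg, tame sg s' & forall psi, bfam psi -> exists2 rho, bfam rho &
    forall k, X k (psi k) = shc (q k) s (psi k) + hN k *: (sg k (psi k) + hN k *: rho k).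

Lemma jet_bfam X s s' psi : jet X s s' -> bfam psi -> bfam (fun k => X k (psi k)).
Proof.
move=> [/tame_shc[_ h _] [sg [_ g _] hX]] hp; have [rho hr E] := hX _ hp.
apply: bfam_eq (fun k => esym (E k)) _; apply: bfamD (h _ hp) _; apply: bfam_hkZ.
exact: bfamD (g _ hp) (bfam_hkZ hr).
Qed.

(** Conjugation by a translation is multiplicative, so the zeroth-order part of the product is
    exact, as the definition demands; the first-order part obeys the Leibniz rule, and the remaining
    terms are bounded with a factor [hN]. *)
Lemma jet_comp X s s' Y t t' : jet X s s' -> jet Y t t' ->
  jet (fun k psi => X k (Y k psi)) (fun psi => s (t psi)) (fun psi => s (t' psi) + s' (t psi)).
Proof.
move=> jX jY; have [hs [sg sgP hX]] := jX; have [ht [tau tauP hY]] := jY.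
have tS := tame_shc hs; have tT := tame_shc ht.
split; first exact: hat_comp hs ht.
exists (fun k psi => shc (q k) s (tau k psi) + sg k (shc (q k) t psi)).
  exact: tameD (tame_comp tS tauP) (tame_comp sgP tT).
move=> psi hp; have [r1 br1 E1] := hY _ hp; have [r2 br2 E2] := hX _ (jet_bfam jY hp).
have [ls bs _] := tS; have [lg bg _] := sgP; have [_ bt _] := tauP.
exists (fun k => shc (q k) s (r1 k) + r2 k + sg k (tau k (psi k) + hN k *: r1 k)).
  apply: bfamD; first exact: bfamD (bs _ br1) br2.
  by apply: (bg (fun k => tau k (psi k) + hN k *: r1 k)); exact: bfamD (bt _ hp) (bfam_hkZ br1).
move=> k; rewrite E2 E1 (linearfD _ _ (ls k)) (linearfZ _ _ (ls k)) (linearfD _ _ (ls k)) (linearfZ _ _ (ls k)).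
rewrite [sg k (shc _ _ _ + _)](linearfD _ _ (lg k)) (linearfZ _ _ (lg k)).
have -> : shc (q k) (fun psi => s (t psi)) (psi k) = shc (q k) s (shc (q k) t (psi k)).
  by rewrite /shc translVK.
set a := shc (q k) s (shc _ _ _); set b := shc _ _ _; set c := shc _ _ _.
set d := sg _ _; set u := sg _ _; set v := r2 _; set w := hN k.
rewrite -addrA; congr (a + _); rewrite -scalerDr; congr (w *: _).
rewrite !scalerDr -!addrA; congr (b + _); rewrite (addrCA (w *: c) d); congr (d + _).
by rewrite [w *: u + _]addrC.
Qed.

Lemma jet_eq X Y s s' : (forall k psi, X k psi = Y k psi) -> jet X s s' -> jet Y s s'.
Proof.
move=> XY [hs [sg sgP h]]; split=> //; exists sg => // psi /h[r br E]; exists r => // k.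
by rewrite -XY.
Qed.

Lemma jet_eqs X s s' t t' : s =1 t -> s' =1 t' -> jet X s s' -> jet X t t'.
Proof. by move=> /funext <- /funext <-. Qed.

Lemma jetD X s s' Y t t' : jet X s s' -> jet Y t t' ->
  jet (fun k psi => X k psi + Y k psi) (fun psi => s psi + t psi) (fun psi => s' psi + t' psi).
Proof.
move=> [hs [sg sgP hX]] [ht [tau tauP hY]]; split; first exact: hatD.
exists (fun k psi => sg k psi + tau k psi); first exact: tameD.
move=> psi hp; have [r1 br1 E1] := hX _ hp; have [r2 br2 E2] := hY _ hp.
exists (fun k => r1 k + r2 k) => [|k]; first exact: bfamD.
rewrite E1 E2 shcD [LHS]addrACA; congr (_ + _); rewrite -scalerDr; congr (_ *: _).
by rewrite addrACA -scalerDr.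
Qed.

Lemma jetZ (c : R[i]) X s s' : jet X s s' ->
  jet (fun k psi => c *: X k psi) (fun psi => c *: s psi) (fun psi => c *: s' psi).
Proof.
move=> [hs [sg sgP hX]]; split; first exact: hatZ.
exists (fun k psi => c *: sg k psi); first exact: tame_cstZ.
move=> psi hp; have [r br E] := hX _ hp; exists (fun k => c *: r k) => [|k].
  by apply: (@bfamZ _ _ _ _ (fun=> c) (cnorm c)).
rewrite E shcZ scalerDr; congr (_ + _); rewrite scalerA mulrC -scalerA scalerDr; congr (_ *: (_ + _)).
by rewrite !scalerA mulrC.
Qed.

Lemma jet_hat s : hat s -> jet (fun k => shc (q k) s) s (fun=> 0).
Proof.
move=> hs; split=> //; exists (fun _ _ => 0); first exact: tame0.
by move=> psi _; exists (fun=> 0) => [|k]; [exact: bfam_cst|rewrite !scaler0 !addr0 scaler0 addr0].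
Qed.

Lemma shc_id p (psi : S) : shc p id psi = psi.
Proof. exact: translK. Qed.

Lemma shc0 p (psi : S) : shc p (fun=> 0) psi = 0.
Proof. by rewrite /shc linear0. Qed.

Lemma jet_id : jet (fun _ psi => psi) id (fun=> 0).
Proof. by apply: jet_eq (jet_hat (hat_id _)) => k psi; exact: shc_id. Qed.

Lemma jet0 : jet (fun _ _ => 0) (fun=> 0) (fun=> 0).
Proof. by apply: jet_eq (jet_hat (hat0 _)) => k psi; exact: shc0. Qed.

Lemma jet_sum (I : Type) (r : seq I) (X : I -> nat -> S -> S) (s s' : I -> S -> S) :
  (forall i, jet (X i) (s i) (s' i)) ->
  jet (fun k psi => \sum_(i <- r) X i k psi) (fun psi => \sum_(i <- r) s i psi)
      (fun psi => \sum_(i <- r) s' i psi).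
Proof.
move=> h; elim: r => [|i r IH].
  by apply: jet_eqs (jet_eq _ jet0) => [psi|psi|k psi]; rewrite big_nil.
by apply: jet_eqs (jet_eq _ (jetD (h i) IH)) => [psi|psi|k psi]; rewrite big_cons.
Qed.

Lemma jet_hZ X s s' : jet X s s' -> jet (fun k psi => hN k *: X k psi) (fun=> 0) s.
Proof.
move=> [hs [sg [lg bg cg] hX]]; split; first exact: hat0.
exists (fun k => shc (q k) s); first exact: tame_shc.
move=> psi hp; have [r br E] := hX _ hp.
exists (fun k => sg k (psi k) + hN k *: r k) => [|k]; first exact: bfamD (bg _ hp) (bfam_hkZ br).
by rewrite E shc0 add0r.
Qed.

Lemma jet_hXZ m X s s' : jet X s s' -> exists s'', jet (fun k psi => hN k ^+ m.+1 *: X k psi) (fun=> 0) s''.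
Proof.
move=> jX; elim: m => [|m [s'' IH]]; first by exists s; apply: jet_eq (jet_hZ jX) => k psi; rewrite expr1.
by exists (fun=> 0); apply: jet_eq (jet_hZ IH) => k psi; rewrite scalerA -exprS.
Qed.

Lemma jet_lim X s s' psi phi : jet X s s' -> stend psi phi -> stend (fun k => X k (psi k)) (s phi).
Proof.
move=> [/tame_shc[_ _ h] [sg [_ bg _] hX]] hp; have [r br E] := hX _ hp.1.
apply: stend_eq (fun k => esym (E k)) _; rewrite -[s phi]addr0; apply: stendD (h _ _ hp) _.
exact: stend_hkZ (bfamD (bg _ hp.1) (bfam_hkZ br)).
Qed.

Lemma jet_unique X s s' t t' : jet X s s' -> jet X t t' -> s =1 t /\ s' =1 t'.
Proof.
move=> jX jY; have st psi : s psi = t psi.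
  exact: stend_unique (jet_lim jX (stend_cst psi)) (jet_lim jY (stend_cst psi)).
split=> // psi; have [_ [sg [_ bg cg] hX]] := jX; have [_ [tau [_ bt ct] hY]] := jY.
have hp := stend_cst psi; have [r br E] := hX _ hp.1; have [r' br' E'] := hY _ hp.1.
have main k : sg k psi + hN k *: r k = tau k psi + hN k *: r' k.
  have := E k; rewrite E' /shc st => /addrI /(congr1 (fun v => (Nn k)%:R%:C *: v)).
  rewrite !scalerA /hN -rmorphM mulfV ?Nn_neq0// rmorph1 !scale1r => ->//.
have lim0 (u : nat -> S) v w : stend u w -> bfam v -> stend (fun k => u k + hN k *: v k) w.
  move=> hu hv; have jh := stend_hkZ hv.
  by rewrite -[w]addr0; exact: stendD.
apply: stend_unique (lim0 _ _ _ (cg _ _ hp) br) _.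
by apply: stend_eq (fun k => esym (main k)) _; apply: lim0 (ct _ _ hp) br'.
Qed.

(** Translation adds [q_l = N xi_l + veps] to [Dop l]. Division by [N] leaves [xi_l] exactly, while
    [veps], tending to 0, disappears from the limit of the first-order part. *)
Lemma jet_Dop l : jet (fun k psi => hN k *: shc (q k) (Dop l) psi) (fun psi => (xi 0 l)%:C *: psi) (Dop l).
Proof.
split; first exact: hatZ (hat_id _).
exists (fun k psi => Dop l psi + (eps k l)%:C *: psi).
  have t1 : tame (fun _ psi => psi) id by split.
  have := tameD (tame_Dop l) (tameZ (eps_le1^~ l) (@eps0 l) t1).
  by congr tame; apply/funext => psi; rewrite scale0r addr0.
move=> psi hp; exists (fun=> 0) => [|k]; first exact: bfam_cst.
have -> : shc (q k) (Dop l) (psi k) = Dop l (psi k) + (q k 0 l)%:~R *: psi k.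
  by rewrite /shc Dop_transl translK.
rewrite scaler0 addr0 shcZ shc_id !scalerDr addrCA; congr (_ + _).
rewrite !scalerA -scalerDl; congr (_ *: _); rewrite /hN -rmorphM /veps.
rewrite -[(q k 0 l)%:~R](rmorph_int (real_complex R)) -rmorphM -rmorphD; congr (_%:C).
by rewrite mulrBr mulrA mulVf ?Nn_neq0// mul1r subrKC.
Qed.

End Jets.

Section SymbolJets.
Context {R : realType} {n N : nat}.
Variable theta : 'M[R]_n.
Hypothesis thetaT : theta^T = - theta.
Local Notation Z := 'rV[int]_n.
Local Notation S := (sspinor R n N).
Local Notation op := (@operator R n N).
Local Notation hat := (@hat R n N theta).

Definition recurrent (xi : 'rV[R]_n) (Nn : nat -> nat) (q : nat -> Z) :=
  [/\ forall k, (k < Nn k)%N, forall k j, `|veps xi Nn q k j| <= k.+1%:R^-1 &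
      forall r, ctend (fun k => phase theta r (q k)) 1].

Lemma in_hat_hat (X : op) : in_hat theta X -> exists2 Y : S -> S, hat Y & forall psi : S, X psi = Y psi.
Proof. by move=> /in_hat_words[ws h]; exists (hop ws) => //; exists ws. Qed.

Lemma homogeneous_hat e (h : 'rV[R]_n -> op) xi : homogeneous theta e h -> xi != 0 ->
  exists2 Y : S -> S, hat Y & forall psi : S, h xi psi = Y psi.
Proof. by move=> [hs _ _] xi0; have [/in_hat_hat] := hs [::] xi xi0. Qed.

Lemma homogeneous_dhat e (h : 'rV[R]_n -> op) xi : homogeneous theta e h -> xi != 0 ->
  exists2 Y : 'I_n -> S -> S, forall l, hat (Y l) & forall l (psi : S), dxi l h xi psi = Y l psi.
Proof.
move=> [hs _ _] xi0.
have /choice[Y hY] l : exists Y : S -> S, hat Y /\ forall psi : S, dxi l h xi psi = Y psi.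
  by have [/in_hat_hat[Y h1 h2] _] := hs [:: l] xi xi0; exists Y.
by exists Y => l; have [] := hY l.
Qed.

(** The sum over [l] is the term of the composition formula with one derivative in [xi], here with
    the derivation acting on the argument. *)
Lemma symbol_jet (P : S -> S) (P' : op) d s e xi :
  has_symbol theta P' d s -> (forall psi : S, P' psi = P psi) ->
  (forall e' (eta : 'rV[R]_n), e < e' -> eta != 0 -> op_eq (s e' eta) (fun _ _ => 0)) ->
  2 <= enorm xi ->
  exists (t0 t1 : S -> S) (tl : 'I_n -> S -> S),
  [/\ hat t0 /\ forall psi : S, s e xi psi = t0 psi,
      hat t1 /\ forall psi : S, s (e - 1) xi psi = t1 psi,
      forall l, hat (tl l) /\ forall psi : S, dxi l (s e) xi psi = tl l psi &
      forall Nn q, recurrent xi Nn q ->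
        jet theta Nn q (fun k psi => ((Nn k)%:R ^ (- e))%:C *: shc (q k) P psi) t0
          (fun psi => t1 psi + \sum_l tl l (Dop l psi))].
Proof.
move=> [rho [_ rho_bd PE [hom hi] asym]] P'E top xi2.
have xi0 : xi != 0 by rewrite -enorm_gt0; apply: lt_le_trans xi2.
have [t0 h0 e0] := homogeneous_hat (hom e) xi0.
have [t1 h1 e1] := homogeneous_hat (hom (e - 1)) xi0.
have [tl hl el] := homogeneous_dhat (hom e) xi0.
exists t0, t1, tl; split=> // Nn q [Ngt qn qr]; split=> //.
have [w0 W0] := h0; have [w1 W1] := h1; have /choice[wl WL] := hl.
have PE' (psi : S) : P psi = quantize rho psi :> spinor by rewrite -P'E; apply: PE; exact: spP.
have S0 (psi : S) : s e xi psi = hop w0 psi by rewrite e0 W0.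
have S1 (psi : S) : s (e - 1) xi psi = hop w1 psi by rewrite e1 W1.
have SL l (psi : S) : dxi l (s e) xi psi = hop (wl l) psi by rewrite el WL.
exists (fun k psi => shc (q k) t1 psi +
   \sum_l (shc (q k) (tl l) (Dop l psi) + (veps xi Nn q k l)%:C *: shc (q k) (tl l) psi)).
  have := tameD (tame_shc thetaT qr h1) (tame_sum (index_enum 'I_n)
     (fun l => tameD (tame_comp (tame_shc thetaT qr (hl l)) (tame_Dop l))
        (tameZ (fun k => eps_le1 qn k l) (@eps0 _ _ _ _ _ qn l) (tame_shc thetaT qr (hl l))))).
  congr tame; apply/funext => psi; congr (_ + _); apply: eq_bigr => l _.
  by rewrite scale0r addr0.
move=> psi hp.
have := expand_operator thetaT rho_bd hom hi asym top PE' xi2 Ngt qn S0 S1 SL hp.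
set r := (X in bfam X) => br; exists r => // k.
have -> : hN Nn k *: (shc (q k) t1 (psi k) + \sum_l (shc (q k) (tl l) (Dop l (psi k)) +
    (veps xi Nn q k l)%:C *: shc (q k) (tl l) (psi k)) + hN Nn k *: r k) =
  hN Nn k *: (shc (q k) (hop w1) (psi k) + \sum_l (shc (q k) (hop (wl l)) (Dop l (psi k)) +
    (veps xi Nn q k l)%:C *: shc (q k) (hop (wl l)) (psi k))) + (hN Nn k * hN Nn k) *: r k.
  rewrite -scalerA -scalerDr; congr (_ *: (_ + _ + _)); first by rewrite /shc W1.
  by apply: eq_bigr => l _; rewrite /shc !WL.
rewrite /r scalerA /hN -!rmorphM /=.
have -> : (Nn k)%:R^-1 * (Nn k)%:R^-1 * (Nn k)%:R ^+ 2 = 1 :> R by field; exact: (Nn_neq0 Ngt k).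
have -> : shc (q k) t0 (psi k) = shc (q k) (hop w0) (psi k) by rewrite /shc W0.
by rewrite scale1r addrA subrKC.
Qed.

End SymbolJets.

(** * Operators killed by the trace *)

Section NullOperators.
Context {R : realType} {n N : nat}.
Variable theta : 'M[R]_n.
Hypothesis thetaT : theta^T = - theta.
Hypothesis theta_irr : strictly_irrational theta.
Local Notation Z := 'rV[int]_n.
Local Notation A := (ncalg theta).
Local Notation S := (sspinor R n N).
Local Notation word := (@word R n N theta).
Local Notation hat := (@hat R n N theta).
Local Notation trv := (@trv R n theta N).
Variables (k h : A).
Hypothesis kh : k * h = 1.
Hypothesis hk : h * k = 1.
Hypothesis k_pos : forall a : Z -> R[i], smooth a -> 0 <= csum (fun m => (a m)^* * Defs.mulA theta a k m).
Local Notation pw := (pw k h).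

(* Finite sums of words a b^o M where b is a power of k; h is the inverse of k. *)
Inductive pword : (S -> S) -> Prop :=
| pword0 : pword (fun=> 0)
| pword_cons (w : word) X : pw w.1.2 -> pword X -> pword (fun psi => wop w psi + X psi)
| pword_eq X Y : X =1 Y -> pword X -> pword Y.

Lemma pword_hat X : pword X -> hat X.
Proof.
elim=> [|w {}X _ _|{}X Y XY _]; [exact: hat0|exact: hatD (hat_wop _)|exact: hat_eq].
Qed.

Lemma pwordD X Y : pword X -> pword Y -> pword (fun psi => X psi + Y psi).
Proof.
move=> hX hY; elim: hX => [|w {}X pww _ IH|{}X X' XX _].
- by apply: pword_eq hY => psi; rewrite add0r.
- by apply: pword_eq (pword_cons pww IH) => psi; rewrite addrA.
- by apply: pword_eq => psi; rewrite XX.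
Qed.

Lemma pword_sum (I : Type) (r : seq I) (X : I -> S -> S) : (forall i, pword (X i)) ->
  pword (fun psi => \sum_(i <- r) X i psi).
Proof.
move=> hX; elim: r => [|i r IH]; first by apply: pword_eq pword0 => psi; rewrite big_nil.
by apply: pword_eq (pwordD (hX i) IH) => psi; rewrite big_cons.
Qed.

Lemma pword_wop (w : word) : pw w.1.2 -> pword (wop w).
Proof. by move=> h1; apply: pword_eq (pword_cons h1 pword0) => psi; rewrite addr0. Qed.

Lemma pword_Lop (a : A) : pword (Lop a).
Proof.
by apply: pword_eq (@pword_wop (a, 1, 1%:M) (pw1 k h)) => psi; rewrite /wop /= Mop_scalar scale1r Rop1.
Qed.

Lemma pword_Rop (b : A) : pw b -> pword (Rop b).
Proof.
by move=> hb; apply: pword_eq (@pword_wop (1, b, 1%:M) hb) => psi; rewrite /wop /= Mop_scalar scale1r Lop1.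
Qed.

Lemma pword_Mop M : pword (Mop M).
Proof.
by apply: pword_eq (@pword_wop (1, 1, M) (pw1 k h)) => psi; rewrite /wop /= Rop1 Lop1.
Qed.

Lemma pword_id : pword id.
Proof. by apply: pword_eq (pword_Mop 1%:M) => psi; rewrite Mop_scalar scale1r. Qed.

Lemma pword_comp X Y : pword X -> pword Y -> pword (fun psi => X (Y psi)).
Proof.
move=> hX hY; elim: hX => [|w {}X pww _ IH|{}X X' XX _ IH]; first exact: pword0.
- apply: pwordD IH; elim: hY => [|w' {}Y pww' _ IH|{}Y Y' YY _ IH].
  + by apply: pword_eq pword0 => psi; rewrite linear0.
  + have p : pw (wmul w w').1.2 by exact: pwM.
    by apply: pword_eq (pwordD (pword_wop p) IH) => psi; rewrite wop_mul linearD.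
  + by apply: pword_eq IH => psi; rewrite YY.
- by apply: pword_eq IH => psi.
Qed.

Lemma pwordZ c X : pword X -> pword (fun psi => c *: X psi).
Proof. by move=> hX; apply: pword_eq (pword_comp (pword_Mop c%:M) hX) => psi; rewrite Mop_scalar. Qed.

Lemma hat_linear X : hat X -> linear X.
Proof. by move=> [ws hX] c u v; rewrite !hX linearP. Qed.

(** Testing against all [a M k^z], rather than requiring a vanishing trace, gives a class stable
    under multiplication by [pword] operators on the left and by powers of [k] on the right. *)
Definition tnul (X : S -> S) := hat X /\ forall (a : A) w M, pw w ->
  trv (fun psi => Lop a (Mop M (Rop w (X psi)))) 0.

Lemma tnul_eq X Y : X =1 Y -> tnul X -> tnul Y.
Proof. by move=> /funext <-. Qed.

Lemma tnul0 : tnul (fun=> 0).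
Proof.
split=> [|a w M _]; first exact: hat0.
by exists [::] => [psi|]; rewrite /hop ?/trw !big_nil// !linear0.
Qed.

Lemma tnulD X Y : tnul X -> tnul Y -> tnul (fun psi => X psi + Y psi).
Proof.
move=> [hX tX] [hY tY]; split=> [|a w M pww]; first exact: hatD.
rewrite -[X in trv _ X]addr0; apply: trv_eq (trvD (tX a w M pww) (tY a w M pww)) => psi.
by rewrite !linearD.
Qed.

Lemma tnul_wop (w : word) X : pw w.1.2 -> tnul X -> tnul (fun psi => wop w (X psi)).
Proof.
move=> pww [hX tX]; split=> [|a v M pwv]; first exact: hat_comp (hat_wop w) hX.
apply: trv_eq (tX (a * w.1.1) (w.1.2 * v) (M *m w.2) (pwM kh hk pww pwv)) => psi.
by rewrite /wop LopM RopM MopM -Lop_Rop Mop_Lop -!Mop_Rop.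
Qed.

Lemma tnul_pword X Y : pword Y -> tnul X -> tnul (fun psi => Y (X psi)).
Proof.
move=> hY hX; elim: hY => [|w {}Y pww _ IH|{}Y Y' YY _ IH]; first exact: tnul0.
- exact: tnulD (tnul_wop pww hX) IH.
- by apply: tnul_eq IH => psi.
Qed.

Lemma tnul_Rop X v : tnul X -> pw v -> tnul (fun psi => X (Rop v psi)).
Proof.
move=> [hX tX] pwv; split=> [|a w M pww]; first by apply: (hat_comp hX); exact: hat_Rop.
apply: (trv_cyc thetaT theta_irr (X := fun psi => Rop w (X psi))).
  by apply: (hat_comp (hat_Rop _) hX).
by apply: trv_eq (tX a (w * v) M (pwM kh hk pww pwv)) => psi; rewrite RopM.
Qed.

(** The trace factorizes, and its [A^o] factor is [tau] of a power of [k] times the derivative of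
    another. *)
Lemma tnul_der l v : pw v -> tnul (Rop (nder l v)).
Proof.
move=> pwv; split=> [|a w M pww]; first exact: hat_Rop.
have e : (nder l v * w : A) 0 = 0 by rewrite tauC// (tau_pw thetaT kh hk k_pos l pww pwv).
have z : a 0 * (nder l v * w : A) 0 * \tr M = 0 by rewrite e mulr0 mul0r.
rewrite -z; apply: trv_eq (trv_wop (a, nder l v * w, M)) => psi; by rewrite /wop /= RopM -!Mop_Rop.
Qed.

Lemma tnul_sum (I : Type) (r : seq I) (X : I -> S -> S) : (forall i, tnul (X i)) ->
  tnul (fun psi => \sum_(i <- r) X i psi).
Proof.
move=> hX; elim: r => [|i r IH]; first by apply: tnul_eq tnul0 => psi; rewrite big_nil.
by apply: tnul_eq (tnulD (hX i) IH) => psi; rewrite big_cons.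
Qed.

(* First-order operators whose part of order zero is killed by the trace once
   all derivations have been moved to the right. *)
Definition onf (X : S -> S) := exists (X0 : S -> S) (Y : 'I_n -> S -> S),
  [/\ tnul X0, forall l, pword (Y l) & forall psi, X psi = X0 psi + \sum_l Y l (Dop l psi)].

Lemma onf_eq X Y : X =1 Y -> onf X -> onf Y.
Proof. by move=> /funext <-. Qed.

Lemma onf_tnul X : tnul X -> onf X.
Proof.
move=> hX; exists X, (fun _ _ => 0); split=> // [l|psi]; first exact: pword0.
by rewrite big1 ?addr0.
Qed.

Lemma onfD X Y : onf X -> onf Y -> onf (fun psi => X psi + Y psi).
Proof.
move=> [X0 [X1 [h1 h2 E]]] [Y0 [Y1 [g1 g2 F]]].
exists (fun psi => X0 psi + Y0 psi), (fun l psi => X1 l psi + Y1 l psi); split.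
- exact: tnulD.
- by move=> l; exact: pwordD.
- by move=> psi; rewrite E F addrACA -big_split.
Qed.

Lemma onf_sum (I : Type) (r : seq I) (X : I -> S -> S) : (forall i, onf (X i)) ->
  onf (fun psi => \sum_(i <- r) X i psi).
Proof.
move=> hX; elim: r => [|i r IH].
  by apply: onf_eq (onf_tnul tnul0) => psi; rewrite big_nil.
by apply: onf_eq (onfD (hX i) IH) => psi; rewrite big_cons.
Qed.

Lemma onf_Dop l : onf (Dop l).
Proof.
exists (fun=> 0), (fun l' psi => if l' == l then psi else 0); split; first exact: tnul0.
  by move=> l'; case: (l' == l); [exact: pword_id|exact: pword0].
by move=> psi; rewrite add0r -big_mkcond big_pred1_eq.
Qed.

Lemma onf_pword X Y : pword Y -> onf X -> onf (fun psi => Y (X psi)).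
Proof.
move=> hY [X0 [X1 [h1 h2 E]]]; have lY := hat_linear (pword_hat hY).
exists (fun psi => Y (X0 psi)), (fun l psi => Y (X1 l psi)); split.
- exact: tnul_pword.
- by move=> l; exact: pword_comp.
- move=> psi; rewrite E (linearfD _ _ lY); congr (_ + _).
  by apply: (big_morph Y) => [u v|]; [exact: linearfD|have := linearfZ 0 0 lY; rewrite !scale0r].
Qed.

Lemma onfZ c X : onf X -> onf (fun psi => c *: X psi).
Proof. by move=> hX; apply: onf_eq (onf_pword (pwordZ c pword_id) hX). Qed.

(** Moving [Dop l] to the right of [Rop v] creates the term [Rop (nder l v)] of order zero, which
    [tnul_der] disposes of. *)
Lemma onf_Rop X v : onf X -> pw v -> onf (fun psi => X (Rop v psi)).
Proof.
move=> [X0 [X1 [h1 h2 E]]] pwv.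
exists (fun psi => X0 (Rop v psi) + \sum_l X1 l (Rop (nder l v) psi)), (fun l psi => X1 l (Rop v psi)); split.
- apply: tnulD; first exact: tnul_Rop.
  by apply: tnul_sum => l; apply: tnul_pword (h2 l) (tnul_der l pwv).
- by move=> l; apply: pword_comp (h2 l) (pword_Rop pwv).
- move=> psi; rewrite E -addrA; congr (_ + _); rewrite -big_split; apply: eq_bigr => l _.
  by rewrite Dop_Rop (linearfD _ _ (hat_linear (pword_hat (h2 l)))) addrC.
Qed.

Lemma hat_shc_lin X p : hat X -> linear (shc p X).
Proof. by move=> /hat_linear h1 c u v; rewrite /shc linearP h1 linearP. Qed.

(* The coefficients of the derivations are the leading terms of the jets along
   the coordinate directions. *)
Lemma onf_hat X : hat X -> onf X -> tnul X.
Proof.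
move=> hX [X0 [Y [t0 hY E]]]; have [h0 _] := t0.
suff Y0 l psi : Y l psi = 0.
  by apply: tnul_eq t0 => psi; rewrite E big1 ?addr0.
have [Nn [q [N1 N2 N3]]] := recurrence theta (delta_mx 0 l : 'rV[R]_n).
have lY j := hat_linear (pword_hat (hY j)).
have j1 : jet theta Nn q _ _ _ := jet_sum (index_enum 'I_n) (fun j =>
  jet_comp thetaT N1 N3 (jet_hat Nn q (pword_hat (hY j))) (jet_Dop theta N1 N2 j)).
have j2 : jet theta Nn q _ _ _ := jet_hZ thetaT N1 N3 (jetD (jet_hat Nn q hX) (jetZ (-1) (jet_hat Nn q h0))).
have E0 r (chi : S) : hN Nn r *: (shc (q r) X chi + -1 *: shc (q r) X0 chi) =
    \sum_i shc (q r) (Y i) (hN Nn r *: shc (q r) (Dop i) chi).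
  rewrite scaleN1r -linearB /= E addrC addKr -linearZ scaler_sumr /shc linear_sum.
  apply: eq_bigr => i _; congr (transl _ _); rewrite -(linearfZ _ _ (lY i)); congr (Y i _).
  by rewrite [RHS]linearZ /= translVK.
have [E1 _] := jet_unique thetaT N1 N3 j1 (jet_eq E0 j2).
have := E1 psi; rewrite (bigD1 l)//= big1 => [|j jl]; last first.
  by rewrite mxE eqxx (negbTE jl) scale0r; have := linearfZ 0 0 (lY j); rewrite !scale0r.
by rewrite mxE !eqxx scale1r addr0.
Qed.

End NullOperators.

(** * The conformally rescaled Dirac operator and its modulus *)

Section ConformalDirac.
Context {R : realType} {n N : nat}.
Variable theta : 'M[R]_n.
Hypothesis thetaT : theta^T = - theta.
Hypothesis theta_irr : strictly_irrational theta.
Local Notation Z := 'rV[int]_n.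
Local Notation A := (ncalg theta).
Local Notation S := (sspinor R n N).
Variable gamma : 'I_n -> 'M[R[i]]_N.
Hypothesis gammaP : gamma_matrices gamma.
Variables (k h : A).
Hypothesis kh : k * h = 1.
Hypothesis hk : h * k = 1.
Hypothesis k_pos : forall a : Z -> R[i], smooth a -> 0 <= csum (fun m => (a m)^* * Defs.mulA theta a k m).
Local Notation pw := (pw k h).
Local Notation onf := (@onf R n N theta k h).
Local Notation pword := (@pword R n N theta k h).

Definition Dflat (psi : S) : S := \sum_j Mop (gamma j) (Dop j psi).

Definition Dk (psi : S) : S := Rop k (Dflat (Rop k psi)).

Fact Dflat_linear : linear Dflat.
Proof.
move=> c u v; rewrite /Dflat scaler_sumr -big_split; apply: eq_bigr => j _.
by rewrite !linearP.
Qed.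
HB.instance Definition _ := GRing.isLinear.Build R[i] S S *:%R Dflat Dflat_linear.

Fact Dk_linear : linear Dk.
Proof. by move=> c u v; rewrite /Dk !linearP. Qed.
HB.instance Definition _ := GRing.isLinear.Build R[i] S S *:%R Dk Dk_linear.

Lemma DflatE (psi : S) : Defs.dirac gamma psi = Dflat psi.
Proof. by apply/funext => m; rewrite /Defs.dirac /Dflat ssp_sumE. Qed.

Lemma conformal_diracE (psi : S) : conformal_dirac theta gamma k psi = Dk psi.
Proof. by rewrite /conformal_dirac -[rmul theta k psi]/(spv (Rop k psi)) DflatE. Qed.

Lemma Dflat_sym (phi psi : S) : inner (Dflat phi) psi = inner phi (Dflat psi).
Proof.
have innerE (I : Type) (r : seq I) (F : I -> S) (chi : S) :
    inner (\sum_(i <- r) F i) chi = \sum_(i <- r) inner (F i) chi.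
  by apply: (big_morph (fun u : S => inner u chi)) => [u v|]; [exact: innerDl|exact: inner0l].
have innerF (I : Type) (r : seq I) (F : I -> S) (chi : S) :
    inner chi (\sum_(i <- r) F i) = \sum_(i <- r) inner chi (F i).
  by apply: (big_morph (fun u : S => inner chi u)) => [u v|]; [exact: innerDr|exact: inner0r].
rewrite /Dflat innerE innerF; apply: eq_bigr => j _.
by rewrite inner_Mop ?inner_Dop ?Dop_Mop// gammaP.1.
Qed.

Lemma Dk_sym (phi psi : S) : inner (Dk phi) psi = inner phi (Dk psi).
Proof. by rewrite /Dk !(inner_Ropk k_pos) Dflat_sym (inner_Ropk k_pos). Qed.

Lemma onf_Mop_Dop M j : onf (fun psi => Mop M (Dop j psi)).
Proof. exact: (onf_pword kh hk (pword_Mop k h M) (onf_Dop k h j)). Qed.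

Lemma onf_Dk : onf Dk.
Proof.
apply: (onf_pword kh hk (pword_Rop (pwk k h))).
apply: (onf_Rop thetaT theta_irr kh hk k_pos _ (pwk k h)); apply: onf_sum => j.
exact: onf_Mop_Dop.
Qed.

Definition Gam (xi : 'rV[R]_n) : 'M[R[i]]_N := \sum_j (xi 0 j)%:C *: gamma j.

Lemma Gam_sqr xi : Gam xi *m Gam xi = ((enorm xi ^+ 2)%:C)%:M.
Proof.
have E : Gam xi *m Gam xi = \sum_i \sum_j ((xi 0 i)%:C * (xi 0 j)%:C) *: (gamma i *m gamma j).
  rewrite /Gam mulmx_suml; apply: eq_bigr => i _; rewrite mulmx_sumr; apply: eq_bigr => j _.
  by rewrite -scalemxAl -scalemxAr scalerA.
have : Gam xi *m Gam xi + Gam xi *m Gam xi = (2 : R[i]) *: ((enorm xi ^+ 2)%:C)%:M.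
  rewrite {2}E exchange_big /= E -big_split /= sqr_enorm rmorph_sum /=.
  rewrite [RHS]scale_scalar_mx mulr_sumr raddf_sum; apply: eq_bigr => i _.
  rewrite -big_split (bigD1 i)//= big1 ?addr0 => [|j ji].
    by rewrite -scalerDr gammaP.2 eqxx mulr1 scale_scalar_mx rmorphXn /= expr2 mulrC.
  by rewrite [_ * (xi 0 i)%:C]mulrC -scalerDr gammaP.2 eq_sym (negbTE ji) mulr0 raddf0 scaler0.
rewrite -mulr2n -scaler_nat => /(congr1 (fun M => 2^-1 *: M)).
by rewrite !scalerA mulVf ?scale1r// pnatr_eq0.
Qed.

(** The leading symbol of [Dk] at [xi]; by the Clifford relations its square is [|xi|^2 k^4] without
    matrices. *)
Definition kap (xi : 'rV[R]_n) (psi : S) : S := Rop (k * k) (Mop (Gam xi) psi).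

Lemma kapE xi psi : kap xi psi = Rop k (\sum_j Mop (gamma j) ((xi 0 j)%:C *: Rop k psi)).
Proof.
rewrite /kap RopM -Mop_Rop /Gam Mop_sum; congr (Rop k _); apply: eq_bigr => j _.
by rewrite MopZ linearZ.
Qed.

Lemma kapZ t xi psi : kap (t *: xi) psi = t%:C *: kap xi psi.
Proof.
have G : Gam (t *: xi) = t%:C *: Gam xi.
  by rewrite /Gam [RHS]scaler_sumr; apply: eq_bigr => j _; rewrite mxE rmorphM scalerA.
rewrite /kap G MopZ; exact: linearZ.
Qed.

Lemma kapZr c xi psi : kap xi (c *: psi) = c *: kap xi psi.
Proof. by rewrite /kap !linearZ. Qed.

Lemma kap_sum xi psi : kap xi psi = \sum_j (xi 0 j)%:C *: Rop (k * k) (Mop (gamma j) psi).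
Proof.
rewrite /kap /Gam Mop_sum linear_sum; apply: eq_bigr => j _.
by rewrite MopZ linearZ.
Qed.

Lemma pword_kap xi : pword (kap xi).
Proof.
by apply: pword_comp => //; [apply: pword_Rop; apply: pwM => //; exact: pwk | exact: pword_Mop].
Qed.

Lemma kap_sqr xi psi : kap xi (kap xi psi) = (enorm xi ^+ 2)%:C *: Rop (k * k) (Rop (k * k) psi).
Proof. by rewrite /kap Mop_Rop -MopM Gam_sqr Mop_scalar !linearZ. Qed.

Lemma jet_Dk xi Nn q : recurrent theta xi Nn q ->
  jet theta Nn q (fun m psi => hN Nn m *: shc (q m) Dk psi) (kap xi) Dk.
Proof.
move=> [Ngt qn qr].
have jR := jet_hat Nn q (hat_Rop (N := N) k).
have jS := jet_sum (index_enum 'I_n) (fun j =>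
   jet_comp thetaT Ngt qr (jet_hat Nn q (hat_Mop theta (gamma j))) (jet_Dop theta Ngt qn j)).
have J := jet_comp thetaT Ngt qr jR (jet_comp thetaT Ngt qr jS jR).
apply: jet_eqs (jet_eq _ J) => [psi|psi|m psi].
- by rewrite kapE.
- rewrite addr0 /Dk /Dflat; congr (Rop k _); rewrite [X in X + _]big1 ?add0r => [|j _].
    by apply: eq_bigr => j _; rewrite addr0.
  by rewrite scaler0 linear0.
- rewrite /shc !translVK -linearZ; congr (transl _ _); rewrite /Dk -linearZ; congr (Rop k _).
  rewrite /Dflat scaler_sumr linear_sum; apply: eq_bigr => j _.
  rewrite [LHS]translVK; transitivity (Mop (gamma j) (hN Nn m *: Dop j (Rop k (transl (q m) psi)))); last exact: linearZ.
  congr (Mop _ _); by rewrite [LHS]linearZ /= translVK.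
Qed.

Lemma onf_Dk_kap xi : onf (fun psi => Dk (kap xi psi)).
Proof.
have pK : pw (k * k * k) by do 2?apply: pwM => //; exact: pwk.
apply: (@onf_eq _ _ _ _ _ _ (fun psi => Rop k (\sum_j Mop (gamma j *m Gam xi) (Dop j (Rop (k * k * k) psi))))).
  move=> psi; rewrite /Dk /kap /Dflat; congr (Rop k _); apply: eq_bigr => j _.
  by rewrite MopM -Dop_Mop !Mop_Rop RopM.
apply: (onf_pword kh hk (pword_Rop (pwk k h))).
apply: (onf_Rop thetaT theta_irr kh hk k_pos (X := fun psi => \sum_j Mop (gamma j *m Gam xi) (Dop j psi)) _ pK).
by apply: onf_sum => j; exact: onf_Mop_Dop.
Qed.

(** [k] commutes with the left action, so [[D_k, b]] is the sum of the [k gamma^j delta_j(b) k]: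
    neither a derivation nor a derivative of [k] is left. *)
Lemma one_form_pword (u : @operator R n N) : one_form theta (conformal_dirac theta gamma k) u ->
  exists2 U : S -> S, pword U & forall psi : S, u psi = U psi.
Proof.
move=> [r [a [b [c [abc uE]]]]].
pose a' t : A := NCAlg theta (let: And3 x _ _ := abc t in x).
pose b' t : A := NCAlg theta (let: And3 _ x _ := abc t in x).
pose c' t : A := NCAlg theta (let: And3 _ _ x := abc t in x).
pose V (t : 'I_r) (psi : S) : S := Dk (Lop (b' t) psi) - Lop (b' t) (Dk psi).
have VE t psi : V t psi = Rop k (\sum_j Mop (gamma j) (Lop (nder j (b' t)) (Rop k psi))).
  have DL (chi : S) : Dflat (Lop (b' t) chi) =
      Lop (b' t) (Dflat chi) + \sum_j Mop (gamma j) (Lop (nder j (b' t)) chi).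
    rewrite /Dflat linear_sum -big_split; apply: eq_bigr => j _.
    by rewrite Dop_Lop linearD /= Mop_Lop.
  by rewrite /V /Dk -[Rop k (Lop _ psi)]Lop_Rop DL linearD /= -[Rop k (Lop _ (Dflat _))]Lop_Rop addrC addKr.
exists (fun psi => \sum_t Lop (a' t) (V t (Lop (c' t) psi))).
  apply: pword_sum => t; apply: pword_comp => //; first exact: pword_Lop.
  apply: (pword_comp kh hk (X := V t)); last exact: pword_Lop.
  apply: pword_eq (fun psi => esym (VE t psi)) _; apply: (pword_comp kh hk (pword_Rop (pwk k h))).
  apply: pword_sum => j; apply: (pword_comp kh hk (pword_Mop _ _ _)).
  exact: (pword_comp kh hk (pword_Lop _ _ _) (pword_Rop (pwk k h))).
move=> psi; rewrite uE; last exact: spP.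
apply/funext => m; rewrite ssp_sumE; apply: eq_bigr => t _.
rewrite -[lmul theta (c t) psi]/(spv (Lop (c' t) psi)); set chi := Lop (c' t) psi.
suff -> : comm_op (conformal_dirac theta gamma k) (lmul theta (b t)) chi = V t chi by [].
apply/funext => p; rewrite /comm_op -[lmul theta (b t) chi]/(spv (Lop (b' t) chi)).
by rewrite !conformal_diracE /V sspDE sspNE.
Qed.

End ConformalDirac.

(** * Derivatives of explicit symbols *)

Section SymbolDerivatives.
Context {R : realType} {n N : nat}.
Local Notation S := (sspinor R n N).
Implicit Types (xi : 'rV[R]_n).

Lemma near_neq0 xi : xi != 0 -> \forall eta \near xi, eta != 0.
Proof.
move=> xi0; apply/nbhs_ballP; exists `|xi| => /=; first by rewrite normr_gt0.
by move=> eta; rewrite -ball_normE /=; apply: contraTneq => ->; rewrite subr0 ltxx.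
Qed.

Lemma derivable_coord xi v j : derivable (fun eta : 'rV[R]_n => eta 0 j) xi v.
Proof.
apply/derivable1P; have -> : (fun t : R => (t *: v + xi) 0 j) = (v 0 j \*: id) + cst (xi 0 j).
  by apply/funext => t; rewrite !fctE !mxE mulrC.
by apply: derivableD; [apply: derivableZ; exact: derivable_id|exact: derivable_cst].
Qed.

Lemma derivable_enorm xi v : xi != 0 -> derivable enorm xi v.
Proof.
move=> xi0; apply/derivable1P.
have cd j : derivable (fun t : R => (t *: v + xi) 0 j) 0 1.
  by have [+ _] := derivable1P (fun eta : 'rV[R]_n => eta 0 j) xi v; apply; exact: derivable_coord.
pose g (t : R) := \sum_j (t *: v + xi) 0 j ^+ 2.
have gd : derivable g 0 1.
  have -> : g = \sum_j (fun t : R => (t *: v + xi) 0 j) ^+ 2.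
    by apply/funext => t; rewrite fct_sumE; apply: eq_bigr => j _; rewrite fctE.
  apply: derivable_sum => j; apply: derivableX; exact: cd.
have g0 : 0 < g 0.
  rewrite /g scale0r add0r -sqr_enorm exprn_gt0// enorm_gt0//.
rewrite -[fun t => _]/(Num.sqrt \o g); apply/derivable1_diffP; apply: differentiable_comp.
  exact/derivable1_diffP.
by apply/derivable1_diffP; have [] := is_derive1_sqrt g0.
Qed.

(** The symbols that have to be differentiated, those of leading order of the modulus and of P, are
    combinations of fixed operators with scalar functions as coefficients. *)
Lemma dxi_lincomb m (s : 'rV[R]_n -> @operator R n N) (f : 'I_m -> 'rV[R]_n -> R) (X : 'I_m -> S -> S) xi l :
  xi != 0 ->
  (forall eta (psi : S), eta != 0 -> s eta psi = spv (\sum_j (f j eta)%:C *: X j psi)) ->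
  (forall j, derivable (f j) xi (delta_mx 0 l)) ->
  forall psi : S, dxi l s xi psi = spv (\sum_j ('D_(delta_mx 0 l) (f j) xi)%:C *: X j psi).
Proof.
move=> xi0 sE fd psi; apply/funext => p; apply/colP => i; rewrite mxE ssp_sumE summxE.
have near (g : R[i] -> R) (gE : forall (a : R) z, g (a%:C * z) = a * g z)
   (gS : forall F : 'I_m -> R[i], g (\sum_j F j) = \sum_j g (F j)) :
   'D_(delta_mx 0 l) (fun eta => g (s eta psi p i 0)) xi =
   \sum_j 'D_(delta_mx 0 l) (f j) xi * g (X j psi p i 0).
  have E : \forall eta \near xi, g (s eta psi p i 0) = (\sum_j (g (X j psi p i 0) \*: f j)) eta.
    near=> eta; rewrite sE; last by near: eta; exact: near_neq0.
    rewrite ssp_sumE summxE gS fct_sumE; apply: eq_bigr => j _.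
    by rewrite sspZE mxE gE mulrC.
  rewrite (near_eq_derive _ E) derive_sum => [|j]; last exact: derivableZ.
  by apply: eq_bigr => j _; rewrite deriveZ// mulrC.
rewrite (near (@complex.Re R)) => [|a z|F]; [|exact: ReMr|exact: Re_sum].
rewrite (near (@complex.Im R)) => [|a z|F]; [|exact: ImMr|exact: Im_sum].
under [RHS]eq_bigr do rewrite sspZE mxE.
by apply/eqP; rewrite eq_complex /= Re_sum Im_sum; apply/andP; split; apply/eqP;
  apply: eq_bigr => j _; rewrite ?ReMr ?ImMr.
Unshelve. all: by end_near.
Qed.

(** The expansions require [2 <= |xi|]; homogeneity then carries their consequences to every nonzero
    [xi]. *)
Lemma scale_enorm xi : xi != 0 -> exists2 t : R, 0 < t & enorm (t *: xi) = 2.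
Proof.
rewrite -enorm_gt0 => x0; exists (2 / enorm xi); first by rewrite divr_gt0.
by rewrite enormZ ger0_norm ?divr_ge0 ?(ltW x0)// divfK// gt_eqF.
Qed.

End SymbolDerivatives.

(** * The first two symbols of the modulus *)

Section Modulus.
Context {R : realType} {n N : nat}.
Variable theta : 'M[R]_n.
Hypothesis thetaT : theta^T = - theta.
Hypothesis theta_irr : strictly_irrational theta.
Local Notation Z := 'rV[int]_n.
Local Notation A := (ncalg theta).
Local Notation S := (sspinor R n N).
Local Notation hat := (@hat R n N theta).
Variable gamma : 'I_n -> 'M[R[i]]_N.
Hypothesis gammaP : gamma_matrices gamma.
Variables (k h : A).
Hypothesis kh : k * h = 1.
Hypothesis hk : h * k = 1.
Hypothesis k_pos : forall a : Z -> R[i], smooth a -> 0 <= csum (fun m => (a m)^* * Defs.mulA theta a k m).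
Local Notation pw := (pw k h).
Local Notation onf := (@onf R n N theta k h).
Local Notation tnul := (@tnul R n N theta k h).
Local Notation pword := (@pword R n N theta k h).
Local Notation Dk := (Dk gamma k).
Local Notation kap := (kap gamma k).
Local Notation K := (k * k).

Lemma pwK : pw K. Proof. by apply: pwM => //; exact: pwk. Qed.

Lemma shc_comp p (X Y : S -> S) psi : shc p X (shc p Y psi) = shc p (fun psi => X (Y psi)) psi.
Proof. by rewrite /shc translVK. Qed.

Lemma shc_linear p (X : {linear S -> S}) : linear (shc p X).
Proof. by move=> c u v; rewrite /shc !linearP. Qed.

Lemma ctend_Re_ge0 (u : nat -> R[i]) l : ctend u l -> (forall m, 0 <= complex.Re (u m)) -> 0 <= complex.Re l.
Proof.
move=> ul u0; rewrite leNgt; apply/negP => l0.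
have [|m /(_ m (leqnn m)) hm] := ul (- complex.Re l / 2); first by rewrite divr_gt0// oppr_gt0.
have := le_trans (Re_le_cnorm _) hm; rewrite ReD ReN => /ler_normlW.
by have := u0 m; move: l0; lra.
Qed.

Lemma Rop_K_lower : exists2 e : R, 0 < e & forall psi : S, e * rip psi psi <= rip psi (Rop K psi).
Proof.
have [M M0 hM] := Rop_bounded (N := N) h.
exists (M ^- 2) => [|psi]; first by rewrite invr_gt0 exprn_gt0.
rewrite RopM -(rip_Ropk k_pos) mulrC ler_pdivrMr ?exprn_gt0//.
have := hM (Rop k psi); rewrite -RopM kh Rop1 => h1.
rewrite -!sqr_nrm mulrC -exprMn lerXn2r ?nnegrE ?nrm_ge0//.
by rewrite mulr_ge0 ?nrm_ge0 ?(ltW M0).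
Qed.

Lemma onfN (X : S -> S) : onf X -> onf (fun psi => - X psi).
Proof. by move=> hX; apply: onf_eq (onfZ kh hk (-1) hX) => psi; rewrite scaleN1r. Qed.

(** Tested against [h^2 w], the two terms of [K X + X K] have the same trace by cyclicity, namely
    that of [X] against [w]; twice this trace is 0. *)
Lemma tnul_anticomm (X : S -> S) : hat X -> tnul (fun psi => Rop K (X psi) + X (Rop K psi)) -> tnul X.
Proof.
move=> hX [_ hE]; split=> // a w M pww.
have hw : pw (h * h * w) by do 2?apply: pwM => //; exact: pwh.
have Kw : h * h * w * K = w.
  rewrite (pw_comm kh hk hw pwK) !mulrA -[k * k * h]mulrA kh mulr1 kh mul1r//.
have hLX : hat (fun psi => Lop a (Mop M (Rop w (X psi)))).
  by apply: (hat_comp (hat_Lop a)); apply: (hat_comp (hat_Mop _ M)); exact: (hat_comp (hat_Rop w)).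
have [x hx] := hat_trv hLX.
have h1 : trv theta (fun psi => Lop a (Mop M (Rop (h * h * w) (Rop K (X psi))))) x.
  by apply: trv_eq hx => psi; rewrite -RopM -(pw_comm kh hk hw pwK) Kw.
have h2 : trv theta (fun psi => Lop a (Mop M (Rop (h * h * w) (X (Rop K psi))))) x.
  apply: (trv_cyc thetaT theta_irr (X := fun psi => Rop (h * h * w) (X psi))).
    exact: (hat_comp (hat_Rop _) hX).
  by apply: trv_eq hx => psi; rewrite -RopM Kw.
have := hE a _ M hw => h3.
have h4 : trv theta (fun psi => Lop a (Mop M (Rop (h * h * w) (Rop K (X psi) + X (Rop K psi))))) (x + x).
  by apply: trv_eq (trvD h1 h2) => psi; rewrite !linearD.
have := trv_unique thetaT theta_irr h3 h4 => /esym/eqP; rewrite -mulr2n mulrn_eq0 /= => /eqP x0.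
by rewrite -x0.
Qed.

Variable T : {linear S -> S}.
Hypothesis T_sym : forall phi psi : S, inner (T phi) psi = inner phi (T psi).
Hypothesis T_pos : forall psi : S, 0 <= inner psi (T psi).
Hypothesis T_sqr : forall psi, T (T psi) = Dk (Dk psi).

Section Jet.
Variables (xi : 'rV[R]_n) (Nn : nat -> nat) (q : nat -> Z) (t0 t' : S -> S).
Hypothesis rec : recurrent theta xi Nn q.
Hypothesis jT : jet theta Nn q (fun m psi => hN Nn m *: shc (q m) T psi) t0 t'.

Lemma modulus_jet_sqr : (forall psi, t0 (t0 psi) = kap xi (kap xi psi)) /\
  (forall psi, t0 (t' psi) + t' (t0 psi) = kap xi (Dk psi) + Dk (kap xi psi)).
Proof.
have [Ngt qn qr] := rec; have jD := jet_Dk thetaT gamma k rec.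
have j1 := jet_comp thetaT Ngt qr jT jT; have j2 := jet_comp thetaT Ngt qr jD jD.
apply: (jet_unique thetaT Ngt qr j1); apply: jet_eq j2 => m psi.
rewrite !(linearfZ _ _ (shc_linear _ _)) !shc_comp; congr (_ *: (_ *: _)).
by rewrite /shc T_sqr.
Qed.

Lemma shc_sym p (phi psi : S) : inner (shc p T phi) psi = inner phi (shc p T psi).
Proof.
by rewrite /shc -(inner_transl p) translVK T_sym -[in RHS](inner_transl p) translVK.
Qed.

(** Translations are unitary, so symmetry and positivity of [T] survive the conjugation and pass to
    the limit [t0]. Both sides are then positive square roots of [|xi|^2 K^2]. *)
Lemma modulus_leading psi : t0 psi = (enorm xi)%:C *: Rop K psi.
Proof.
have [Ngt qn qr] := rec; have [[w t0E] _] := jT.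
have hNr m : conjc (hN Nn m : R[i]) = hN Nn m by rewrite /hN conjc_real.
have lim (phi chi : S) : ctend (fun m => inner phi (hN Nn m *: shc (q m) T chi)) (inner phi (t0 chi)).
  exact: rip_cont (stend_cst phi) (jet_lim thetaT Ngt qr jT (stend_cst chi)).
have liml (phi chi : S) : ctend (fun m => inner (hN Nn m *: shc (q m) T phi) chi) (inner (t0 phi) chi).
  exact: rip_cont (jet_lim thetaT Ngt qr jT (stend_cst phi)) (stend_cst chi).
have sym (phi chi : S) : rip (t0 phi) chi = rip phi (t0 chi).
  rewrite /rip; congr complex.Re; apply: ctend_unique (liml phi chi) _.
  suff -> : (fun m => inner (hN Nn m *: shc (q m) T phi) chi) =
     fun m => inner phi (hN Nn m *: shc (q m) T chi) by exact: lim.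
  by apply/funext => m; rewrite innerZl innerZr shc_sym; congr (_ * _); exact: hNr.
have pos (phi : S) : 0 <= rip phi (t0 phi).
  apply: ctend_Re_ge0 (lim phi phi) _ => m.
  rewrite innerZr ReMr mulr_ge0// /shc -(inner_transl (q m)) translVK.
  by have := T_pos (transl (q m) phi); rewrite lecE => /andP[].
(* At [xi = 0] there is no positive lower bound for uniqueness of the root, but a symmetric operator
   with square 0 vanishes. *)
have [xi0|xi0] := eqVneq (enorm xi) 0.
  have z (phi : S) : t0 phi = 0.
    apply: rip_eq0; rewrite sym modulus_jet_sqr.1 kap_sqr// xi0 expr0n /= scale0r.
    by rewrite /rip inner0r.
  by rewrite z xi0 scale0r.
have c0 : 0 < enorm xi by rewrite lt_def xi0 enorm_ge0.
have [e e0 he] := Rop_K_lower; have [M M0 hM] := Rop_bounded (N := N) ((enorm xi)%:C *: K).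
rewrite t0E -RopZ.
have symK (phi chi : S) : rip (Rop K phi) chi = rip phi (Rop K chi).
  by rewrite !RopM !(rip_Ropk k_pos).
have s1 (phi chi : S) : rip (hop w phi) chi = rip phi (hop w chi) by rewrite -!t0E.
have s2 (phi : S) : 0 <= rip phi (hop w phi) by rewrite -!t0E.
have s3 (phi chi : S) : rip (Rop ((enorm xi)%:C *: K) phi) chi = rip phi (Rop ((enorm xi)%:C *: K) chi).
  by rewrite !RopZ ripZl ripZr symK.
have s4 (phi : S) : enorm xi * e * rip phi phi <= rip phi (Rop ((enorm xi)%:C *: K) phi).
  by rewrite RopZ ripZr -mulrA ler_pM2l.
have s5 (phi : S) : rip (Rop ((enorm xi)%:C *: K) phi) (Rop ((enorm xi)%:C *: K) phi) <= M ^+ 2 * rip phi phi.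
  rewrite -!sqr_nrm -exprMn lerXn2r ?nnegrE ?nrm_ge0//.
  by rewrite mulr_ge0 ?nrm_ge0 ?(ltW M0).
have s6 (phi : S) : hop w (hop w phi) = Rop ((enorm xi)%:C *: K) (Rop ((enorm xi)%:C *: K) phi).
  by rewrite -!t0E modulus_jet_sqr.1 kap_sqr// !RopZ linearZ /= scalerA -rmorphM expr2.
exact: (pos_sqrt_unique M0 (mulr_gt0 c0 e0) s1 s2 s3 s4 s5 s6).
Qed.

End Jet.

Variables (T' : @operator R n N) (s : int -> 'rV[R]_n -> @operator R n N).
Hypothesis T'E : forall psi : S, T' psi = T psi.
Hypothesis T's : has_symbol theta T' 1 s.

Lemma symbol_homogeneous e t (xi : 'rV[R]_n) (psi : S) : 0 < t -> xi != 0 ->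
  s e (t *: xi) psi = fun p => (t ^ e)%:C *: s e xi psi p.
Proof.
by move=> t0 xi0; have [rho [_ _ _ [hom _] _]] := T's; have [_ _ h1] := hom e; apply: h1 => //; exact: spP.
Qed.

Lemma modulus_symbol_jet (xi : 'rV[R]_n) : 2 <= enorm xi ->
  exists (t0 t1 : S -> S) (tl : 'I_n -> S -> S),
  [/\ hat t0 /\ forall psi : S, s 1 xi psi = t0 psi,
      hat t1,
      forall l, forall psi : S, dxi l (s 1) xi psi = tl l psi &
      forall Nn q, recurrent theta xi Nn q ->
        jet theta Nn q (fun m psi => hN Nn m *: shc (q m) T psi) t0
          (fun psi => t1 psi + \sum_l tl l (Dop l psi))].
Proof.
move=> xi2; have top (e' : int) (eta : 'rV[R]_n) : 1 < e' -> eta != 0 -> op_eq (s e' eta) (fun _ _ => 0).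
  by have [rho [_ _ _ [_ hi] _]] := T's; exact: hi.
have [t0 [t1 [tl [h0 [h1 _] hl hj]]]] := symbol_jet thetaT T's T'E top xi2.
exists t0, t1, tl; split=> // l psi; by have [_] := hl l.
Qed.

Lemma modulus_symbol (xi : 'rV[R]_n) (psi : S) : xi != 0 ->
  s 1 xi psi = spv ((enorm xi)%:C *: Rop K psi).
Proof.
move=> xi0; have [t t0 te] := scale_enorm xi0.
have [|s0 [s1 [sl [[_ E] _ _ hj]]]] := modulus_symbol_jet (xi := t *: xi); first by rewrite te.
have [Nn [q hr]] := recurrence theta (t *: xi).
have lead := modulus_leading hr (hj Nn q hr) psi.
have := E psi; rewrite lead te symbol_homogeneous// expr1z => e1.
apply/funext => p; have := congr1 (fun f => (t^-1)%:C *: f p) e1.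
rewrite !sspZE !scalerA -!rmorphM /= mulVf ?gt_eqF// rmorph1 scale1r => ->.
congr (_%:C *: _); rewrite -te enormZ gtr0_norm// mulrA mulVf ?gt_eqF// mul1r//.
Qed.

Lemma modulus_jet (xi : 'rV[R]_n) : 2 <= enorm xi ->
  exists2 t' : S -> S, onf t' & forall Nn q, recurrent theta xi Nn q ->
    jet theta Nn q (fun m psi => hN Nn m *: shc (q m) T psi)
      (fun psi => (enorm xi)%:C *: Rop K psi) t'.
Proof.
move=> xi2; have xi0 : xi != 0 by rewrite -enorm_gt0; apply: lt_le_trans xi2.
have [t0 [t1 [tl [[_ t0E] ht1 tlE hj]]]] := modulus_symbol_jet xi2.
have [Nn [q hr]] := recurrence theta xi.
have c0 : (enorm xi)%:C != 0 :> R[i] by rewrite fmorph_eq0 gt_eqF// enorm_gt0.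
have t0K : t0 =1 fun psi => (enorm xi)%:C *: Rop K psi.
  by move=> psi; exact: modulus_leading hr (hj _ _ hr) psi.
(* Differentiating the leading symbol requires its value in a neighbourhood of [xi], which
   [modulus_symbol] supplies. *)
have tlK l : tl l =1 fun psi => ('D_(delta_mx 0 l) enorm xi)%:C *: Rop K psi.
  move=> psi; apply: sspinor_eq => m; rewrite -tlE.
  rewrite (@dxi_lincomb _ _ _ 1 _ (fun=> enorm) (fun=> Rop K))// => [|eta chi eta0|_].
  - by rewrite big_ord1.
  - by rewrite big_ord1; exact: modulus_symbol.
  - exact: derivable_enorm.
have pK : pword (Rop K : S -> S) := pword_Rop pwK.
pose U (psi : S) := \sum_l tl l (Dop l psi).
have onfU : onf U.
  apply: onf_sum => l; apply: (@onf_eq _ _ _ _ _ _ (fun psi => ('D_(delta_mx 0 l) enorm xi)%:C *: Rop K (Dop l psi))).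
    by move=> psi; rewrite tlK.
  exact: onfZ (onf_pword kh hk pK (onf_Dop k h l)).
(* In the first-order part of [T^2 = D_k^2], everything but [K t1 + t1 K] belongs to [onf]. This sum
   therefore does so too; as it contains no derivation, [onf_hat] puts it into [tnul]. *)
have t1tnul : tnul t1.
  apply: tnul_anticomm => //; apply: onf_hat => //.
    apply: hatD; first exact: (hat_comp (hat_Rop _) ht1).
    exact: (hat_comp ht1 (hat_Rop _)).
  have [_ E1] := modulus_jet_sqr hr (hj _ _ hr).
  have onfE : onf (fun psi => kap xi (Dk psi) + Dk (kap xi psi)).
    apply: onfD; last exact: onf_Dk_kap.
    by apply: onf_pword => //; [exact: pword_kap | exact: onf_Dk].
  have onfE2 : onf (fun psi => Rop K (U psi) + U (Rop K psi)).
    apply: onfD; first exact: onf_pword.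
    by apply: onf_Rop => //; exact: pwK.
  apply: onf_eq (onfD (onfZ kh hk ((enorm xi)%:C)^-1 onfE) (onfN onfE2)) => psi /=.
  have lt1 := hat_linear ht1; have lU : linear U.
    move=> c u v; rewrite /U scaler_sumr -big_split; apply: eq_bigr => l _.
    by rewrite !tlK !linearP /= !scalerA mulrC -!scalerA.
  have Uc chi : \sum_l tl l (Dop l chi) = U chi by [].
  rewrite -E1 !t0K !Uc (linearfZ _ _ lU) (linearfZ _ _ lt1) -!scalerDr scalerA mulVf// scale1r.
  by rewrite linearD addrACA addrK.
exists (fun psi => t1 psi + U psi) => [|Nn' q' hr'].
  exact: onfD (onf_tnul t1tnul) onfU.
by apply: jet_eqs (hj _ _ hr').
Qed.

End Modulus.

(** * The symbol of order -n *)

Section Residue.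
Context {R : realType} {n N : nat}.
Variable theta : 'M[R]_n.
Hypothesis thetaT : theta^T = - theta.
Hypothesis theta_irr : strictly_irrational theta.
Local Notation Z := 'rV[int]_n.
Local Notation A := (ncalg theta).
Local Notation S := (sspinor R n N).
Local Notation hat := (@hat R n N theta).
Variable gamma : 'I_n -> 'M[R[i]]_N.
Variables (k h : A).
Hypothesis kh : k * h = 1.
Hypothesis hk : h * k = 1.
Hypothesis k_pos : forall a : Z -> R[i], smooth a -> 0 <= csum (fun m => (a m)^* * Defs.mulA theta a k m).
Local Notation pw := (pw k h).
Local Notation onf := (@onf R n N theta k h).
Local Notation tnul := (@tnul R n N theta k h).
Local Notation pword := (@pword R n N theta k h).
Local Notation Dk := (Dk gamma k).
Local Notation kap := (kap gamma k).
Local Notation K := (k * k).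
Local Notation H := (h * h).
Variables (T B : {linear S -> S}) (U : S -> S).
Hypothesis T_jet : forall xi : 'rV[R]_n, 2 <= enorm xi ->
  exists2 t' : S -> S, onf t' & forall Nn q, recurrent theta xi Nn q ->
    jet theta Nn q (fun m psi => hN Nn m *: shc (q m) T psi)
      (fun psi => (enorm xi)%:C *: Rop K psi) t'.
Hypothesis U_pword : pword U.
Hypothesis UDB : forall psi, U (Dk (B (iter n T psi))) = U (Dk psi).
Local Notation P := (fun psi => U (Dk (B psi))).
Variables (P' : @operator R n N) (d : int) (s : int -> 'rV[R]_n -> @operator R n N).
Hypothesis P'E : forall psi : S, P' psi = P psi.
Hypothesis P's : has_symbol theta P' d s.

Let P_linear : linear P.
Proof. by move=> c u v; rewrite !linearP (hat_linear (pword_hat U_pword)). Qed.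

Lemma HKn m : H ^+ m * K ^+ m = 1.
Proof.
have HK : H * K = 1 by rewrite -mulrA (mulrA h k) hk mul1r hk.
elim: m => [|m IH]; first by rewrite !expr0 mulr1.
by rewrite exprSr exprS -mulrA (mulrA H) HK mul1r.
Qed.

Lemma pwKn m : pw (K ^+ m). Proof. by apply: pwX => //; apply: pwM => //; exact: pwk. Qed.

Lemma pwHn m : pw (H ^+ m). Proof. by apply: pwX => //; apply: pwM => //; exact: pwh. Qed.

Lemma hNX Nn m r : hN Nn m ^+ r = ((Nn m)%:R ^ (- r%:Z))%:C :> R[i].
Proof. by rewrite /hN -rmorphXn /= -exprnN exprVn. Qed.

(** The leading coefficients are right multiplications by powers of [k], so both terms of the
    Leibniz rule stay in [onf]: one by [onf_pword], the other by [onf_Rop]. *)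
Lemma modulus_pow_jet (xi : 'rV[R]_n) m : 2 <= enorm xi ->
  exists2 C : S -> S, onf C & forall Nn q, recurrent theta xi Nn q ->
    jet theta Nn q (fun r psi => hN Nn r ^+ m *: shc (q r) (iter m T) psi)
      (fun psi => (enorm xi ^+ m)%:C *: Rop (K ^+ m) psi) C.
Proof.
move=> xi2; have [t' onft jT] := T_jet xi2; elim: m => [|m [C onfC jC]].
  exists (fun=> 0) => [|Nn q hr]; first exact: onf_tnul (tnul0 k h).
  apply: jet_eqs (jet_eq _ (jet_id theta Nn q)) => [psi|psi|r psi] //.
  - by rewrite !expr0 scale1r Rop1.
  - by rewrite expr0 scale1r shc_id.
exists (fun psi => (enorm xi)%:C *: Rop K (C psi) + t' ((enorm xi ^+ m)%:C *: Rop (K ^+ m) psi)).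
  have pK : pword (Rop K : S -> S) by apply: pword_Rop; rewrite -[K]expr1; exact: pwKn.
  apply: onfD; first exact: onfZ (onf_pword kh hk pK onfC).
  have [X0 [Y [hX0 hY E]]] := onft.
  have lt' : linear t'.
    have lX := hat_linear hX0.1 => c u v; rewrite !E lX scalerDr addrACA; congr (_ + _).
    rewrite scaler_sumr -big_split; apply: eq_bigr => l _.
    by rewrite linearP (hat_linear (pword_hat (hY l))).
  apply: (@onf_eq _ _ _ _ _ _ (fun psi => (enorm xi ^+ m)%:C *: t' (Rop (K ^+ m) psi))).
    by move=> psi; rewrite (linearfZ _ _ lt').
  exact: onfZ (onf_Rop thetaT theta_irr kh hk k_pos onft (pwKn m)).
move=> Nn q hr; have [Ngt _ qr] := hr.
apply: jet_eqs (jet_eq _ (jet_comp thetaT Ngt qr (jT _ _ hr) (jC _ _ hr))) => [psi|psi|r psi] //.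
- by rewrite [Rop K _]linearZ /= -RopM -exprSr scalerA -rmorphM -exprS.
- by rewrite (linearfZ _ _ (shc_linear _ T)) shc_comp scalerA -exprS.
Qed.

Lemma symbol_scale e t (xi : 'rV[R]_n) (psi : S) : 0 < t -> xi != 0 ->
  s e xi psi = fun p => (t ^ (- e))%:C *: s e (t *: xi) psi p.
Proof.
move=> t0 xi0; have [rho [_ _ _ [hom _] _]] := P's; have [_ _ h1] := hom e.
apply/funext => p; rewrite h1//; last exact: spP.
by rewrite scalerA -rmorphM -expfzDr ?gt_eqF// addNr expr0z rmorph1 scale1r.
Qed.

Lemma shc_scaled_product e Nn (q : nat -> Z) m (psi : S) :
  ((Nn m)%:R ^ (- e))%:C *: shc (q m) P (hN Nn m ^+ n *: shc (q m) (iter n T) psi) =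
  ((Nn m)%:R ^ (- e))%:C *: (hN Nn m ^+ n *: shc (q m) (fun psi => U (Dk psi)) psi).
Proof.
have lS : linear (shc (q m) P) by move=> c u v; rewrite /shc linearP P_linear linearP.
rewrite (linearfZ _ _ lS) shc_comp; congr (_ *: (_ *: _)).
by rewrite /shc UDB.
Qed.

(** Descent from the nominal order [d], whatever it is. If all components above [e'] vanish and
    [1 - n < e'], then [P T^n] has order [e' + n >= 2] unless its leading coefficient is 0, whereas
    [U D_k] has order 1; since [K^n] is invertible, the component of degree [e'] vanishes. *)
Lemma symbol_top e (eta : 'rV[R]_n) : 1 - n%:Z < e -> eta != 0 -> op_eq (s e eta) (fun _ _ => 0).
Proof.
suff main m (e' : int) (eta' : 'rV[R]_n) : d - m%:Z < e' -> 1 - n%:Z < e' -> eta' != 0 ->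
    op_eq (s e' eta') (fun _ _ => 0).
  by apply: (main `|d - e|.+1%N); lia.
elim: m e' eta' => [|m IH] e' eta' de ne eta0.
  have [rho [_ _ _ [_ hi] _]] := P's; apply: hi => //; lia.
have top (e'' : int) (z : 'rV[R]_n) : e' < e'' -> z != 0 -> op_eq (s e'' z) (fun _ _ => 0).
  by move=> h1 z0; apply: IH => //; lia.
have [t t0 te] := scale_enorm eta0.
have te2 : 2 <= enorm (t *: eta') by rewrite te.
have [p0 [p1 [pl [[hp0 p0E] _ _ jP]]]] := symbol_jet thetaT P's P'E top te2.
have [C _ jC] := modulus_pow_jet n te2.
have [Nn [q hr]] := recurrence theta (t *: eta'); have [Ngt _ qr] := hr.
(* One power of [hN] normalizes [D_k]; the remaining [r.+1], at least one, kill the leading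
   coefficient. *)
have [r hre] : exists r : nat, e' + n%:Z = r.+2%:Z by exists (absz (e' + n%:Z)%R - 2)%N; lia.
have [s'' J2] := jet_hXZ thetaT Ngt qr r (jet_comp thetaT Ngt qr (jet_hat Nn q (pword_hat U_pword)) (jet_Dk thetaT gamma k hr)).
have J1 := jet_comp thetaT Ngt qr (jP _ _ hr) (jC _ _ hr).
have E0 m' (psi : S) : hN Nn m' ^+ r.+1 *: shc (q m') U (hN Nn m' *: shc (q m') Dk psi) =
   ((Nn m')%:R ^ (- e'))%:C *: shc (q m') P (hN Nn m' ^+ n *: shc (q m') (iter n T) psi).
  rewrite shc_scaled_product (linearfZ _ _ (hat_shc_lin (q m') (pword_hat U_pword))) shc_comp !scalerA.
  congr (_ *: _); rewrite -exprSr !hNX -rmorphM -expfzDr ?(Nn_neq0 Ngt)//; congr ((_ ^ _)%:C); lia.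
have [E1 _] := jet_unique thetaT Ngt qr J1 (jet_eq E0 J2).
have c0 : (enorm (t *: eta') ^+ n)%:C != 0 :> R[i] by rewrite te fmorph_eq0 expf_neq0// pnatr_eq0.
have p00 psi : p0 psi = 0.
  rewrite -(E1 ((enorm (t *: eta') ^+ n)%:C^-1 *: Rop (H ^+ n) psi)).
  by rewrite [Rop (K ^+ n) _]linearZ /= scalerA mulfV// scale1r -RopM HKn Rop1.
move=> psi hpsi; rewrite (symbol_scale _ (SSpinor _ hpsi) t0 eta0) p0E p00.
by apply/funext => p; rewrite scaler0.
Qed.

Lemma UDk_jet (xi : 'rV[R]_n) Nn q : recurrent theta xi Nn q ->
  jet theta Nn q (fun m psi => shc (q m) U (hN Nn m *: shc (q m) Dk psi))
    (fun psi => U (kap xi psi)) (fun psi => U (Dk psi)).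
Proof.
move=> hr; have [Ngt _ qr] := hr.
apply: jet_eqs (jet_comp thetaT Ngt qr (jet_hat Nn q (pword_hat U_pword)) (jet_Dk thetaT gamma k hr)) => // psi.
by rewrite addr0.
Qed.

Lemma residue_jets (xi : 'rV[R]_n) : 2 <= enorm xi ->
  exists (p0 p1 : S -> S) (pl : 'I_n -> S -> S),
  [/\ forall psi : S, s (1 - n%:Z) xi psi = p0 psi,
      hat p1 /\ forall psi : S, s (- n%:Z) xi psi = p1 psi,
      forall l (psi : S), dxi l (s (1 - n%:Z)) xi psi = pl l psi,
      forall psi, p0 ((enorm xi ^+ n)%:C *: Rop (K ^+ n) psi) = U (kap xi psi) &
      exists2 C : S -> S, onf C & forall psi,
        p0 (C psi) + (p1 ((enorm xi ^+ n)%:C *: Rop (K ^+ n) psi) +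
          \sum_l pl l (Dop l ((enorm xi ^+ n)%:C *: Rop (K ^+ n) psi))) = U (Dk psi)].
Proof.
move=> xi2.
have [p0 [p1 [pl [[hp0 p0E] [hp1 p1E] plE jP]]]] := symbol_jet thetaT P's P'E (fun e' z h1 h2 => symbol_top h1 h2) xi2.
have [C onfC jC] := modulus_pow_jet n xi2.
have [Nn [q hr]] := recurrence theta xi; have [Ngt _ qr] := hr.
have J1 := jet_comp thetaT Ngt qr (jP _ _ hr) (jC _ _ hr).
have E0 m' (psi : S) : shc (q m') U (hN Nn m' *: shc (q m') Dk psi) =
   ((Nn m')%:R ^ (- (1 - n%:Z)))%:C *: shc (q m') P (hN Nn m' ^+ n *: shc (q m') (iter n T) psi).
  rewrite shc_scaled_product (linearfZ _ _ (hat_shc_lin (q m') (pword_hat U_pword))) shc_comp !scalerA.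
  congr (_ *: _); rewrite -[LHS]expr1 !hNX -rmorphM -expfzDr ?(Nn_neq0 Ngt)//; congr ((_ ^ _)%:C); lia.
have [E1 E2] := jet_unique thetaT Ngt qr J1 (jet_eq E0 (UDk_jet hr)).
exists p0, p1, pl; split=> //.
- by split=> // psi; rewrite -p1E; congr (s _ xi psi); lia.
- by move=> l psi; have [_] := plE l.
- by exists C.
Qed.

Lemma U_linear : linear U. Proof. exact: hat_linear (pword_hat U_pword). Qed.

Lemma pword_leading c xi : pword (fun psi => U (kap xi (c *: Rop (H ^+ n) psi))).
Proof.
apply: pword_comp => //; apply: (pword_comp kh hk (pword_kap _ kh hk _)).
by apply: pwordZ => //; apply: pword_Rop; exact: pwHn.
Qed.

Lemma symbol_leading (eta : 'rV[R]_n) (psi : S) : eta != 0 ->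
  s (1 - n%:Z) eta psi = spv (U (kap eta ((enorm eta ^- n)%:C *: Rop (H ^+ n) psi))).
Proof.
move=> eta0; have [t t0 te] := scale_enorm eta0.
have te2 : 2 <= enorm (t *: eta) by rewrite te.
have [p0 [p1 [pl [p0E _ _ E _]]]] := residue_jets te2.
rewrite (symbol_scale _ _ t0 eta0) p0E.
have c0 : enorm eta != 0 by rewrite gt_eqF// enorm_gt0.
have tn0 : t != 0 by rewrite gt_eqF.
(* [K^n] is inverted by [H^n], which brings [psi] into the form on which [p0] is known. *)
have -> : psi = (enorm (t *: eta) ^+ n)%:C *: Rop (K ^+ n) ((enorm (t *: eta) ^- n)%:C *: Rop (H ^+ n) psi).
  by rewrite [Rop (K ^+ n) _]linearZ /= scalerA -rmorphM mulfV ?rmorph1 ?scale1r -?RopM ?HKn ?Rop1// te expf_neq0.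
rewrite E kapZ !kapZr !(linearfZ _ _ U_linear) te.
have -> : Rop (H ^+ n) ((2 ^+ n)%:C *: Rop (K ^+ n) ((2 ^- n)%:C *: Rop (H ^+ n) psi)) = Rop (H ^+ n) psi.
  congr (Rop _ _); rewrite [Rop (K ^+ n) _]linearZ /= scalerA -rmorphM mulfV ?expf_neq0// rmorph1 scale1r.
  by rewrite -RopM HKn Rop1.
apply/funext => p; rewrite !sspZE !scalerA -!rmorphM; congr (_%:C *: _).
rewrite -te enormZ gtr0_norm// exprMn invfM.
have -> : t ^ (- (1 - n%:Z)) = t ^+ n * t^-1 by rewrite opprB expfzDr.
field; rewrite expf_neq0// tn0 expf_neq0//.
Qed.

(** The first-order equation is solved for the term containing [p1]. The other terms lie in [onf],
    since the leading symbol and its derivatives are words in [A], matrices and powers of [k]; the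
    term with [p1] contains no derivation and so belongs to [tnul]. Multiplication by [H^n] then
    isolates [p1]. *)
Lemma symbol_residue (xi : 'rV[R]_n) : 2 <= enorm xi ->
  exists2 X : S -> S, tnul X & forall psi : S, s (- n%:Z) xi psi = X psi.
Proof.
move=> xi2; have [p0 [p1 [pl [p0E [hp1 p1E] plE _ [C onfC E]]]]] := residue_jets xi2.
have xi0 : xi != 0 by rewrite -enorm_gt0; apply: lt_le_trans xi2.
have c0 : (enorm xi ^+ n)%:C != 0 :> R[i] by rewrite fmorph_eq0 expf_neq0// gt_eqF// enorm_gt0.
exists p1 => //.
have hp0 : pword p0.
  by apply: pword_eq (pword_leading (enorm xi ^- n)%:C xi) => psi; apply: sspinor_eq => m; rewrite -p0E symbol_leading.
(* The leading symbol depends on [eta] through these scalar functions only: [gamma(eta)] divided by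
   [|eta|^n]. *)
pose f (j : 'I_n) (eta : 'rV[R]_n) := enorm eta ^- n * eta 0 j.
have fd j l : derivable (f j) xi (delta_mx 0 l).
  apply: derivableM; last exact: derivable_coord.
  apply: derivableV; first by rewrite expf_neq0// gt_eqF// enorm_gt0.
  have -> : (fun y : 'rV[R]_n => enorm y ^+ n) = enorm ^+ n by apply/funext => y; rewrite fctE.
  by apply: derivableX; exact: derivable_enorm.
pose X (j : 'I_n) (psi : S) := U (Rop K (Mop (gamma j) (Rop (H ^+ n) psi))).
have pX j : pword (X j).
  apply: pword_comp => //; apply: pword_comp => //; first by apply: pword_Rop; rewrite -[K]expr1; exact: pwKn.
  by apply: (pword_comp kh hk (pword_Mop k h (gamma j))); apply: pword_Rop; exact: pwHn.
have sX eta (psi : S) : eta != 0 -> s (1 - n%:Z) eta psi = spv (\sum_j (f j eta)%:C *: X j psi).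
  move=> eta0; rewrite symbol_leading//; congr spv; rewrite kap_sum.
  have Us (F : 'I_n -> S) : U (\sum_j F j) = \sum_j U (F j).
    apply: (big_morph U) => [u v|]; first exact: linearfD U_linear.
    by have := linearfZ 0 0 U_linear; rewrite !scale0r.
  rewrite Us; apply: eq_bigr => j _; rewrite (linearfZ _ _ U_linear) !linearZ /= (linearfZ _ _ U_linear).
  by rewrite scalerA -rmorphM mulrC.
have hpl l : pword (pl l).
  apply: (@pword_eq _ _ _ _ _ _ (fun psi => \sum_j ('D_(delta_mx 0 l) (f j) xi)%:C *: X j psi)).
    by move=> psi; apply: sspinor_eq => m; rewrite -plE (dxi_lincomb xi0 sX).
  by apply: pword_sum => j; exact: pwordZ.
have tn : tnul (fun psi => p1 ((enorm xi ^+ n)%:C *: Rop (K ^+ n) psi)).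
  apply: onf_hat => //.
    by apply: (hat_comp hp1); apply: hatZ; exact: hat_Rop.
  have o1 : onf (fun psi => U (Dk psi)) by apply: (onf_pword kh hk U_pword); exact: onf_Dk.
  have o2 : onf (fun psi => p0 (C psi)) := onf_pword kh hk hp0 onfC.
  have o3 : onf (fun psi => \sum_l pl l (Dop l ((enorm xi ^+ n)%:C *: Rop (K ^+ n) psi))).
    apply: onf_sum => l; apply: (@onf_eq _ _ _ _ _ _ (fun psi => (enorm xi ^+ n)%:C *: pl l (Dop l (Rop (K ^+ n) psi)))).
      by move=> psi; rewrite linearZ (linearfZ _ _ (hat_linear (pword_hat (hpl l)))).
    apply: onfZ => //; apply: (onf_pword kh hk (hpl l)).
    exact: (onf_Rop thetaT theta_irr kh hk k_pos (onf_Dop k h l) (pwKn n)).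
  apply: onf_eq (onfD o1 (onfN kh hk (onfD o2 o3))) => psi /=.
  by rewrite -E opprD addrACA subrr add0r addrK.
have := tnul_pword kh hk (pwordZ kh hk (enorm xi ^+ n)%:C^-1 (pword_id k h)) (tnul_Rop thetaT theta_irr kh hk tn (pwHn n)).
apply: tnul_eq => psi.
by rewrite (linearfZ _ _ (hat_linear hp1)) scalerA mulVf// scale1r -RopM HKn Rop1.
Qed.

Lemma tauTr_symbol (xi : 'rV[R]_n) : xi != 0 -> tauTr theta (s (- n%:Z) xi) = 0.
Proof.
move=> xi0; have [t t0 te] := scale_enorm xi0.
have te2 : 2 <= enorm (t *: xi) by rewrite te.
have [X [hX tX] XE] := symbol_residue te2.
have := tX 1 1 1%:M (pw1 k h) => t1.
have t2 : trv theta (fun psi => (t ^ n%:Z)%:C *: X psi) 0.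
  rewrite -[X in trv _ _ X](mulr0 (t ^ n%:Z)%:C); apply: trvZ; apply: trv_eq t1 => psi.
  by rewrite Rop1 Mop_scalar scale1r Lop1.
apply: (tauTr_trv thetaT theta_irr _ t2) => psi.
by rewrite (symbol_scale _ _ t0 xi0) XE opprK.
Qed.

End Residue.

(** * From operators on families to maps of smooth spinors; inverse powers; the sphere integral *)

Section Lift.
Context {R : realType} {n N : nat}.
Local Notation S := (sspinor R n N).
Variables (T : @operator R n N) (T_lin : linear_smooth T).

Definition lift (psi : S) : S := SSpinor _ (T_lin.1 psi (spP psi)).

Lemma liftE (psi : S) : T psi = lift psi. Proof. by []. Qed.

Fact lift_linear : linear lift.
Proof.
move=> c u v; apply: sspinor_eq => m.
by have := T_lin.2 c u v (spP u) (spP v) => /(congr1 (fun f => f m)).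
Qed.
HB.instance Definition _ := GRing.isLinear.Build R[i] S S *:%R lift lift_linear.

Lemma iter_lift m (psi : S) : iter m T psi = iter m lift psi.
Proof. by elim: m => [|m IH] //; rewrite !iterS IH. Qed.

End Lift.

Section InversePower.
Context {R : realType} {n N : nat}.
Local Notation S := (sspinor R n N).
Variables T D : {linear S -> S}.
Hypothesis T_sym : forall phi psi : S, inner (T phi) psi = inner phi (T psi).
Hypothesis D_sym : forall phi psi : S, inner (D phi) psi = inner phi (D psi).
Hypothesis T_sqr : forall psi, T (T psi) = D (D psi).

(** By symmetry [|T^(m+1) psi|^2] is the inner product of [T^m psi] with [T^(m+2) psi]. *)
Lemma iter_sym_ker m psi : iter m.+1 T psi = 0 -> T psi = 0.
Proof.
elim: m => // m IH TT; apply: IH; apply: rip_eq0.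
by rewrite iterS /rip T_sym -iterS -iterS TT inner0r.
Qed.

Lemma sym_ker psi : T psi = 0 -> D psi = 0.
Proof. by move=> T0; apply: rip_eq0; rewrite /rip D_sym -T_sqr T0 linear0 inner0r. Qed.

Lemma iter_linear m : linear (iter m T).
Proof. by elim: m => [|m IH] c u v //; rewrite !iterS IH linearP. Qed.

(** [B T^m] is the identity only up to the kernel of [T], and [D] on the left removes the
    difference. Since [m] is positive, [T^m psi] lies in the range of [T] and is orthogonal to the
    kernel; so [T^m] kills [B T^m psi - psi], and by symmetry so do [T] and [D]. *)
Lemma inverse_power_cancel (B : S -> S) m : (0 < m)%N ->
  (forall psi : S, (forall phi : S, T phi = 0 -> inner phi psi = 0) -> iter m T (B psi) = psi) ->
  forall psi, D (B (iter m T psi)) = D psi.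
Proof.
case: m => // m _ hB psi; apply/eqP; rewrite -subr_eq0 -linearB; apply/eqP/sym_ker.
apply: (@iter_sym_ker m); rewrite -scaleN1r addrC (iter_linear m.+1) hB ?scaleN1r ?addNr// => phi T0.
by rewrite iterS -T_sym T0 inner0l.
Qed.

End InversePower.

Section SphereIntegral.
Context {R : realType}.

Lemma integral_rV0 n : integral_rV (fun _ : 'rV[R]_n => 0 : R) = 0.
Proof.
elim: n => //= n IH; under [X in Rintegral _ _ X]eq_fun do rewrite IH.
by rewrite /Rintegral integral0.
Qed.

Lemma sphere_integral0 n (f : 'rV[R]_n -> R[i]) : (forall xi, xi != 0 -> f xi = 0) ->
  sphere_integral f = 0.
Proof.
move=> f0; have key (g : R[i] -> R) : g 0 = 0 -> sphere_rintegral (fun xi => g (f xi)) = 0.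
  move=> g0; rewrite /sphere_rintegral -[RHS](mulr0 n%:R); congr (_ * _); rewrite -[RHS](integral_rV0 n).
  congr integral_rV; apply/funext => x; case: ifP => // /andP[x0 _]; rewrite f0//.
  by rewrite scaler_eq0 negb_or invr_eq0 gt_eqF// -enorm_gt0.
by rewrite /sphere_integral !key.
Qed.

End SphereIntegral.

Theorem corollary4p2 (R : realType) (n N : nat) (theta : 'M[R]_n)
    (gamma : 'I_n -> 'M[R[i]]_N) (k : 'rV[int]_n -> R[i])
    (absDk absDk_n : @operator R n N)
    (n_gt0 : (0 < n)%N)
    (theta_antisym : theta^T = - theta)
    (theta_irr : strictly_irrational theta)
    (gammaP : gamma_matrices gamma)
    (k_smooth : smooth k)
    (k_pos : positive_invertible theta k)
    (absDkP : is_modulus (conformal_dirac theta gamma k) absDk)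
    (absDk_psido : psido theta 1 absDk)
    (absDk_nP : is_inverse_power absDk n absDk_n) :
  forall u v w : @operator R n N,
    one_form theta (conformal_dirac theta gamma k) u ->
    one_form theta (conformal_dirac theta gamma k) v ->
    one_form theta (conformal_dirac theta gamma k) w ->
    spectral_torsion theta (conformal_dirac theta gamma k) absDk_n u v w = 0.
Proof.
move=> u v w hu hv hw.
have [kpos [h [h_smooth kh' hk']]] := k_pos.
pose kA := NCAlg theta k_smooth; pose hA := NCAlg theta h_smooth.
have kh : kA * hA = 1 by apply: ncalg_eq => m; rewrite ncME kh'.
have hk : hA * kA = 1 by apply: ncalg_eq => m; rewrite ncME hk'.
have [Tlin Tsym Tpos Tsqr] := absDkP; have [Blin _ BT] := absDk_nP.
have DE := conformal_diracE gamma kA.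
have kApos : forall a : 'rV[int]_n -> R[i], smooth a -> 0 <= csum (fun m => (a m)^* * Defs.mulA theta a kA m).
  exact: kpos.
have DkS := Dk_sym gammaP kApos.
pose T := lift Tlin; pose B := lift Blin; pose D := Dk gamma kA.
have T_sym (phi psi : sspinor R n N) : inner (T phi) psi = inner phi (T psi).
  exact: Tsym (spP phi) (spP psi).
have T_pos (psi : sspinor R n N) : 0 <= inner psi (T psi) := Tpos _ (spP psi).
have T_sqr psi : T (T psi) = D (D psi).
  have e : absDk (absDk psi) = spv (D (D psi)) by rewrite (Tsqr _ (spP psi)) [conformal_dirac _ _ _ psi]DE DE.
  by apply: sspinor_eq => m; exact: (congr1 (fun f => f m) e).
have [U1 pU1 uE] := one_form_pword kh hk hu.
have [U2 pU2 vE] := one_form_pword kh hk hv.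
have [U3 pU3 wE] := one_form_pword kh hk hw.
have pU : pword kA hA (fun psi => U1 (U2 (U3 psi))).
  exact: (pword_comp kh hk pU1 (pword_comp kh hk pU2 pU3)).
have TB (psi : sspinor R n N) :
    (forall phi : sspinor R n N, T phi = 0 -> inner phi psi = 0) -> iter n T (B psi) = psi.
  move=> hpsi; have [|_ e] := BT psi (spP psi).
    move=> phi hphi Tphi; apply: (hpsi (SSpinor _ hphi)).
    by apply: sspinor_eq => m; exact: (congr1 (fun f => f m) Tphi).
  by apply: sspinor_eq => m; rewrite -(iter_lift Tlin); exact: (congr1 (fun f => f m) e).
have UDB psi : U1 (U2 (U3 (D (B (iter n T psi))))) = U1 (U2 (U3 (D psi))).
  congr (U1 (U2 (U3 _))).
  exact: (@inverse_power_cancel _ _ _ (lift Tlin) (Dk gamma kA) T_sym DkS T_sqr B n n_gt0 TB psi).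
have [sT hT] := absDk_psido.
have T_jet xi := @modulus_jet _ _ _ _ theta_antisym theta_irr _ gammaP _ _ kh hk kApos T T_sym T_pos T_sqr
   absDk sT (liftE Tlin) hT xi.
(* If the product has no classical symbol, the default value of [xget] is already 0. Otherwise the
   integrand vanishes for whichever symbol was chosen. *)
rewrite /spectral_torsion /Wres; case: xgetP => // r _ [d [s [hs ->]]].
apply: sphere_integral0 => xi xi0.
apply: (tauTr_symbol theta_antisym theta_irr kh hk kApos T_jet pU UDB _ hs xi0) => psi.
by rewrite /= [absDk_n psi]liftE DE wE vE uE.
Qed.
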